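(* Let $\pi_0$ be a Borel probability measure on the separable Banach space $X$, and assume: (i) $y\in Y_0$; (ii) $\mathcal G:X\to Y_0$ is $\pi_0$-almost surely continuous with respect to the $L^2(D;L^2(T))$ norm on $Y_0$; (iii) there exists an increasing function $R_{\mathcal G}:[0,\infty)\to[0,\infty)$ such that $\|\mathcal G(u)\|_{L^\infty(D;L^\infty(T))}\le R_{\mathcal G}(\|u\|_X)$ for all $u\in X$. Then for any choice $\Phi\in\{\Phi_{L^2},\Phi_{\dot H^{-1}},\Phi_M,\Phi_{W_2}\}$, the quantity $$Z_\Phi(y)=\int_X \exp(-\Phi(u;y))\,\pi_0(\mathrm{d}u)$$ is strictly positive and finite, and $$\pi_\Phi^y(\mathrm{d}u):=\frac{1}{Z_\Phi(y)}\exp(-\Phi(u;y))\,\pi_0(\mathrm{d}u)$$ defines a Radon probability measure on $X$.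
   Context: $(X,\|\cdot\|_X)$ is a separable Banach space; $(D,\mathcal D,\lambda)$ is a finite measure space; $T\subset\mathbb R^p$ is a compact connected set of positive Lebesgue measure $|T|$ on which the Poincaré inequality holds for mean-zero functions. $L^p$ spaces over $D$ are with respect to $\lambda$, those over $T$ with respect to Lebesgue measure; elements of $L^\infty(D;L^\infty(T))$ are regarded as functions on $D\times T$. $Y_0=\{y\in L^\infty(D;L^\infty(T)) : \int_T y(x,t)\,\mathrm{d}t=0 \text{ for all } x\in D\}$. For mean-zero $h$ on $T$, $\|h\|_{\dot H^{-1}(T)}=\sup\{\int_T h\varphi\,\mathrm{d}t : \|\nabla\varphi\|_{L^2(T)}\le 1\}$, and $\|h\|_{L^2(D;\dot H^{-1}(T))}^2=\int_D\|h(x,\cdot)\|_{\dot H^{-1}(T)}^2\,\lambda(\mathrm{d}x)$. For probability densities $f,g$ on $T$, $W_2(f,g)$ is the quadratic Wasserstein distance between the measures $f\,\mathrm{d}t$ and $g\,\mathrm{d}t$: $W_2(f,g)^2=\inf_S\int_T|t-S(t)|^2 f(t)\,\mathrm{d}t$, with the infimum over measurable $S:T\to T$ pushing $f\,\mathrm{d}t$ forward to $g\,\mathrm{d}t$. $\sigma:\mathbb R\to(0,\infty)$ is a fixed locally Lipschitz function, and for $y:D\times T\to\mathbb R$, $$(P_\sigma y)(x,t)=\frac{\sigma(y(x,t))}{\int_T\sigma(y(x,t'))\,\mathrm{d}t'}.$$ For a map $\mathcal G:X\to Y_0$ the four potentials, for $u\in X$ and $y\in Y_0$, are $$\Phi_{L^2}(u;y)=\tfrac12\int_D\|\mathcal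 G(u)(x,\cdot)-y(x,\cdot)\|_{L^2(T)}^2\,\lambda(\mathrm{d}x),$$ $$\Phi_{\dot H^{-1}}(u;y)=\tfrac12\int_D\|\mathcal G(u)(x,\cdot)-y(x,\cdot)\|_{\dot H^{-1}(T)}^2\,\lambda(\mathrm{d}x),$$ $$\Phi_M(u;y)=\tfrac12\int_D\left\|\frac{(P_\sigma\mathcal G(u))(x,\cdot)-(P_\sigma y)(x,\cdot)}{(P_\sigma y)(x,\cdot)}\right\|_{L^2(T)}^2\,\lambda(\mathrm{d}x),$$ $$\Phi_{W_2}(u;y)=\tfrac12\int_D W_2\big((P_\sigma\mathcal G(u))(x,\cdot),(P_\sigma y)(x,\cdot)\big)^2\,\lambda(\mathrm{d}x).$$ *)

(* Defs.v *)
From HB Require Import structures.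
From mathcomp Require Import all_boot all_order all_algebra.
From mathcomp Require Import all_classical all_reals all_analysis.
From mathcomp Require Import measurable_realfun.

Set Implicit Arguments.
Unset Strict Implicit.
Unset Printing Implicit Defensive.

Import Order.TTheory GRing.Theory Num.Def Num.Theory.
Import numFieldNormedType.Exports.

Local Open Scope classical_set_scope.
Local Open Scope ring_scope.

Section borel_rV.
Context {R : realType} {n : nat}.

(* 'rV[R]_n carries its Borel sigma-algebra. *)
HB.instance Definition _ := @isMeasurable.Build
  (sigma_display (@open 'rV[R]_n)) 'rV[R]_n <<s @open 'rV[R]_n >>
  (@sigma_algebra0 _ setT _) (@sigma_algebraC _ _)
  (@sigma_algebra_bigcup _ setT _).

Lemma measurable_coord (i : 'I_n) :
  measurable_fun [set: 'rV[R]_n] (fun v : 'rV[R]_n => v 0 i).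
Proof.
apply: (measurability _ (RGenOpens.measurableE R)) => _ [_ [a [b ->]] <-].
apply: sub_sigma_algebra; rewrite setTI.
apply: open_comp; last exact: interval_open.
by move=> v _; exact: coord_continuous.
Qed.

Definition rat_box (q : 'rV[rat]_n * nat) : set 'rV[R]_n :=
  [set v | forall i, `|v 0 i - ratr (q.1 0 i)| < q.2.+1%:R^-1].

Lemma open_rat_box (O : set 'rV[R]_n) : open O ->
  O = \bigcup_(q in [set q | rat_box q `<=` O]) rat_box q.
Proof.
move=> oO; apply/seteqP; split; last by move=> v [q qO /qO].
move=> v Ov; have /nbhs_ballP[e /= e0 eO] : nbhs v O by exact: open_nbhs_nbhs.
have [k ke] : exists k, k.+1%:R^-1 < e / 2.
  have e20 : 0 < e / 2 by rewrite divr_gt0.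
  have [k _ /(_ k (leqnn k))/= kk] := near_infty_natSinv_lt (PosNum e20).
  by exists k.
have /choice[q qP] : forall i : 'I_n, exists q : rat,
    `|v 0 i - ratr q| < k.+1%:R^-1.
  move=> i; have k0 : 0 < k.+1%:R^-1 :> R by rewrite invr_gt0.
  have [x [bx [q _ qx]]] : ball (v 0 i) k.+1%:R^-1 `&` range ratr !=set0.
    by apply: dense_rat; [exists (v 0 i); exact: ballxx|exact: ball_open].
  by exists q; rewrite qx.
exists (\row_i q i, k); last by move=> i; rewrite /= mxE.
move=> w wq; apply: eO; split => // i j; rewrite /ball/= (ord1 i).
have := wq j; rewrite /= mxE => wqj.
rewrite -(subrKA (ratr (q j))) (le_lt_trans (ler_normD _ _))//.
rewrite [e]splitr ltrD ?(lt_trans (qP _))// distrC.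
exact: lt_trans wqj ke.
Qed.

Lemma measurable_rV d (S : measurableType d) (D : set S) (f : S -> 'rV[R]_n) :
  (forall i, measurable_fun D (fun s => f s 0 i)) -> measurable_fun D f.
Proof.
move=> mf mD; apply: (measurability (@open 'rV[R]_n) erefl) => // _ [U oU <-].
rewrite (open_rat_box oU) preimage_bigcup setI_bigcupr.
rewrite bigcup_mkcond; apply: countable_bigcupT_measurable => // q.
case: ifPn => // _.
pose V i := D `&` (fun s => f s 0 i) @^-1` ball (ratr (q.1 0 i) : R) q.2.+1%:R^-1.
have -> : D `&` f @^-1` rat_box q = D `&` \bigcap_(i in [set: 'I_n]) V i.
  apply/seteqP; split => s [Ds qs]; split => // i; last first.
    by have [_] := qs i I; rewrite /V/= /ball/= distrC.
  by move=> _; split => //; rewrite /= /ball/= distrC; exact: qs.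
apply: measurableI => //; apply: fin_bigcap_measurable => //.
by move=> i _; apply: mf => //; apply: open_measurable; exact: ball_open.
Qed.

End borel_rV.

Section lebesgue_rV.
Context {R : realType}.

Definition rV_cons n (x : R * 'rV[R]_n) : 'rV[R]_n.+1 :=
  \row_i oapp (fun j => x.2 0 j) x.1 (unlift ord0 i).

Definition rV_uncons n (v : 'rV[R]_n.+1) : R * 'rV[R]_n :=
  (v 0 ord0, \row_j v 0 (lift ord0 j)).

Lemma rV_consK n : cancel (@rV_cons n) (@rV_uncons n).
Proof.
move=> [x v]; congr (_, _); rewrite ?mxE ?unlift_none//.
by apply/rowP => j; rewrite !mxE liftK.
Qed.

Lemma measurable_rV_cons n : measurable_fun setT (@rV_cons n).
Proof.
apply: measurable_rV => i; under eq_fun do rewrite mxE.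
case: unliftP => [j|] _ /=; last exact: measurable_fst.
exact: (measurableT_comp (measurable_coord j) measurable_snd).
Qed.

Lemma measurable_rV_uncons n : measurable_fun setT (@rV_uncons n).
Proof.
apply/measurable_fun_pairP; split; first exact: measurable_coord.
apply: measurable_rV => j /=; under eq_fun do rewrite mxE.
exact: measurable_coord.
Qed.

Section step.
Variables (n : nat) (mu : {sigma_finite_measure set 'rV[R]_n -> \bar R}).

Definition lebesgue_rV_step : set 'rV[R]_n.+1 -> \bar R :=
  pushforward (lebesgue_measure \x mu)%E (@rV_cons n).

Let mrV_cons A : measurable A -> measurable (@rV_cons n @^-1` A).
Proof.
by move=> mA; rewrite -[X in measurable X]setTI; exact: measurable_rV_cons.
Qed.

Let step0 : lebesgue_rV_step set0 = 0%E.
Proof. by rewrite /lebesgue_rV_step /pushforward preimage_set0 measure0. Qed.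

Let step_ge0 A : (0 <= lebesgue_rV_step A)%E.
Proof. exact: (measure_ge0 (lebesgue_measure \x mu)%E). Qed.

Let step_sigma_additive : semi_sigma_additive lebesgue_rV_step.
Proof.
move=> F mF tF mUF; rewrite /lebesgue_rV_step /pushforward preimage_bigcup.
apply: measure_semi_sigma_additive.
- by move=> k; exact: mrV_cons.
- apply/trivIsetP => /= i j _ _ ij; rewrite -preimage_setI.
  by move/trivIsetP : tF => /(_ _ _ _ _ ij) ->//; rewrite preimage_set0.
- by rewrite -preimage_bigcup; exact: mrV_cons.
Qed.

HB.instance Definition _ := isMeasure.Build _ _ _ lebesgue_rV_step
  step0 step_ge0 step_sigma_additive.

Let sigma_finite_step : sigma_finite setT lebesgue_rV_step.
Proof.
have /sigma_finiteP[F [TF ndF Foo]] := sigma_finiteT (@lebesgue_measure R).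
have /sigma_finiteP[G [TG ndG Goo]] := sigma_finiteT mu.
exists (fun k => @rV_uncons n @^-1` (F k `*` G k)).
  rewrite -preimage_bigcup (_ : \bigcup_k _ = setT) ?preimage_setT//.
  apply/seteqP; split => // -[x v] _.
  have : setT x by []. rewrite TF => -[i _ Fx].
  have : setT v by []. rewrite TG => -[j _ Gv].
  exists (maxn i j) => //; split.
    by move: x Fx; exact/subsetPset/ndF/leq_maxl.
  by move: v Gv; exact/subsetPset/ndG/leq_maxr.
move=> k; have [mF Fk] := Foo k; have [mG Gk] := Goo k; split.
  by rewrite -[X in measurable X]setTI; apply: measurable_rV_uncons => //;
    exact: measurableX.
rewrite /lebesgue_rV_step /pushforward -comp_preimage.
rewrite (_ : _ \o _ = id); last by apply/funext => x /=; exact: rV_consK.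
by rewrite preimage_id product_measure1E// lte_mul_pinfty// ge0_fin_numE.
Qed.

HB.instance Definition _ :=
  Measure_isSigmaFinite.Build _ _ _ lebesgue_rV_step sigma_finite_step.

End step.

(* Lebesgue measure on R^n on its Borel sets, by iterated products with the
   one-dimensional Lebesgue measure; see [lebesgue_rV_box]. *)
Fixpoint lebesgue_rV n : {sigma_finite_measure set 'rV[R]_n -> \bar R} :=
  match n with
  | 0 => dirac (0 : 'rV[R]_0)
  | n'.+1 => lebesgue_rV_step (lebesgue_rV n')
  end.

Lemma lebesgue_rV_box n (a b : 'rV[R]_n) : (forall i, a 0 i <= b 0 i) ->
  lebesgue_rV n [set v | forall i, a 0 i < v 0 i <= b 0 i] =
  (\prod_i (b 0 i - a 0 i))%:E.
Proof.
elim: n a b => [|n IHn] a b ab.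
  by rewrite big_ord0 /= diracE mem_set// => -[].
rewrite big_ord_recl EFinM.
pose a' : 'rV[R]_n := \row_j a 0 (lift ord0 j).
pose b' : 'rV[R]_n := \row_j b 0 (lift ord0 j).
have ab' i : a' 0 i <= b' 0 i by rewrite !mxE.
have mbox : measurable [set v : 'rV[R]_n | forall i, a' 0 i < v 0 i <= b' 0 i].
  have -> : [set v : 'rV[R]_n | forall i, a' 0 i < v 0 i <= b' 0 i] =
      \bigcap_(i in [set: 'I_n]) ((fun v => v 0 i) @^-1` `]a' 0 i, b' 0 i]).
    apply/seteqP; split => v vab i; first by move=> _; rewrite /= in_itv/= vab.
    by have := vab i I; rewrite /= in_itv.
  apply: fin_bigcap_measurable => // i _.
  by rewrite -[X in measurable X]setTI; exact: measurable_coord.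
have := IHn a' b' ab'; under eq_bigr do rewrite !mxE.
move=> <-; rewrite /= /lebesgue_rV_step /pushforward.
rewrite (_ : _ @^-1` _ = `]a 0 ord0, b 0 ord0]%classic `*`
    [set v : 'rV[R]_n | forall i, a' 0 i < v 0 i <= b' 0 i]); last first.
  apply/seteqP; split => -[x v] /=.
    move=> xv; split.
      by have := xv ord0; rewrite mxE unlift_none /= in_itv.
    by move=> i; have := xv (lift ord0 i); rewrite !mxE liftK.
  move=> [+ vab] i; rewrite in_itv /= mxE => xab.
  by case: unliftP => [j|] ->//=; have := vab j; rewrite !mxE.
rewrite product_measure1E//; congr (_ * _)%E.
rewrite [LHS]lebesgue_measure_itv/= lte_fin; case: ltP => // ba.
by rewrite (le_anti (_ : a 0 ord0 <= b 0 ord0 <= a 0 ord0)) ?subrr// ab ba.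
Qed.
End lebesgue_rV.

Section functions_on_T.
Context {R : realType} {p : nat}.
Implicit Types (T : set 'rV[R]_p) (f h phi psi : 'rV[R]_p -> R).
Implicit Types (g : 'rV[R]_p -> 'rV[R]_p).
Local Open Scope ereal_scope.

Local Notation leb := (lebesgue_rV p).

(* The library norm on 'rV[R]_p is the sup norm. *)
Definition enorm (v : 'rV[R]_p) : R := Num.sqrt (\sum_i v ord0 i ^+ 2)%R.

Definition LnormT T (q : \bar R) f : \bar R := 'N[leb]_q[EFin \o (f \_ T)].

Definition partial (i : 'I_p) f : 'rV[R]_p -> R :=
  fun t => 'D_(delta_mx ord0 i) f t.

Fixpoint Ck (k : nat) f : Prop :=
  match k with
  | 0 => continuous f
  | k'.+1 => (forall t, differentiable f t) /\ forall i, Ck k' (partial i f)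
  end.

Definition test_function T psi : Prop :=
  [/\ forall k, Ck k psi,
      compact (closure [set t | psi t != 0%R]) &
      closure [set t | psi t != 0%R] `<=` T°].

Definition weak_gradient T phi g : Prop :=
  forall psi, test_function T psi -> forall i : 'I_p,
    (\int[leb]_(t in T) (phi t * partial i psi t) =
     - \int[leb]_(t in T) (g t ord0 i * psi t))%R.

Definition L2 T f : Prop := measurable_fun T f /\ LnormT T 2%:E f < +oo.

(* phi is in the Sobolev space H^1(T), with weak gradient g. *)
Definition H1 T phi g : Prop :=
  [/\ L2 T phi, forall i : 'I_p, L2 T (fun t => g t ord0 i) &
      weak_gradient T phi g].

Definition grad_norm T g : \bar R := LnormT T 2%:E (fun t => enorm (g t)).

Definition poincare T : Prop :=
  exists C : R, forall phi g, H1 T phi g ->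
    \int[leb]_(t in T) (phi t)%:E = 0 ->
    LnormT T 2%:E phi <= C%:E * grad_norm T g.

Definition Hm1norm T h : \bar R :=
  ereal_sup [set \int[leb]_(t in T) (h t * phi t)%:E |
    phi in [set phi | exists2 g, H1 T phi g & grad_norm T g <= 1]].

Definition transport_map T f h (S : 'rV[R]_p -> 'rV[R]_p) : Prop :=
  [/\ measurable_fun T S,
      forall t, T t -> T (S t) &
      forall B, measurable B ->
        \int[leb]_(t in T `&` S @^-1` B) (f t)%:E =
        \int[leb]_(t in T `&` B) (h t)%:E].

Definition W2 T f h : \bar R :=
  ereal_inf [set \int[leb]_(t in T) (enorm (t - S t) ^+ 2 * f t)%:E |
    S in transport_map T f h] `^ 2^-1.

End functions_on_T.

Section potentials.
Context {R : realType} {d : measure_display} {D : measurableType d} {p : nat}.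
Variables (lam : {measure set D -> \bar R}) (T : set 'rV[R]_p).
Implicit Types (a b y : D -> 'rV[R]_p -> R).
Local Open Scope ereal_scope.

(* Norm of L^q(D; L^q(T)). *)
Definition LnormDT (q : \bar R) y : \bar R := 'N[lam]_q[(fun x => LnormT T q (y x))].

(* Elements are represented by functions on D x T, extended arbitrarily off T. *)
Definition Y0 : set (D -> 'rV[R]_p -> R) :=
  [set y | [/\ measurable_fun (setT `*` T)
                 (fun z : D * 'rV[R]_p => y z.1 z.2),
               forall x, LnormT T +oo (y x) < +oo,
               LnormDT +oo y < +oo &
               forall x, \int[lebesgue_rV p]_(t in T) (y x t)%:E = 0]].

Definition Psigma (sigma : R -> R) y : D -> 'rV[R]_p -> R :=
  fun x t => (sigma (y x t) / \int[lebesgue_rV p]_(s in T) sigma (y x s))%R.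

Definition Phi_L2 a y : \bar R :=
  2^-1%:E * \int[lam]_x (LnormT T 2%:E (fun t => a x t - y x t)%R ^+ 2).

Definition Phi_Hm1 a y : \bar R :=
  2^-1%:E * \int[lam]_x (Hm1norm T (fun t => a x t - y x t)%R ^+ 2).

Definition Phi_M (sigma : R -> R) a y : \bar R :=
  2^-1%:E * \int[lam]_x (LnormT T 2%:E (fun t =>
    (Psigma sigma a x t - Psigma sigma y x t) / Psigma sigma y x t)%R ^+ 2).

Definition Phi_W2 (sigma : R -> R) a y : \bar R :=
  2^-1%:E * \int[lam]_x (W2 T (Psigma sigma a x) (Psigma sigma y x) ^+ 2).

Definition L2_continuous_at (X : topologicalType)
    (G : X -> D -> 'rV[R]_p -> R) (u : X) : Prop :=
  LnormDT 2%:E (fun x t => G v x t - G u x t)%R @[v --> u] --> 0.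

End potentials.

Section posterior.
Context {R : realType}.
Local Open Scope ereal_scope.

Definition borelType (X : ptopologicalType) := g_sigma_algebraType (@open X).

Definition radon (X : ptopologicalType)
    (mu : {measure set (borelType X) -> \bar R}) : Prop :=
  (forall u : X, exists2 U : set X, open_nbhs u U & mu U < +oo) /\
  (forall A : set (borelType X), measurable A ->
    mu A = ereal_sup [set mu K | K in [set K : set X | compact K /\ K `<=` A]]).

Variables (X : ptopologicalType) (pi0 : probability (borelType X) R).

(* Measurability for the pi0-completion of the Borel sets. The library integral
   is total, so that an integral makes sense has to be asserted separately. *)
Definition ae_measurable (f : X -> \bar R) : Prop :=
  exists2 g : borelType X -> \bar R, measurable_fun setT g &
    {ae pi0, forall u, f u = g u}.

Variable Phi : X -> \bar R.

Definition normalizer : \bar R := \int[pi0]_u expeR (- Phi u).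

Definition posterior (A : set (borelType X)) : \bar R :=
  (fine normalizer)^-1%:E * \int[pi0]_(u in A) expeR (- Phi u).

End posterior.

(* Main.v *)
(* Each potential is [1/2 * \int[lam]_x q (a x) (y x)] for a functional [q] of two
   functions on [T] which, on mean-zero functions bounded by [M], is bounded and
   satisfies [q a c <= q b c + K * |a - b|_L2] with [K = K(M)]. This is elementary for
   the L^2 potential, follows from the Poincare inequality for the H^-1 potential,
   and from two-sided bounds for [sigma] on [[-M, M]] for the multiplicative one. For
   W2 it suffices that densities [f], [g] admit a map from [f] to [g] of first-moment
   cost at most [diam T * |f - g|_L1 + e]: precomposing a map from [g] to [h] with it
   changes the quadratic cost by at most a multiple of [diam T] times that. Hence
   [u |-> Phi (G u) y] is finite everywhere and continuous wherever [G] is; this makes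
   the likelihood measurable up to a null set and positive with values in [0, 1], and the
   posterior is a Borel probability measure on a Polish space, which is Radon. *)

Require Import Defs.
From HB Require Import structures.
From mathcomp Require Import all_boot all_order all_algebra.
From mathcomp Require Import all_classical all_reals all_analysis.
From mathcomp Require Import measurable_realfun ess_sup_inf.
From mathcomp Require Import ring lra.

Set Implicit Arguments.
Unset Strict Implicit.
Unset Printing Implicit Defensive.

Import Order.TTheory GRing.Theory Num.Def Num.Theory.
Import numFieldNormedType.Exports.

Local Open Scope classical_set_scope.
Local Open Scope ring_scope.

(** * Lower integrals and densities *)

(** For the H^-1 and Wasserstein potentials the integrand over D is a supremum over Sobolev
    functions or an infimum over transport maps, and its measurability in x is never established.
    Its integrals are therefore treated as lower integrals, which are monotone but not additive. The
    stability estimate has the shape that survives this: its error term, the L^2 distance of two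
    sections, is measurable by Tonelli and can be split off. [W2] is an infimum over maps, not over
    couplings, so that neither finiteness nor a triangle inequality comes for free and maps must be
    built. The sources are densities, so their first coordinate has no atoms, and every law of the
    same mass can be reached from it once R^p is coded measurably in the line. Such a map may move
    mass far. One of them is therefore used on each small cell, with a target that leaves most of
    the mass in the cell when the two densities are close. All estimates are one-sided; the reverse
    inequality comes from exchanging the two functions. *)

Section lower_integral.
Local Open Scope ereal_scope.
Context d (T : measurableType d) (R : realType).
Variable mu : {measure set T -> \bar R}.
Implicit Types f g w : T -> \bar R.

Import HBNNSimple.

Lemma le_lower_integral f g : (forall x, 0 <= f x) -> (forall x, f x <= g x) ->
  \int[mu]_x f x <= \int[mu]_x g x.
Proof.
move=> f0 fg; have g0 x : 0 <= g x by exact: le_trans (fg x).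
rewrite !ge0_integralTE//; apply: ge_ereal_sup => _ [h/= hf <-].
by apply: ereal_sup_ubound; exists h => //= x; exact: le_trans (fg x).
Qed.

(* The library integral of a nonnegative function is a lower integral, which is
   only superadditive in general. *)
Lemma le_lower_integralD f g w : (forall x, 0 <= f x) -> (forall x, 0 <= g x) ->
  (forall x, 0 <= w x) -> measurable_fun setT w ->
  {ae mu, forall x, f x <= g x + w x} ->
  \int[mu]_x f x <= \int[mu]_x g x + \int[mu]_x w x.
Proof.
move=> f0 g0 w0 mw [N [mN N0 fgw]].
rewrite ge0_integralTE//; apply: ge_ereal_sup => _ [h/= hf <-].
rewrite -integralT_nnsfun.
(* [k] is measurable, so additivity applies to [k + w], which dominates the simple function [h]. Cut
   off on [N], [k] lies below [g], and its integral is at most the lower integral of [g]. *)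
pose k x := maxe ((h x)%:E - w x) 0.
have mk : measurable_fun setT k.
  apply: measurable_maxe => //; apply: emeasurable_funB => //.
  exact/measurable_EFinP.
have mk' : measurable_fun setT (k \_ (~` N)).
  apply/(measurable_restrictT _ _).1; first exact: measurableC.
  exact: measurable_funTS.
have k0 x : 0 <= (k \_ (~` N)) x.
  by apply: erestrict_ge0 => // y _; rewrite /k le_max lexx orbT.
apply: (@le_trans _ _ (\int[mu]_x ((k \_ (~` N)) x + w x))).
  apply: ae_ge0_le_integral => //.
  - by move=> x _; rewrite lee_fin.
  - exact/measurable_EFinP.
  - by move=> x _; exact: adde_ge0.
  - exact: emeasurable_funD.
  exists N; split => // x /=; apply: contra_notP => Nx _.
  rewrite patchE mem_set// /k.
  case: (w x) (w0 x) => [r r0|_|//]; last by rewrite addey ?leey// -ltNye lt_max ltNyr orbT.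
  by rewrite -EFinB -leeBlDr// le_max lexx.
rewrite ge0_integralD// leeD2r// le_lower_integral// => x.
rewrite patchE; case: ifPn => // /set_mem Nx; rewrite /k ge_max g0 andbT.
have fgwx : f x <= g x + w x by apply: contrapT => ?; apply: Nx; exact: fgw.
have := le_trans (hf x) fgwx.
case: (w x) (w0 x) => [r r0|_ _|//]; last by rewrite /= leNye.
by rewrite leeBlDr.
Qed.

Lemma ae_le_lower_integral f g : (forall x, 0 <= f x) -> (forall x, 0 <= g x) ->
  {ae mu, forall x, f x <= g x} -> \int[mu]_x f x <= \int[mu]_x g x.
Proof.
move=> f0 g0 fg; rewrite -[leRHS]adde0 -[X in _ + X](integral0 mu setT).
apply: le_lower_integralD => //.
by apply: filterS fg => x; rewrite adde0.
Qed.

Lemma ae_eq_lower_integral f g : (forall x, 0 <= f x) -> (forall x, 0 <= g x) ->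
  {ae mu, forall x, f x = g x} -> \int[mu]_x f x = \int[mu]_x g x.
Proof.
move=> f0 g0 fg; apply/eqP; rewrite eq_le !ae_le_lower_integral//.
  by apply: filterS fg => x ->.
by apply: filterS fg => x ->.
Qed.

End lower_integral.

Section density_measure.
Local Open Scope ereal_scope.
Context d (T : measurableType d) (R : realType).
Variable mu : {measure set T -> \bar R}.

(** The two proofs are arguments so that the measure structure declared below can be inferred from
    the term alone. *)
Definition density (f : T -> R) of measurable_fun setT f &
  (forall x, 0 <= f x)%R : set T -> \bar R :=
  fun A => \int[mu]_(x in A) (f x)%:E.

Variables (f : T -> R) (mf : measurable_fun setT f).
Hypothesis f0 : forall x, (0 <= f x)%R.

Let density0 : density mf f0 set0 = 0. Proof. exact: integral_set0. Qed.

Let density_ge0 A : 0 <= density mf f0 A.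
Proof. by apply: integral_ge0 => x _; rewrite lee_fin. Qed.

Let density_sigma_additive : semi_sigma_additive (density mf f0).
Proof.
apply: semi_sigma_additive_nng_induced; first exact/measurable_EFinP.
by move=> x; rewrite lee_fin.
Qed.

HB.instance Definition _ := isMeasure.Build _ _ _ (density mf f0)
  density0 density_ge0 density_sigma_additive.

Import HBNNSimple.

Let ge0_integral_density_nnsfun (h : {nnsfun T >-> R}) :
  \int[density mf f0]_x (h x)%:E = \int[mu]_x ((h x)%:E * (f x)%:E).
Proof.
under [LHS]eq_integral do rewrite fimfunE -fsumEFin//.
rewrite ge0_integral_fsum//; last 2 first.
  - by move=> r /=; apply: measurableT_comp => //; exact: measurableT_comp.
  - by move=> r t _; rewrite EFinM nnfun_muleindic_ge0.
transitivity (\int[mu]_x \sum_(y \in range h)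
    ((y * \1_(h @^-1` [set y]) x)%:E * (f x)%:E)); last first.
  apply: eq_integral => x _; rewrite -ge0_mule_fsuml; last first.
    by move=> y; rewrite EFinM nnfun_muleindic_ge0.
  by rewrite fimfunE -fsumEFin.
rewrite ge0_integral_fsum//; last 2 first.
  - move=> y; apply: emeasurable_funM; last exact/measurable_EFinP.
    by apply/measurable_EFinP; apply: measurable_funM.
  - by move=> y x _; rewrite mule_ge0// ?EFinM ?nnfun_muleindic_ge0 ?lee_fin//.
apply: eq_fsbigr => r /[!inE] -[x _ <-{r}].
under [LHS]eq_integral do rewrite EFinM.
rewrite ge0_integralZl//; last 2 first.
  - exact/measurable_EFinP.
  - by rewrite lee_fin.
rewrite integral_indic// setIT.
under [RHS]eq_integral do rewrite EFinM -muleA.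
rewrite ge0_integralZl//; last 3 first.
  - by apply: emeasurable_funM; exact/measurable_EFinP.
  - by move=> y _; rewrite mule_ge0// lee_fin.
  - by rewrite lee_fin.
congr (_ * _); rewrite /density [LHS]integral_mkcond.
apply: eq_integral => z _; rewrite patchE indicE.
by case: ifPn => _; rewrite ?mul1e ?mul0e.
Qed.

Lemma ge0_integral_density (g : T -> \bar R) : measurable_fun setT g ->
  (forall x, 0 <= g x) ->
  \int[density mf f0]_x g x = \int[mu]_x (g x * (f x)%:E).
Proof.
move=> mg g0; pose g_ := nnsfun_approx measurableT mg.
have g_g x : EFin \o g_ ^~ x @ \oo --> g x by exact: cvg_nnsfun_approx.
transitivity (limn (fun n => \int[density mf f0]_x (g_ n x)%:E)).
  rewrite -monotone_convergence//.
  - by apply: eq_integral => x _; apply/esym/cvg_lim => //; exact: g_g.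
  - by move=> n; exact/measurable_EFinP.
  - by move=> n x _; rewrite lee_fin.
  - by move=> x _ m n mn; rewrite lee_fin; exact/lefP/nd_nnsfun_approx.
under eq_fun do rewrite ge0_integral_density_nnsfun.
rewrite -monotone_convergence//.
- apply: eq_integral => x _; apply/cvg_lim => //.
  rewrite muleC; under eq_fun do rewrite muleC.
  by apply: cvgeZl => //; exact: g_g.
- by move=> n; apply: emeasurable_funM; exact/measurable_EFinP.
- by move=> n x _; rewrite mule_ge0// lee_fin.
- move=> x _ m n mn; rewrite lee_wpmul2r ?lee_fin//.
  exact/lefP/nd_nnsfun_approx.
Qed.

End density_measure.

(** * Transport maps from an atomless source *)

Section ternary_code.
Context {R : realType}.
Implicit Types (c : nat -> bool) (r : R).

(* Only the digits 0 and 1 are used in base 3, so that the coding is injective. *)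
Definition code_seq c : R^nat := fun k => (c k)%:R / 3 ^+ k.+1.

Definition code c : R := limn (series (code_seq c)).

Let series_code_ge0 c n : 0 <= series (code_seq c) n.
Proof. by rewrite /series/=; apply: sumr_ge0 => k _; rewrite divr_ge0. Qed.

Let series_code_le c n : series (code_seq c) n <= (1 - 3 ^- n) / 2.
Proof.
elim: n => [|n IH]; first by rewrite /series/= big_geq// expr0 invr1 subrr mul0r.
rewrite seriesSr; apply: (le_trans (lerD IH (_ : _ <= 3 ^- n.+1))).
  by rewrite /code_seq ler_piMl// ?invr_ge0//; case: (c n).
rewrite exprS invfM; set x := 3 ^- n; lra.
Qed.

Lemma cvg_code c : series (code_seq c) @ \oo --> code c.
Proof.
apply: nondecreasing_is_cvgn.
  apply: nondecreasing_series => n _ _; by rewrite divr_ge0.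
exists (2^-1) => _ [n _ <-]; apply: le_trans (series_code_le c n) _.
rewrite -[leRHS]mul1r ler_wpM2r// lerBlDr lerDl invr_ge0//.
Qed.

Lemma code_ge0 c : 0 <= code c.
Proof. by apply: limr_ge; [exact/cvgP/cvg_code|exact: nearW]. Qed.

Lemma code_le c : code c <= 2^-1.
Proof.
apply: limr_le; first exact/cvgP/cvg_code.
apply: nearW => n; apply: le_trans (series_code_le c n) _.
by rewrite -[leRHS]mul1r ler_wpM2r// lerBlDr lerDl invr_ge0.
Qed.

Lemma codeS c : code c = ((c 0)%:R + code (c \o succn)) / 3.
Proof.
have : series (code_seq c) n.+1 @[n --> \oo] --> code c.
  by rewrite cvg_shiftS; exact: cvg_code.
have -> : (fun n => series (code_seq c) n.+1) =
    (fun n => ((c 0)%:R + series (code_seq (c \o succn)) n) / 3).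
  apply/funext => n; rewrite /series/= big_nat_recl// mulrDl /code_seq expr1.
  congr (_ + _); rewrite mulr_suml; apply: eq_bigr => k _.
  by rewrite -mulrA -invfM -exprSr.
move=> /cvg_unique; apply => //.
by apply: cvgMl; apply: cvgD; [exact: cvg_cst|exact: cvg_code].
Qed.

Definition digit r : bool := 3^-1 <= r.
Definition shift_code r : R := 3 * r - (digit r)%:R.
Definition decode n r : bool := digit (iter n shift_code r).

(** By [codeS] and the bounds 0 and 1/2 on the tail, a first digit 0 gives a code of at most 1/6 and
    a first digit 1 a code of at least 1/3. Comparison with 1/3 thus reads the first digit, and
    [shift_code] removes it. *)
Lemma codeK n c : decode n (code c) = c n.
Proof.
have dE c' : digit (code c') = c' 0%N.
  rewrite /digit codeS; have := code_ge0 (c' \o succn).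
  have := code_le (c' \o succn); case: (c' 0%N) => /= c1 c0.
    by apply/idP; lra.
  by apply/negbTE; rewrite -ltNge; lra.
rewrite /decode; have -> : iter n shift_code (code c) = code (c \o addn n).
  elim: n => [|n IH]; first by congr code; apply/funext.
  rewrite iterS IH /shift_code dE [in LHS]codeS mulrCA mulfV// mulr1 addrAC subrr add0r.
  by congr code; apply/funext => k/=; rewrite addnS.
by rewrite dE /= addn0.
Qed.

Lemma measurable_digit : measurable [set r | digit r].
Proof.
rewrite (_ : [set r | digit r] = `[3^-1, +oo[%classic)//.
by apply/seteqP; split => r; rewrite /= in_itv/= andbT.
Qed.

Lemma measurable_shift_code : measurable_fun setT shift_code.
Proof.
apply: measurable_funB; first exact: mulrl_measurable.
rewrite (_ : (fun r => _) = \1_[set r | digit r]); last first.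
  by apply/funext => r; rewrite indicE mem_setE.
by apply: measurable_indic; exact: measurable_digit.
Qed.

Lemma measurable_decode n : measurable [set r | decode n r].
Proof.
have : measurable_fun setT (iter n shift_code).
  elim: n => [|n IH]; first exact: measurable_id.
  exact: (measurableT_comp measurable_shift_code IH).
by move=> /(_ measurableT _ measurable_digit); rewrite setTI.
Qed.

End ternary_code.

Section code_rV.
Context {R : realType} {p : nat}.

(* Every point of R^p is coded by a real number, whose ternary digits tell which
   rational half-spaces contain it. *)
Definition cut (t : 'rV[R]_p) (n : nat) : bool :=
  if choice.unpickle n is Some iq then ratr (iq : 'I_p * rat).2 < t 0 iq.1 else false.

Definition code_rV (t : 'rV[R]_p) : R := code (cut t).

(** Indices that encode another coordinate, a failed cut or nothing at all give -oo, which is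
    neutral for the supremum over n. *)
Definition cut_sup (i : 'I_p) (r : R) (n : nat) : \bar R :=
  if choice.unpickle n is Some iq then
    if ((iq : 'I_p * rat).1 == i) && decode n r then (ratr iq.2)%:E else -oo%E
  else -oo%E.

(** [esups] at index 0 is the supremum over all n. Reals that are not codes may give an infinite
    supremum, which [fine] sends to 0. *)
Definition decode_rV (r : R) : 'rV[R]_p :=
  \row_i fine (esups (cut_sup i r) 0).

Lemma code_rVK : cancel code_rV decode_rV.
Proof.
move=> t; apply/rowP => i; rewrite mxE.
suff -> : esups (cut_sup i (code_rV t)) 0 = (t 0 i)%:E by [].
apply/eqP; rewrite eq_le; apply/andP; split.
  apply: ge_ereal_sup => _ [n _ <-]; rewrite /cut_sup.
  case E : (choice.unpickle n) => [[j q]|]; last by rewrite leNye.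
  case: ifPn => [/= /andP[/eqP ji]|_]; last by rewrite leNye.
  by rewrite codeK /cut E /= ji => ?; rewrite lee_fin ltW.
apply/lee_subgt0Pr => e e0.
have [q] : exists q, ratr q \in `]t 0 i - e, t 0 i[.
  by apply: rat_in_itvoo; rewrite ltrBlDr ltrDl.
rewrite in_itv/= => /andP[q1 q2].
apply: (@le_trans _ _ (ratr q)%:E); first by rewrite -EFinB lee_fin ltW.
apply: ereal_sup_ubound; exists (choice.pickle (i, q)) => //.
by rewrite /cut_sup choice.pickleK /= eqxx codeK /cut choice.pickleK /= q2.
Qed.

Lemma measurable_code_rV : measurable_fun setT code_rV.
Proof.
apply: (@measurable_fun_cvg _ _ _ _ (fun n t => series (code_seq (cut t)) n)).
  move=> n; rewrite /series/=; apply: measurable_sum => k.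
  apply: measurable_funM => //; rewrite /cut.
  case: (choice.unpickle k) => [[i q]|] /=; last exact: measurable_cst.
  rewrite (_ : (fun t => _) = \1_[set t : 'rV[R]_p | ratr q < t 0 i]); last first.
    by apply/funext => t; rewrite indicE mem_setE.
  apply: measurable_indic.
  rewrite (_ : [set t | _] = (fun t : 'rV[R]_p => t 0 i) @^-1` `]ratr q, +oo[%classic).
    by rewrite -[X in measurable X]setTI; exact: measurable_coord.
  by apply/seteqP; split => r; rewrite /= in_itv/= andbT.
by move=> t _; exact: cvg_code.
Qed.

Lemma measurable_decode_rV : measurable_fun setT decode_rV.
Proof.
apply: measurable_rV => i; under eq_fun do rewrite mxE.
apply: measurableT_comp => //; apply: measurable_fun_esups => n.
rewrite /cut_sup; case: (choice.unpickle n) => [[j q]|] //=.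
case: (j == i) => //=.
apply: measurable_fun_ifT => //.
apply: (measurable_fun_bool true).
by rewrite setTI; exact: measurable_decode.
Qed.

End code_rV.

Section ray_limits.
Context {R : realType}.
Variable m : {measure set (measurableTypeR R) -> \bar R}.
Local Open Scope ereal_scope.

(** Right continuity of the distribution function; finiteness is what continuity from above
    requires. *)
Lemma measure_ray_ge (c : \bar R) x : m setT < +oo ->
  (forall y, (x < y)%R -> c <= m `]-oo, y]%classic) -> c <= m `]-oo, x]%classic.
Proof.
move=> moo cm; pose F n : set (measurableTypeR R) := `]-oo, (x + n.+1%:R^-1)%R]%classic.
have mF i : measurable (F i) by exact: measurable_itv.
have FE : \bigcap_n F n = `]-oo, x]%classic.
  apply/seteqP; split => y /=.
    move=> Fy; rewrite in_itv/=; apply/ler_addgt0Pr => e e0.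
    have [k _ /(_ k (leqnn k))/= ke] := near_infty_natSinv_lt (PosNum e0).
    have := Fy k I; rewrite /F/= in_itv/= => /le_trans; apply.
    by rewrite lerD2l ltW.
  move=> yx n _; rewrite /F/=; move: yx; rewrite !in_itv/= => /le_trans; apply.
  by rewrite lerDl invr_ge0.
rewrite -FE; have : m \o F @ \oo --> m (\bigcap_n F n).
  apply: nonincreasing_cvg_mu => //.
  - by apply: le_lt_trans moo; apply: le_measure; rewrite ?inE.
  - exact: bigcap_measurable.
  - move=> i j ij; apply/subsetPset => y; rewrite /F/= !in_itv/= => /le_trans; apply.
    by rewrite lerD2l lef_pV2 ?posrE// ler_nat.
by apply: cvge_ge; apply: nearW => n; apply: cm; rewrite ltrDl invr_gt0.
Qed.

(** Continuity from below along increasing rays, which exhaust only the open ray. *)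
Lemma measure_ray_le (c : \bar R) x :
  (forall y, (y < x)%R -> m `]-oo, y]%classic <= c) -> m `]-oo, x[%classic <= c.
Proof.
move=> cm; pose F n : set (measurableTypeR R) := `]-oo, (x - n.+1%:R^-1)%R]%classic.
have mF i : measurable (F i) by exact: measurable_itv.
have FE : \bigcup_n F n = `]-oo, x[%classic.
  apply/seteqP; split => y /=.
    move=> [n _]; rewrite /F/= !in_itv/= => /le_lt_trans; apply.
    by rewrite ltrBlDr ltrDl invr_gt0.
  rewrite in_itv/= => yx; have yx0 : (0 < x - y)%R by rewrite subr_gt0.
  have [k _ /(_ k (leqnn k))/= ke] := near_infty_natSinv_lt (PosNum yx0).
  by exists k => //; rewrite /F/= in_itv/= lerBrDr -lerBrDl ltW.
rewrite -FE; have : m \o F @ \oo --> m (\bigcup_n F n).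
  apply: nondecreasing_cvg_mu => //; first exact: bigcup_measurable.
  move=> i j ij; apply/subsetPset => y; rewrite /F/= !in_itv/= => /le_trans; apply.
  by rewrite lerD2l lerN2 lef_pV2 ?posrE// ler_nat.
by apply: cvge_le; apply: nearW => n; apply: cm; rewrite ltrBlDr ltrDl invr_gt0.
Qed.

End ray_limits.

Section quantile_transport.
Context {R : realType}.
Variables m n : {measure set (measurableTypeR R) -> \bar R}.
Local Open Scope ereal_scope.
Hypothesis mfin : m setT < +oo.
Hypothesis mn : m setT = n setT.
Hypothesis m_atomless : forall x, m [set x] = 0.
Hypothesis n01 : n (~` `[0%R, 1%R]%classic) = 0.

Let F x := m `]-oo, x]%classic.
Let G x := n `]-oo, x]%classic.

Let le_ray (k : {measure set (measurableTypeR R) -> \bar R}) x y :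
  (x <= y)%R -> k `]-oo, x]%classic <= k `]-oo, y]%classic.
Proof.
move=> xy; apply: le_measure; rewrite ?inE// => z; rewrite /= !in_itv/=.
by move=> /le_trans; exact.
Qed.

Let F_x x : F x = m `]-oo, x[%classic.
Proof.
rewrite /F -(@setUitv1 _ _ _ x true)// measureU//; last first.
  by apply/seteqP; split => // y /= [+ yx]; rewrite in_itv/= yx ltxx.
by rewrite [X in _ + X](m_atomless x) adde0.
Qed.

(** Under [m] the distribution function is uniformly distributed. The sublevel set is a ray whose
    endpoint x is its supremum, and continuity of [F], due to the absence of atoms, forces F x = s.
    If the set is empty, the limit of [F] at -oo forces s = 0. *)
Let level_set s : 0 <= s -> s <= m setT -> m [set x | F x <= s] = s.
Proof.
move=> s0; rewrite le_eqVlt => /predU1P[->|sm].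
  congr (m _); apply/seteqP; split => // x _ /=.
  by apply: le_measure; rewrite ?inE.
pose A := [set x | F x <= s].
have [A0|/set0P[a Aa]] := eqVneq A set0.
  rewrite -/A A0 measure0; apply/eqP; rewrite eq_le s0/=.
  have TE : \bigcap_k (`]-oo, (- k%:R)%R]%classic : set (measurableTypeR R)) = set0.
    apply/seteqP; split => // x /(_ (Num.bound `|x|%R) I); rewrite /= in_itv/=.
    rewrite leNgt => /negP; apply; rewrite ltrNl.
    by rewrite (le_lt_trans (ler_norm _))// normrN archi_boundP.
  rewrite -(measure0 m) -TE.
  have : m \o (fun k => `]-oo, (- k%:R)%R]%classic) @ \oo -->
      m (\bigcap_k (`]-oo, (- k%:R)%R]%classic : set (measurableTypeR R))).
    apply: nonincreasing_cvg_mu => //.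
    - by apply: le_lt_trans mfin; apply: le_measure; rewrite ?inE.
    - exact: bigcap_measurable.
    - move=> i j ij; apply/subsetPset => y; rewrite /= !in_itv/= => /le_trans; apply.
      by rewrite lerN2 ler_nat.
  apply: cvge_ge; apply: nearW => k; rewrite leNgt; apply/negP => /ltW Fk.
  by have : A (- k%:R)%R by []; rewrite A0.
have Aub : has_ubound A.
  have [c cP] : exists c, s < F c.
    apply: contrapT => /forallNP sF; move: sm; rewrite ltNge => /negP; apply.
    have TE : \bigcup_k (`]-oo, k%:R%R]%classic : set (measurableTypeR R)) = setT.
      apply/seteqP; split => // x _; exists (Num.bound `|x|%R) => //=.
      by rewrite in_itv/= ltW// (le_lt_trans (ler_norm _))// archi_boundP.
    have : m \o (fun k => `]-oo, k%:R%R]%classic) @ \oo --> m setT.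
      rewrite -TE; apply: nondecreasing_cvg_mu => //.
        exact: bigcup_measurable.
      move=> i j ij; apply/subsetPset => y; rewrite /= !in_itv/= => /le_trans; apply.
      by rewrite ler_nat.
    apply: cvge_le; apply: nearW => k; rewrite leNgt; apply/negP.
    exact: sF.
  exists c => x Ax; rewrite leNgt; apply/negP => cx.
  have := lt_le_trans cP (le_ray m (ltW cx)); rewrite ltNge => /negP; apply.
  exact: Ax.
pose x := sup A.
have Fxs : F x = s.
  apply/eqP; rewrite eq_le; apply/andP; split.
    rewrite F_x; apply: measure_ray_le => y yx.
    have [z Az yz] := sup_gt (ex_intro _ a Aa) yx.
    by apply: le_trans Az; exact/le_ray/ltW.
  apply: measure_ray_ge => // y xy; rewrite leNgt; apply/negP => /ltW Ay.
  by have := ub_le_sup Aub Ay; rewrite leNgt xy.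
rewrite -[RHS]Fxs; congr (m _); apply/seteqP; split => y /=.
  by move=> Fy; rewrite in_itv/=; apply: ub_le_sup.
by rewrite in_itv/= => yx; rewrite -Fxs; exact: le_ray.
Qed.

(** Monotone rearrangement: the generalized inverse of [G] after [F]. As [n] lives on [0, 1], the
    set contains 1, and the condition on r bounds it below, so the infimum is a genuine one. *)
Let q x : R := inf [set r | (0 <= r)%R /\ F x <= G r].

Let F_G1 x : F x <= G 1%R.
Proof.
apply: (@le_trans _ _ (m setT)); first by apply: le_measure; rewrite ?inE.
rewrite mn -[leRHS]adde0 -n01.
apply: le_trans (measureU2 _ _ _) => //; last exact: measurableC.
apply: le_measure; rewrite ?inE//.
  by apply: measurableU => //; exact: measurableC.
move=> y _; have [y1|y1] := leP y 1%R; [left|right]; rewrite /= in_itv//=.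
by rewrite [(y <= 1)%R]leNgt y1 andbF.
Qed.

Let has_inf_q x : has_inf [set r | (0 <= r)%R /\ F x <= G r].
Proof. by split; [exists 1%R; split|exists 0%R => r []]. Qed.

Let q_ge0 x : (0 <= q x)%R.
Proof. by apply: lb_le_inf; [have [] := has_inf_q x|move=> r []]. Qed.

(** Galois connection between quantile and distribution functions; right continuity of [G] makes the
    infimum attained. *)
Let q_le x r : (0 <= r)%R -> (q x <= r)%R <-> F x <= G r.
Proof.
move=> r0; split => [qr|FG]; last by apply: ge_inf => //; exists 0%R => s [].
apply: measure_ray_ge; first by rewrite -mn.
move=> y ry; have [s [s0 Fs] sy] := inf_lt (has_inf_q x).1 (le_lt_trans qr ry).
by apply: le_trans Fs _; exact/le_ray/ltW.
Qed.

Let measurable_q : measurable_fun setT q.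
Proof.
apply: nondecreasing_measurable => // x y xy.
apply/q_le => //; apply: (@le_trans _ _ (F y)); first exact: le_ray.
by apply/q_le.
Qed.

Lemma quantile_transport : exists2 q : R -> R, measurable_fun setT q &
  forall B : set (measurableTypeR R), measurable B -> m (q @^-1` B) = n B.
Proof.
exists q => // B mB.
have mq C : measurable C -> measurable (q @^-1` C).
  by move=> mC; rewrite -[X in measurable X]setTI; exact: measurable_q.
(* By [q_le] this preimage is a sublevel set of [F] at height G r, so [level_set] applies. For r < 0
   both sides vanish. *)
have qray r : m (q @^-1` `]-oo, r]%classic) = G r.
  have [r0|r0] := leP 0%R r.
    rewrite -[RHS]level_set//; last by rewrite mn; apply: le_measure; rewrite ?inE.
    congr (m _); apply/seteqP; split => x /=; rewrite in_itv/=; first by move=> /q_le ->.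
    by move=> /q_le ->.
  rewrite (_ : _ @^-1` _ = set0) ?measure0.
    apply/esym/eqP; rewrite -measure_le0 -n01.
    apply: le_measure; rewrite ?inE//; first exact: measurableC.
    move=> x; rewrite /= !in_itv/= => xr /andP[x0 _].
    by have := lt_le_trans (le_lt_trans xr r0) x0; rewrite ltxx.
  apply/seteqP; split => // x /=; rewrite in_itv/= => xr.
  by have := lt_le_trans (le_lt_trans xr r0) (q_ge0 x); rewrite ltxx.
pose q' : measurableTypeR R -> measurableTypeR R := q.
(* The measures are compared on the pi-system of open right rays, whose masses follow from [qray] by
   complement, the total mass being finite. *)
apply: (@measure_unique _ R _ [set A : set (measurableTypeR R) | exists x, A = `]x, +oo[%classic]
  (fun k => `](- k%:R)%R, +oo[%classic) _ _ _ _ (pushforward m q') n) => //.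
- exact: RGenOInfty.measurableE.
- move=> _ _ [x ->] [y ->]; exists (Num.max x y).
  by apply/seteqP; split => z /=; rewrite !in_itv/= !andbT gt_max => /andP.
- by move=> k; exists (- k%:R)%R.
- apply/seteqP; split => // x _; exists (Num.bound `|x|%R) => //=.
  rewrite in_itv/= andbT ltrNl.
  by rewrite (le_lt_trans (ler_norm _))// normrN archi_boundP.
- move=> _ [x ->]; rewrite -setCitvl.
  have mqx : measurable (q @^-1` `]-oo, x]%classic) by exact: mq.
  have kC (k : {measure set (measurableTypeR R) -> \bar R}) C : measurable C ->
      k setT < +oo -> k (~` C) = k setT - k C.
    by move=> mC koo; rewrite -setTD measureD// setTI.
  have nfin : n setT < +oo by rewrite -mn.
  transitivity (m (~` (q @^-1` `]-oo, x]%classic))) => //.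
  rewrite (kC m _ mqx mfin) qray mn; apply/esym.
  by apply: (kC n _ _ nfin); exact: measurable_itv.
- move=> k; have mqk : measurable (q @^-1` `](- k%:R)%R, +oo[%classic) by exact: mq.
  apply: le_lt_trans mfin; change (m (q @^-1` `](- k%:R)%R, +oo[%classic) <= m setT).
  by apply: le_measure; rewrite ?inE.
Qed.

End quantile_transport.

Section transport_rV.
Context {R : realType} {p : nat}.
Local Open Scope ereal_scope.

(* The source only needs one atomless coordinate: it is mapped to the line by that
   coordinate, then by a monotone rearrangement to the law of the code of the
   target, and decoded. *)
Lemma transport_exists (i : 'I_p) (mu nu : {measure set 'rV[R]_p -> \bar R})
    (T : set 'rV[R]_p) (t0 : 'rV[R]_p) : measurable T -> T t0 ->
  mu setT < +oo -> mu setT = nu setT -> nu (~` T) = 0 ->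
  (forall c, mu [set t | t 0%R i = c] = 0) ->
  exists S : 'rV[R]_p -> 'rV[R]_p,
    [/\ measurable_fun setT S, forall t, T (S t) &
        forall B, measurable B -> mu (S @^-1` B) = nu B].
Proof.
move=> mT Tt0 mufin munu nuT mu0.
pose f : 'rV[R]_p -> measurableTypeR R := fun t => t 0%R i.
have mf : measurable_fun setT f by exact: measurable_coord.
pose g : 'rV[R]_p -> measurableTypeR R := code_rV.
have mg : measurable_fun setT g by exact: measurable_code_rV.
have [||||q mq qP] := @quantile_transport R
  (measure_function_pushforward__canonical__measure_function_Measure mu mf)
  (measure_function_pushforward__canonical__measure_function_Measure nu mg).
- by [].
- by [].
- by move=> x; exact: mu0.
- change (nu (g @^-1` (~` `[0%R, 1%R]%classic)) = 0).
  rewrite (_ : g @^-1` _ = set0) ?measure0//.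
  apply/seteqP; split => // t /=; apply; rewrite in_itv/= code_ge0/=.
  by apply: le_trans (code_le _) _; rewrite invf_le1// ler1n.
pose S0 t : 'rV[R]_p := decode_rV (q (f t)).
have mS0 : measurable_fun setT S0.
  apply: (measurableT_comp measurable_decode_rV).
  exact: (measurableT_comp mq mf).
have S0P B : measurable B -> mu (S0 @^-1` B) = nu B.
  move=> mB; have mD : measurable (decode_rV @^-1` B : set (measurableTypeR R)).
    by rewrite -[X in measurable X]setTI; exact: measurable_decode_rV.
  transitivity (nu (g @^-1` (decode_rV @^-1` B))); first exact: (qP _ mD).
  by congr (nu _); apply/seteqP; split => t /=; rewrite /g code_rVK.
(* [S0] leaves [T] only on a [mu]-null set, because [nu] does not charge the complement of [T].
   Sending that set to [t0] forces values in [T] everywhere without changing the image law. *)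
exists (fun t => if S0 t \in T then S0 t else t0).
have mST : measurable (S0 @^-1` T).
  by rewrite -[X in measurable X]setTI; exact: mS0.
have mS : measurable_fun setT (fun t => if S0 t \in T then S0 t else t0).
  apply: measurable_fun_ifT => //.
  apply: (measurable_fun_bool true); rewrite setTI.
  rewrite (_ : _ @^-1` _ = S0 @^-1` T)//.
  by apply/seteqP; split => t /=; [move=> /set_mem|move=> /mem_set].
split => //.
  by move=> t; case: ifPn => // /set_mem.
move=> B mB; rewrite -S0P//.
have mSB : measurable ((fun t => if S0 t \in T then S0 t else t0) @^-1` B).
  by rewrite -[X in measurable X]setTI; exact: mS.
have mS0B : measurable (S0 @^-1` B).
  by rewrite -[X in measurable X]setTI; exact: mS0.
have nST : mu (~` (S0 @^-1` T)) = 0.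
  transitivity (mu (S0 @^-1` (~` T))) => //.
  by rewrite S0P//; exact: measurableC.
have key A C : measurable A -> measurable C ->
    A `&` S0 @^-1` T `<=` C -> mu A <= mu C.
  move=> mA mC AC; rewrite -[leRHS]adde0 -nST.
  apply: le_trans (measureU2 _ _ _) => //; last exact: measurableC.
  apply: le_measure; rewrite ?inE//; first by apply: measurableU => //; exact: measurableC.
  move=> t At; have [?|?] := pselect ((S0 @^-1` T) t); last by right.
  by left; exact: AC.
apply/eqP; rewrite eq_le; apply/andP; split; apply: key => // t [/= + TS].
  by rewrite mem_set.
by rewrite mem_set.
Qed.

End transport_rV.

(** * Near-identity transport and stability of W2 *)

Section enorm.
Context {R : realType} {p : nat}.
Implicit Types v w : 'rV[R]_p.

Lemma enorm_ge0 v : 0 <= enorm v. Proof. exact: sqrtr_ge0. Qed.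

Lemma sqr_enorm v : enorm v ^+ 2 = \sum_i v ord0 i ^+ 2.
Proof. by rewrite sqr_sqrtr// sumr_ge0// => i _; exact: sqr_ge0. Qed.

Lemma enorm_le_sum v : enorm v <= \sum_i `|v ord0 i|.
Proof.
rewrite -[leRHS]ger0_norm ?sumr_ge0// -sqrtr_sqr ler_wsqrtr// expr2 big_distrl/=.
apply: ler_sum => i _; rewrite -[leLHS]real_normK ?num_real// expr2.
by rewrite ler_wpM2l// (bigD1 i)//= lerDl sumr_ge0.
Qed.

Lemma measurable_enorm : measurable_fun setT (@enorm R p).
Proof.
apply: (@measurableT_comp _ _ _ _ _ _ (@Num.sqrt R)).
  by apply: continuous_measurable_fun; exact: sqrt_continuous.
apply: measurable_sum => i; apply: measurable_funX; exact: measurable_coord.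
Qed.

Lemma cauchy_schwarz_enorm v w :
  `|\sum_i v ord0 i * w ord0 i| <= enorm v * enorm w.
Proof.
rewrite -sqrtr_sqr -sqrtrM ?sumr_ge0//; last by move=> i _; exact: sqr_ge0.
rewrite ler_wsqrtr//.
have [w0|w0] := eqVneq (\sum_i w ord0 i ^+ 2) 0.
  have wi i : w ord0 i = 0.
    apply/eqP; rewrite -sqrf_eq0; move/eqP: w0.
    by rewrite psumr_eq0 => [/allP/(_ i (mem_index_enum i))//|j _]; exact: sqr_ge0.
  by rewrite w0 mulr0 big1 ?expr0n// => i _; rewrite wi mulr0.
set a := \sum_i v ord0 i ^+ 2; set b := \sum_i w ord0 i ^+ 2 in w0 *.
set c := \sum_i v ord0 i * w ord0 i.
have b0 : 0 < b by rewrite lt_neqAle eq_sym w0 sumr_ge0// => i _; exact: sqr_ge0.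
(* With b = |w|^2, c the inner product and a = |v|^2, this sum of squares equals b (a b - c^2). *)
have : 0 <= \sum_i (b * v ord0 i - c * w ord0 i) ^+ 2.
  by apply: sumr_ge0 => i _; exact: sqr_ge0.
have -> : \sum_i (b * v ord0 i - c * w ord0 i) ^+ 2 = b ^+ 2 * a - b * c * c *+ 2 + c ^+ 2 * b.
  transitivity (\sum_i (b ^+ 2 * v ord0 i ^+ 2 + - (b * c *+ 2) * (v ord0 i * w ord0 i)
      + c ^+ 2 * w ord0 i ^+ 2)); first by apply: eq_bigr => i _; ring.
  by rewrite !big_split/= -!mulr_sumr -/a -/b -/c; ring.
have -> : b ^+ 2 * a - b * c * c *+ 2 + c ^+ 2 * b = b * (a * b - c ^+ 2) by ring.
by rewrite pmulr_rge0// subr_ge0.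
Qed.

Lemma enorm_triangle v w : enorm (v + w) <= enorm v + enorm w.
Proof.
rewrite -[leRHS]ger0_norm ?addr_ge0 ?enorm_ge0// -sqrtr_sqr ler_wsqrtr//.
rewrite sqrrD !sqr_enorm.
have -> : \sum_i (v + w) ord0 i ^+ 2 =
    \sum_i v ord0 i ^+ 2 + (\sum_i v ord0 i * w ord0 i) *+ 2 + \sum_i w ord0 i ^+ 2.
  rewrite -sumrMnl -!big_split/=; apply: eq_bigr => i _; rewrite mxE; ring.
rewrite lerD2r lerD2l lerMn2r/= (le_trans (ler_norm _))//.
exact: cauchy_schwarz_enorm.
Qed.

End enorm.

Section lebesgue_rV_facts.
Context {R : realType}.
Local Open Scope ereal_scope.

(** Provides the atomless coordinate that [transport_exists] asks of a source with a density. *)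
Lemma lebesgue_rV_hyperplane p (hp : (0 < p)%N) (c : R) :
  lebesgue_rV p [set t : 'rV[R]_p | t 0%R (Ordinal hp) = c] = 0.
Proof.
case: p hp => // p hp; rewrite /= /lebesgue_rV_step /pushforward.
rewrite (_ : _ @^-1` _ = [set c] `*` [set: 'rV[R]_p]).
  by rewrite product_measure1E// [X in X * _](_ : _ = 0) ?mul0e//; exact: lebesgue_measure_set1.
have -> : Ordinal hp = ord0 by exact: val_inj.
by apply/seteqP; split => -[x v] /=; rewrite mxE unlift_none/= => // -[].
Qed.

Lemma closed_measurable_rV p (A : set 'rV[R]_p) : closed A -> measurable A.
Proof.
move=> cA; rewrite -[A]setCK; apply: measurableC; apply: sub_sigma_algebra.
exact: closed_openC.
Qed.

Lemma compact_rV_box p (T : set 'rV[R]_p) : compact T ->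
  exists2 M : R, (0 < M)%R & forall t i, T t -> (`|t ord0 i| <= M)%R.
Proof.
move=> /compact_bounded[M [_ MT]]; exists (`|M| + 1)%R; first by rewrite ltr_wpDl.
move=> t i Tt; apply: le_trans (MT (`|M| + 1)%R _ t Tt).
  by rewrite [leRHS]mx_normrE (le_bigmax _ (fun ij => `|t ij.1 ij.2|)%R (ord0, i)).
by rewrite (le_lt_trans (ler_norm _))// ltrDl.
Qed.

Lemma lebesgue_rV_compact_fin p (T : set 'rV[R]_p) : compact T ->
  lebesgue_rV p T < +oo.
Proof.
move=> cT; have [M M0 TM] := compact_rV_box cT.
(* The boxes of [lebesgue_rV_box] are open on the left, so the lower corner is moved beyond -M. *)
pose a : 'rV[R]_p := const_mx (- (M + 1))%R.
pose b : 'rV[R]_p := const_mx M.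
have ab i : (a 0%R i <= b 0%R i)%R by rewrite !mxE; lra.
have boxE := lebesgue_rV_box ab.
have mbox : measurable [set v : 'rV[R]_p | forall i, (a 0 i < v 0 i <= b 0 i)%R].
  have -> : [set v : 'rV[R]_p | forall i, (a 0 i < v 0 i <= b 0 i)%R] =
      \bigcap_(i in [set: 'I_p]) ((fun v => v 0%R i) @^-1` `]a 0%R i, b 0%R i]%classic).
    apply/seteqP; split => v vab i; first by move=> _; rewrite /= in_itv/= vab.
    by have := vab i I; rewrite /= in_itv.
  apply: fin_bigcap_measurable => // i _.
  by rewrite -[X in measurable X]setTI; exact: measurable_coord.
apply: (@le_lt_trans _ _ (lebesgue_rV p [set v : 'rV[R]_p | forall i, (a 0 i < v 0 i <= b 0 i)%R])).
  apply: le_measure; rewrite ?inE//.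
    by apply: closed_measurable_rV; exact: compact_closed.
  move=> t Tt i; have := TM t i Tt; rewrite ler_norml !mxE => /andP[tM ->].
  by rewrite andbT; lra.
by rewrite boxE ltry.
Qed.

End lebesgue_rV_facts.

Section cells.
Context {R : realType} {p : nat}.

Lemma measurable_rat_box (q : 'rV[rat]_p * nat) :
  measurable (rat_box q : set 'rV[R]_p).
Proof.
have -> : rat_box q = \bigcap_(i in [set: 'I_p])
    ((fun v : 'rV[R]_p => v 0 i) @^-1` ball (ratr (q.1 0 i) : R) q.2.+1%:R^-1).
  apply/seteqP; split => v vq i.
    by move=> _; rewrite /= /ball/= distrC; exact: vq.
  by have := vq i I; rewrite /= /ball/= distrC.
apply: fin_bigcap_measurable => // i _.
rewrite -[X in measurable X]setTI; apply: measurable_coord => //.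
exact: measurable_ball.
Qed.

(** Rational boxes of half-side 1/(N+1) < e/2/(p+1) are enumerated and made disjoint. Coordinates
    within a cell differ by at most e/(p+1), and the Euclidean norm is at most the sum of the p
    coordinates; p+1 keeps the divisor positive. *)
Lemma small_cells (e : R) : 0 < e -> exists Q : (set 'rV[R]_p)^nat,
  [/\ forall n, measurable (Q n), trivIset setT Q, \bigcup_n Q n = setT &
      forall n s t, Q n s -> Q n t -> enorm (s - t) <= e].
Proof.
move=> e0; have pe0 : 0 < e / 2 / p.+1%:R by rewrite !divr_gt0.
have [N _ /(_ N (leqnn N))/= Ne] := near_infty_natSinv_lt (PosNum pe0).
pose B n : set 'rV[R]_p :=
  if choice.unpickle n is Some q then rat_box (q : 'rV[rat]_p, N) else set0.
have mB n : measurable (B n).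
  by rewrite /B; case: choice.unpickle => // q; exact: measurable_rat_box.
exists (seqDU B); split.
- by move=> n; apply: measurableD => //; exact: bigsetU_measurable.
- exact: trivIset_seqDU.
- rewrite -seqDU_bigcup_eq; apply/seteqP; split => // v _.
  have /choice[q qP] : forall i : 'I_p, exists q : rat,
      `|v 0 i - ratr q| < N.+1%:R^-1.
    move=> i; have N0 : 0 < N.+1%:R^-1 :> R by rewrite invr_gt0.
    have [q] : exists q, ratr q \in `]v 0 i - N.+1%:R^-1, v 0 i[.
      by apply: rat_in_itvoo; rewrite ltrBlDr ltrDl.
    rewrite in_itv/= => /andP[q1 q2]; exists q.
    by rewrite gtr0_norm ?subr_gt0// ltrBlDr -ltrBlDl.
  exists (choice.pickle (\row_i q i)) => //; rewrite /B choice.pickleK => i /=.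
  by rewrite mxE.
- move=> n s t [+ _] [+ _]; rewrite /B; case: choice.unpickle => // q sq tq.
  apply: (le_trans (enorm_le_sum _)).
  apply: (@le_trans _ _ (\sum_(i < p) e / p.+1%:R)).
    apply: ler_sum => i _; rewrite !mxE -(subrKA (ratr (q 0 i))).
    apply: (le_trans (ler_normD _ _)).
    have -> : e / p.+1%:R = e / 2 / p.+1%:R + e / 2 / p.+1%:R.
      by rewrite -mulrDl -splitr.
    apply: lerD; apply/ltW/(lt_trans _ Ne); first exact: sq.
    by rewrite distrC; exact: tq.
  rewrite sumr_const card_ord -[leLHS]mulr_natr -mulrA ler_piMr ?(ltW e0)//.
  by rewrite mulrC ler_pdivrMr// mul1r ler_nat.
Qed.

End cells.

Section near_identity_transport.
Context {R : realType} {p : nat}.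
Local Notation leb := (lebesgue_rV p).
Local Open Scope ereal_scope.

Variables (f g : 'rV[R]_p -> R).
Hypothesis p_gt0 : (0 < p)%N.
Hypotheses (mf : measurable_fun setT f) (mg : measurable_fun setT g).
Hypotheses (f0 : forall t, (0 <= f t)%R) (g0 : forall t, (0 <= g t)%R).
Hypothesis ffin : \int[leb]_t (f t)%:E < +oo.
Hypothesis fg : \int[leb]_t (f t)%:E = \int[leb]_t (g t)%:E.

Let lo t := Num.min (f t) (g t).
Let up t := Num.max (f t - g t)%R 0%R.
Let dn t := Num.max (g t - f t)%R 0%R.

Let mlo : measurable_fun setT lo. Proof. exact: measurable_minr. Qed.
Let mup : measurable_fun setT up.
Proof. by apply: measurable_maxr => //; exact: measurable_funB. Qed.
Let mdn : measurable_fun setT dn.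
Proof. by apply: measurable_maxr => //; exact: measurable_funB. Qed.
Let lo0 t : (0 <= lo t)%R. Proof. by rewrite le_min f0 g0. Qed.
Let up0 t : (0 <= up t)%R. Proof. by rewrite le_max lexx orbT. Qed.
Let dn0 t : (0 <= dn t)%R. Proof. by rewrite le_max lexx orbT. Qed.

Let m_f : {measure set 'rV[R]_p -> \bar R} := density leb mf f0.
Let m_g : {measure set 'rV[R]_p -> \bar R} := density leb mg g0.
Let m_lo : {measure set 'rV[R]_p -> \bar R} := density leb mlo lo0.
Let m_up : {measure set 'rV[R]_p -> \bar R} := density leb mup up0.
Let m_dn : {measure set 'rV[R]_p -> \bar R} := density leb mdn dn0.

Let densityD (h1 h2 h3 : 'rV[R]_p -> R) (m1 : measurable_fun setT h1)
    (m2 : measurable_fun setT h2) (m3 : measurable_fun setT h3)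
    (h10 : forall t, (0 <= h1 t)%R) (h20 : forall t, (0 <= h2 t)%R)
    (h30 : forall t, (0 <= h3 t)%R) A : measurable A ->
  (forall t, h1 t = h2 t + h3 t)%R ->
  density leb m1 h10 A = density leb m2 h20 A + density leb m3 h30 A.
Proof.
move=> mA h123; rewrite /density.
under eq_integral do rewrite h123 EFinD.
rewrite ge0_integralD//.
- by move=> t _; rewrite lee_fin.
- by apply/measurable_EFinP; exact: measurable_funTS.
- by move=> t _; rewrite lee_fin.
- by apply/measurable_EFinP; exact: measurable_funTS.
Qed.

Let m_fE A : measurable A -> m_f A = m_lo A + m_up A.
Proof.
move=> mA; apply: densityD => // t.
by rewrite /lo /up; case: (leP (f t) (g t)) => h; rewrite /Num.min /Num.max; case: ifPn; lra.
Qed.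

Let m_gE A : measurable A -> m_g A = m_lo A + m_dn A.
Proof.
move=> mA; apply: densityD => // t.
by rewrite /lo /dn; case: (leP (f t) (g t)) => h; rewrite /Num.min /Num.max; case: ifPn; lra.
Qed.

Let m_f_fin : m_f setT < +oo. Proof. exact: ffin. Qed.

Let m_lo_fin : m_lo setT \is a fin_num.
Proof.
rewrite ge0_fin_numE//; apply: le_lt_trans m_f_fin.
by rewrite m_fE// leeDl.
Qed.

Let m_up_fin A : measurable A -> m_up A \is a fin_num.
Proof.
move=> mA; rewrite ge0_fin_numE//; apply: le_lt_trans m_f_fin.
rewrite m_fE//; apply: (@le_trans _ _ (m_up setT)).
  by apply: le_measure; rewrite ?inE.
by rewrite leeDr.
Qed.

Let m_up_dn : m_up setT = m_dn setT.
Proof.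
have : m_f setT = m_g setT by exact: fg.
rewrite m_fE// m_gE//.
by move/(congr1 (fun z => z - m_lo setT)); rewrite ![m_lo setT + _]addeC !addeK.
Qed.

(* Each small cell keeps the part [min f g] of its mass, and its excess over [g] is
   spread over all of [T] proportionally to [max (g - f) 0]. *)
Lemma near_identity_transport (T : set 'rV[R]_p) (e Dm : R) :
  measurable T -> T !=set0 -> (forall t, ~ T t -> f t = 0%R) ->
  (forall t, ~ T t -> g t = 0%R) -> (0 < e)%R -> (0 <= Dm)%R ->
  (forall s t, T s -> T t -> enorm (s - t) <= Dm)%R ->
  exists S : 'rV[R]_p -> 'rV[R]_p,
    [/\ measurable_fun setT S, forall t, T (S t),
        forall B, measurable B ->
          \int[leb]_(t in S @^-1` B) (f t)%:E = \int[leb]_(t in B) (g t)%:E &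
        \int[leb]_t (enorm (t - S t) * f t)%:E <=
          e%:E * \int[leb]_t (f t)%:E +
          Dm%:E * \int[leb]_t (Num.max (f t - g t) 0)%:E].
Proof.
move=> mT [t0 Tt0] fT gT e0 Dm0 diamT.
have [Q [mQ tQ QT Qe]] := @small_cells R p e e0.
pose M := m_up setT.
(* Share of the cell in the total excess of [f] over [g]. If M = 0 the quotient is 0 and [alphaM]
   still holds, every excess being null. *)
pose alpha n : R := (fine (m_up (Q n)) / fine M)%R.
have alpha0 n : (0 <= alpha n)%R by apply: divr_ge0; apply: fine_ge0; exact: measure_ge0.
have alphaM n : (alpha n)%:E * M = m_up (Q n).
  have [M0|M0] := eqVneq M 0.
    rewrite M0 mule0; apply/esym/eqP; rewrite -measure_le0 -M0.
    by apply: le_measure; rewrite ?inE.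
  have MF : M \is a fin_num by exact: m_up_fin.
  by rewrite -[X in _ * X](fineK MF) -EFinM divfK ?fine_eq0// fineK// m_up_fin.
(* Target of the mass of [f] in [Q n]. The masses agree because total excess and total deficit are
   equal, and the targets add up to [lo + dn], that is to [g]. *)
pose h n t := (lo t * \1_(Q n) t + alpha n * dn t)%R.
have mh n : measurable_fun setT (h n).
  apply: measurable_funD; apply: measurable_funM => //.
have h0 n t : (0 <= h n t)%R.
  by rewrite addr_ge0// mulr_ge0.
pose fQ n t := (f t * \1_(Q n) t)%R.
have mfQ n : measurable_fun setT (fQ n) by apply: measurable_funM.
have fQ0 n t : (0 <= fQ n t)%R by rewrite mulr_ge0.
have indicE' (k : 'rV[R]_p -> R) A n : \int[leb]_(t in A) (k t * \1_(Q n) t)%:E =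
    \int[leb]_(t in A `&` Q n) (k t)%:E.
  rewrite [RHS]integral_mkcondr; apply: eq_integral => t _.
  by rewrite patchE indicE; case: ifPn => _; rewrite ?mulr1 ?mulr0.
have hE n A : measurable A ->
    density leb (mh n) (h0 n) A = m_lo (A `&` Q n) + (alpha n)%:E * m_dn A.
  move=> mA; rewrite /density /h; under eq_integral do rewrite EFinD.
  rewrite ge0_integralD//; last 4 first.
  - by move=> t _; rewrite lee_fin mulr_ge0.
  - by apply/measurable_EFinP; apply: measurable_funTS; exact: measurable_funM.
  - by move=> t _; rewrite lee_fin mulr_ge0.
  - by apply/measurable_EFinP; apply: measurable_funTS; exact: measurable_funM.
  rewrite indicE'; congr (_ + _); under eq_integral do rewrite EFinM.
  rewrite ge0_integralZl//.
  - by apply/measurable_EFinP; apply: measurable_funTS.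
  - by move=> t _; rewrite lee_fin.
  - by rewrite lee_fin.
have fQE n A : density leb (mfQ n) (fQ0 n) A = m_f (A `&` Q n).
  exact: indicE'.
have /choice[S SP] : forall n, exists S : 'rV[R]_p -> 'rV[R]_p,
    [/\ measurable_fun setT S, forall t, T (S t) &
        forall B, measurable B -> m_f (S @^-1` B `&` Q n) =
          m_lo (B `&` Q n) + (alpha n)%:E * m_dn B].
  move=> n; have [||||||S [mS TS SP]] := @transport_exists R p (Ordinal p_gt0)
    (density leb (mfQ n) (fQ0 n)) (density leb (mh n) (h0 n)) T t0.
  - by [].
  - by [].
  - change (density leb (mfQ n) (fQ0 n) setT < +oo).
    by rewrite fQE setTI; apply: le_lt_trans m_f_fin; apply: le_measure; rewrite ?inE.
  - change (density leb (mfQ n) (fQ0 n) setT = density leb (mh n) (h0 n) setT).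
    by rewrite fQE hE// setTI m_fE// -m_up_dn alphaM.
  - change (density leb (mh n) (h0 n) (~` T) = 0); rewrite hE; last exact: measurableC.
    rewrite /m_lo /m_dn /= /density !integral0_eq ?mule0 ?adde0// => t.
      by move=> Tt; rewrite /dn fT// gT// subrr maxxx.
    by move=> [Tt _]; rewrite /lo fT// gT// minxx.
  - move=> c; change (density leb (mfQ n) (fQ0 n)
      ((fun t : 'rV[R]_p => t 0%R (Ordinal p_gt0)) @^-1` [set c]) = 0).
    apply: null_set_integral => //.
    + by rewrite -[X in measurable X]setTI; exact: measurable_coord.
    + by apply/measurable_EFinP; exact: measurable_funTS.
    + exact: lebesgue_rV_hyperplane.
  by exists S; split => // B mB; rewrite -fQE -hE//; exact: SP.
have mS n : measurable_fun setT (S n) by have [] := SP n.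
have TS n t : T (S n t) by have [] := SP n.
have {}SP n B : measurable B -> m_f (S n @^-1` B `&` Q n) =
  m_lo (B `&` Q n) + (alpha n)%:E * m_dn B by have [_ _] := SP n; exact.
have mSB n B : measurable B -> measurable (S n @^-1` B `&` Q n).
  move=> mB; apply: measurableI => //.
  by rewrite -[X in measurable X]setTI; exact: mS.
have /choice[k kP] : forall t, exists n, Q n t.
  by move=> t; have : setT t by []; rewrite -QT => -[n _ Qt]; exists n.
have kE n t : Q n t -> k t = n.
  move=> Qt; apply: (tQ (k t) n) => //.
  by exists t; split => //; exact: kP.
have SE B : (fun t => S (k t) t) @^-1` B = \bigcup_n (S n @^-1` B `&` Q n).
  apply/seteqP; split => t /=; first by move=> St; exists (k t).
  by move=> [n _ [St Qt]]; rewrite (kE n).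
have tSB B : trivIset setT (fun n => S n @^-1` B `&` Q n) by exact: trivIset_setIl.
have bigQ (m : {measure set 'rV[R]_p -> \bar R}) B : measurable B ->
    m B = \sum_(n <oo) m (B `&` Q n).
  move=> mB; rewrite -[in LHS](setIT B) -QT setI_bigcupr measure_semi_bigcup//.
  - by move=> n; exact: measurableI.
  - exact: trivIset_setIl.
  - by apply: bigcupT_measurable => n; exact: measurableI.
(* The shares sum to 1 unless M = 0, in which case the deficit is null too and both sides vanish. *)
have alpha_sum B : measurable B -> \sum_(n <oo) (alpha n)%:E * m_dn B = m_dn B.
  move=> mB; have dn_le : m_dn B <= M.
    by rewrite /M m_up_dn; apply: le_measure; rewrite ?inE.
  have [M0|M0] := eqVneq M 0.
    have -> : m_dn B = 0 by apply/eqP; rewrite -measure_le0 -M0.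
    by rewrite eseries0// => n _ _; rewrite mule0.
  have MF : M \is a fin_num by exact: m_up_fin.
  have dnF : m_dn B \is a fin_num.
    by rewrite ge0_fin_numE//; apply: le_lt_trans dn_le _; rewrite ltey_eq MF.
  rewrite -(fineK dnF); under eq_eseriesr do rewrite muleC.
  rewrite nneseriesZl//; last by move=> n _; rewrite lee_fin.
  suff -> : \sum_(n <oo) (alpha n)%:E = 1 by rewrite mule1.
  have : (fine M)%:E * \sum_(n <oo) (alpha n)%:E = (fine M)%:E.
    rewrite -nneseriesZl//; last by move=> n _; rewrite lee_fin.
    rewrite fineK//; under eq_eseriesr do rewrite muleC alphaM.
    by rewrite [RHS](bigQ m_up)//; apply: eq_eseriesr => n _; rewrite setTI.
  have fM0 : fine M != 0%R by rewrite fine_eq0.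
  move/(congr1 (fun z => ((fine M)^-1)%:E * z)).
  by rewrite muleA -!EFinM mulVf// mul1e.
have mSt : measurable_fun setT (fun t => S (k t) t).
  move=> _ B mB; rewrite setTI SE; apply: bigcupT_measurable => n.
  exact: mSB.
exists (fun t => S (k t) t); split.
- by [].
- by move=> t; exact: TS.
- move=> B mB; change (m_f ((fun t => S (k t) t) @^-1` B) = m_g B).
  rewrite SE measure_semi_bigcup//; last 2 first.
    by move=> n; exact: mSB.
    by apply: bigcupT_measurable => n; exact: mSB.
  under eq_eseriesr do rewrite SP//.
  rewrite nneseriesD//; last by move=> n _; rewrite mule_ge0// lee_fin.
  by rewrite alpha_sum// -bigQ// m_gE.
have mcost : measurable_fun setT (fun t : 'rV[R]_p => enorm (t - S (k t) t) * f t)%R.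
  apply: measurable_funM => //; apply: (measurableT_comp measurable_enorm).
  apply: measurable_rV => i; under eq_fun do rewrite !mxE.
  apply: measurable_funB; first exact: measurable_coord.
  exact: (measurableT_comp (measurable_coord i) mSt).
have cost0 t : 0 <= (enorm (t - S (k t) t) * f t)%:E.
  by rewrite lee_fin mulr_ge0// enorm_ge0.
rewrite -[X in integral _ X _]QT ge0_integral_bigcup//; last first.
  by apply/measurable_EFinP; exact: measurable_funTS.
have -> : \int[leb]_t (f t)%:E = \sum_(n <oo) m_f (Q n).
  rewrite -[LHS]/(m_f setT) (bigQ m_f)//.
  by apply: eq_eseriesr => n _; rewrite setTI.
have -> : \int[leb]_t (Num.max (f t - g t) 0)%:E = \sum_(n <oo) m_up (Q n).
  rewrite -[LHS]/(m_up setT) (bigQ m_up)//.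
  by apply: eq_eseriesr => n _; rewrite setTI.
rewrite -!nneseriesZl// -nneseriesD//; last 2 first.
  by move=> n _; rewrite mule_ge0// lee_fin ltW.
  by move=> n _; rewrite mule_ge0// lee_fin.
apply: lee_nneseries => [n _ _|n _]; first exact: integral_ge0.
(* Mass that stays in its cell moves by at most e, mass that leaves it by at most Dm. The latter can
   only land on the deficit part of the target, so it amounts to at most [alpha n] times M, the
   excess of the cell. *)
apply: (@le_trans _ _ (e%:E * m_f (Q n) +
    Dm%:E * m_f (S n @^-1` (~` Q n) `&` Q n))); last first.
  rewrite leeD2l// lee_wpmul2l ?lee_fin// SP; last exact: measurableC.
  rewrite setICl measure0 add0e -alphaM lee_wpmul2l ?lee_fin//.
  by rewrite /M m_up_dn; apply: le_measure; rewrite ?inE//; exact: measurableC.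
have mA : measurable (S n @^-1` (~` Q n)).
  by rewrite -[X in measurable X]setTI; apply: mS => //; exact: measurableC.
have mfE : measurable_fun setT (EFin \o f) by exact/measurable_EFinP.
rewrite setIC /m_f /= /density integral_mkcondr.
rewrite -!ge0_integralZl ?lee_fin ?(ltW e0)//; last 4 first.
- by apply/(measurable_restrict _ _ _) => //; exact: measurable_funTS.
- by move=> t _; rewrite erestrict_ge0// => s _; rewrite lee_fin.
- exact: measurable_funTS.
- by move=> t _; rewrite lee_fin.
rewrite -ge0_integralD//; last 4 first.
- by move=> t _; rewrite mule_ge0// lee_fin// ltW.
- by apply: measurable_funeM; exact: measurable_funTS.
- move=> t _; rewrite mule_ge0 ?lee_fin// erestrict_ge0// => s _.
  by rewrite lee_fin.
- apply: measurable_funeM.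
  by apply/(measurable_restrict _ _ _) => //; exact: measurable_funTS.
apply: ge0_le_integral => //.
- by apply/measurable_EFinP; exact: measurable_funTS.
- apply: emeasurable_funD; first by apply: measurable_funeM; exact: measurable_funTS.
  apply: measurable_funeM.
  by apply/(measurable_restrict _ _ _) => //; exact: measurable_funTS.
move=> t Qt; rewrite (kE n)// patchE.
have [Tt|Tt] := pselect (T t); last first.
  by rewrite fT// mulr0 mule0 add0e; case: ifPn => _; rewrite mule0.
case: ifPn => [_|/negP nS].
  rewrite -!EFinM -EFinD lee_fin -mulrDl ler_wpM2r//.
  by apply: le_trans (diamT _ _ Tt (TS n t)) _; rewrite lerDr ltW.
rewrite mule0 adde0 -EFinM lee_fin ler_wpM2r//.
apply: (Qe n) => //; apply: contrapT => QS; apply: nS; exact/mem_set.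
Qed.

End near_identity_transport.

Section wasserstein_stability.
Context {R : realType} {p : nat}.
Local Notation leb := (lebesgue_rV p).
Local Open Scope ereal_scope.

Variables (T : set 'rV[R]_p) (Dm : R).
Hypotheses (p_gt0 : (0 < p)%N) (mT : measurable T) (T0 : T !=set0).
Hypotheses (Dm0 : (0 <= Dm)%R)
  (diamT : forall s t, T s -> T t -> (enorm (s - t) <= Dm)%R).

Let integralI (f : 'rV[R]_p -> R) A :
  \int[leb]_(t in A) ((f \_ T) t)%:E = \int[leb]_(t in A `&` T) (f t)%:E.
Proof.
rewrite integral_mkcondr; apply: eq_integral => t _.
by rewrite !patchE; case: ifPn.
Qed.

Let patch_ge0 (f : 'rV[R]_p -> R) : (forall t, T t -> (0 <= f t)%R) ->
  forall t, (0 <= (f \_ T) t)%R.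
Proof. by move=> f0 t; rewrite patchE; case: ifPn => // /set_mem/f0. Qed.

Let measurable_patch (f : 'rV[R]_p -> R) : measurable_fun T f ->
  measurable_fun setT (f \_ T).
Proof. by move=> mf; apply/(measurable_restrictT _ _).1. Qed.

(** Both densities are extended by zero, which turns transport on the whole space into transport on
    [T]. The change of variables in [phi] follows since the image of the measure with density [f] is
    the one with density [g]. *)
Lemma near_identity_transport_map (f g : 'rV[R]_p -> R) (e : R) :
  measurable_fun T f -> measurable_fun T g ->
  (forall t, T t -> (0 <= f t)%R) -> (forall t, T t -> (0 <= g t)%R) ->
  \int[leb]_(t in T) (f t)%:E < +oo ->
  \int[leb]_(t in T) (f t)%:E = \int[leb]_(t in T) (g t)%:E -> (0 < e)%R ->
  exists S : 'rV[R]_p -> 'rV[R]_p,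
    [/\ measurable_fun setT S, forall t, T (S t), transport_map T f g S,
      forall phi : 'rV[R]_p -> R, measurable_fun T phi ->
        (forall t, T t -> (0 <= phi t)%R) ->
        \int[leb]_(t in T) (phi (S t) * f t)%:E =
        \int[leb]_(t in T) (phi t * g t)%:E &
      \int[leb]_(t in T) (enorm (t - S t) * f t)%:E <=
        e%:E * \int[leb]_(t in T) (f t)%:E +
        Dm%:E * \int[leb]_(t in T) `|f t - g t|%:E].
Proof.
move=> mf mg f0 g0 ffin fg e0.
have := @near_identity_transport R p (f \_ T) (g \_ T) p_gt0
  (measurable_patch mf) (measurable_patch mg) (patch_ge0 f0) (patch_ge0 g0).
rewrite !integralI !setTI => /(_ ffin fg T e Dm mT T0).
have fT t : ~ T t -> (f \_ T) t = 0%R by move=> Tt; rewrite patchE memNset.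
have gT t : ~ T t -> (g \_ T) t = 0%R by move=> Tt; rewrite patchE memNset.
move=> /(_ fT gT e0 Dm0 diamT)[S [mS TS SP Se]].
exists S; split => //.
- split => //; first exact: measurable_funTS.
  by move=> B mB; have := SP B mB; rewrite !integralI !(setIC _ T).
- move=> phi mphi phi0.
  pose m_f := density leb (measurable_patch mf) (patch_ge0 f0).
  pose m_g := density leb (measurable_patch mg) (patch_ge0 g0).
  pose phi' := EFin \o (phi \_ T).
  have mphi' : measurable_fun setT phi'.
    by apply/measurable_EFinP; exact: measurable_patch.
  have phi'0 t : 0 <= phi' t by rewrite lee_fin; exact: patch_ge0.
  have mphiS : measurable_fun setT (phi' \o S) by exact: measurableT_comp.
  transitivity (\int[m_f]_t (phi' \o S) t).
    rewrite ge0_integral_density//; last by move=> t; exact: phi'0.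
    rewrite [LHS]integral_mkcond; apply: eq_integral => t _.
    rewrite /phi'/= !patchE; case: ifPn => Tt; last by rewrite mule0.
    by rewrite (mem_set (TS t)) EFinM.
  transitivity (\int[m_g]_t phi' t); last first.
    rewrite ge0_integral_density//.
    rewrite [RHS]integral_mkcond; apply: eq_integral => t _.
    by rewrite /phi'/= !patchE; case: ifPn => Tt; rewrite ?mule0 ?EFinM.
  transitivity (\int[pushforward m_f S]_t phi' t).
    by rewrite ge0_integral_pushforward.
  apply: eq_measure_integral => A mA _; rewrite /= /pushforward.
  exact: SP.
- apply: le_trans (le_trans _ Se) _.
    rewrite [leLHS]integral_mkcond le_eqVlt; apply/orP; left; apply/eqP.
    apply: eq_integral => t _; rewrite !patchE.
    by case: ifPn => //; rewrite mulr0.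
  rewrite leeD2l// lee_wpmul2l ?lee_fin//.
  rewrite [leRHS]integral_mkcond; apply: ge0_le_integral => //.
  - by move=> t _; rewrite lee_fin le_max lexx orbT.
  - apply/measurable_EFinP; apply: measurable_maxr => //.
    by apply: measurable_funB; exact: measurable_patch.
  - apply/(measurable_restrictT _ _).1 => //; apply/measurable_EFinP.
    by apply: measurableT_comp => //; exact: measurable_funB.
  - move=> t _; rewrite !patchE; case: ifPn => _; last by rewrite subrr maxxx.
    by rewrite lee_fin ge_max ler_norm normr_ge0.
Qed.

Definition transport_cost (f h : 'rV[R]_p -> R) : \bar R :=
  ereal_inf [set \int[leb]_(t in T) (enorm (t - S t) ^+ 2 * f t)%:E |
    S in transport_map T f h].

Lemma transport_cost_ge0 f h : (forall t, T t -> (0 <= f t)%R) ->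
  0 <= transport_cost f h.
Proof.
move=> f0; apply: le_ereal_inf_tmp => _ [S _ <-]; apply: integral_ge0 => t Tt.
by rewrite lee_fin mulr_ge0 ?sqr_ge0 ?f0.
Qed.

Lemma sqr_W2 f h : (forall t, T t -> (0 <= f t)%R) ->
  W2 T f h ^+ 2 = transport_cost f h.
Proof.
move=> f0; have := transport_cost_ge0 h f0.
rewrite /W2 -/(transport_cost f h); case: (transport_cost f h) => [r r0|_|//].
  by rewrite poweR_EFin -EFin_expe powR12_sqrt// sqr_sqrtr.
by rewrite poweRyr ?invr_eq0// expe2 mulyy.
Qed.

Variables (f g : 'rV[R]_p -> R).
Hypotheses (mf : measurable_fun T f) (mg : measurable_fun T g).
Hypotheses (f0 : forall t, T t -> (0 <= f t)%R)
  (g0 : forall t, T t -> (0 <= g t)%R).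
Hypothesis ffin : \int[leb]_(t in T) (f t)%:E < +oo.
Hypothesis fg : \int[leb]_(t in T) (f t)%:E = \int[leb]_(t in T) (g t)%:E.

(** A single transport map suffices, as no point of [T] moves by more than Dm; the accuracy 1 passed
    to the construction is arbitrary. *)
Lemma transport_cost_le :
  transport_cost f g <= (Dm ^+ 2)%:E * \int[leb]_(t in T) (f t)%:E.
Proof.
have [S [mS TS SP _ _]] := near_identity_transport_map mf mg f0 g0 ffin fg ltr01.
apply: (@le_trans _ _ (\int[leb]_(t in T) (enorm (t - S t) ^+ 2 * f t)%:E)).
  by apply: ereal_inf_lbound; exists S.
rewrite -ge0_integralZl ?lee_fin ?sqr_ge0//; last exact/measurable_EFinP.
apply: ge0_le_integral => //.
- by move=> t Tt; rewrite lee_fin mulr_ge0 ?sqr_ge0 ?f0.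
- apply/measurable_EFinP; apply: measurable_funM => //; apply: measurable_funX.
  apply: measurable_funTS; apply: (measurableT_comp measurable_enorm).
  apply: measurable_rV => i; under eq_fun do rewrite !mxE.
  apply: measurable_funB; first exact: measurable_coord.
  exact: (measurableT_comp (measurable_coord i) mS).
- by apply: measurable_funeM; exact/measurable_EFinP.
move=> t Tt; rewrite -EFinM lee_fin ler_wpM2r ?f0//.
by rewrite lerXn2r ?nnegrE ?enorm_ge0// diamT.
Qed.

(** Let S1 go from [f] to [g] and S2 from [g] to [h]. With a = |t - S2 S1 t|, b = |S1 t - S2 S1 t|
    and c = |t - S1 t|, the identity a^2 - b^2 = (a - b)(a + b) and the triangle inequality give a^2
    <= b^2 + 2 Dm c. The mean of b^2 under [f] is the cost of S2, and the mean of c brings the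
    second factor Dm. *)
Lemma transport_cost_lip h :
  transport_cost f h <= transport_cost g h +
    (2 * Dm ^+ 2)%:E * \int[leb]_(t in T) `|f t - g t|%:E.
Proof.
set L := \int[leb]_(t in T) `|f t - g t|%:E.
have mfg : measurable_fun T (fun t => `|f t - g t|)%R.
  by apply: measurableT_comp => //; exact: measurable_funB.
have L0 : 0 <= L by apply: integral_ge0 => t _; rewrite lee_fin.
have LF : L \is a fin_num.
  rewrite ge0_fin_numE//; apply: (@le_lt_trans _ _
      (\int[leb]_(t in T) ((f t)%:E + (g t)%:E))).
    apply: ge0_le_integral => //.
    - exact/measurable_EFinP.
    - by apply: emeasurable_funD; exact/measurable_EFinP.
    - move=> t Tt; rewrite -EFinD lee_fin.
      by apply: le_trans (ler_normB _ _) _; rewrite !ger0_norm ?f0 ?g0.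
  rewrite ge0_integralD//.
  - by rewrite -fg lte_add_pinfty.
  - exact/measurable_EFinP.
  - exact/measurable_EFinP.
set F := \int[leb]_(t in T) (f t)%:E.
have F0 : 0 <= F by apply: integral_ge0 => t Tt; rewrite lee_fin f0.
have FF : F \is a fin_num by rewrite ge0_fin_numE.
apply/lee_addgt0Pr => e e0.
(* Chosen so that 2 Dm e1 F <= e; the summand 1 keeps the divisor positive. *)
pose e1 : R := (e / (2 * Dm * fine F + 1))%R.
have d0 : (0 < 2 * Dm * fine F + 1)%R by rewrite ltr_wpDl// !mulr_ge0// fine_ge0.
have e10 : (0 < e1)%R by rewrite divr_gt0.
have [S1 [mS1 TS1 [_ _ S1P] S1phi S1e]] :=
  near_identity_transport_map mf mg f0 g0 ffin fg e10.
(* The finite error moves to the left, so that the infimum on the right can be tested on each map S2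
   separately. *)
rewrite -addeA -leeBlDr; last by rewrite fin_numD fin_numM.
apply: le_ereal_inf_tmp => _ [S2 [mS2 TS2 S2P] <-].
rewrite leeBlDr; last by rewrite fin_numD fin_numM.
have mS12 : measurable_fun T (S2 \o S1).
  apply: (measurable_comp mT _ mS2); last exact: measurable_funTS.
  by move=> _ [t _ <-]; exact: TS1.
have menorm (S : 'rV[R]_p -> 'rV[R]_p) : measurable_fun T S ->
    measurable_fun T (fun t : 'rV[R]_p => enorm (t - S t)).
  move=> mS; apply: (measurableT_comp measurable_enorm).
  apply: measurable_rV => i; under eq_fun do rewrite !mxE.
  apply: measurable_funB; first by apply: measurable_funTS; exact: measurable_coord.
  exact: (measurableT_comp (measurable_coord i) mS).
apply: (@le_trans _ _ (\int[leb]_(t in T) (enorm (t - (S2 \o S1) t) ^+ 2 * f t)%:E)).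
  apply: ereal_inf_lbound; exists (S2 \o S1) => //; split => //.
    by move=> t Tt; apply: TS2; exact: TS1.
  move=> B mB; rewrite -S2P//.
  have -> : T `&` S2 @^-1` B = T `&` (T `&` S2 @^-1` B) by rewrite setIA setIid.
  rewrite -S1P; last exact: mS2.
  by congr (integral _ _ _); apply/seteqP; split => t /= [Tt] => [?|[_ ?]].
have mphi : measurable_fun T (fun t => enorm (t - S2 t) ^+ 2)%R.
  by apply: measurable_funX; exact: menorm.
rewrite -S1phi//; last by move=> t _; exact: sqr_ge0.
have mcost1 : measurable_fun T (fun t => (enorm (t - S1 t) * f t)%:E).
  apply/measurable_EFinP; apply: measurable_funM => //; apply: menorm.
  exact: measurable_funTS.
have mcost2 : measurable_fun T (fun t => (enorm (S1 t - S2 (S1 t)) ^+ 2 * f t)%:E).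
  apply/measurable_EFinP; apply: measurable_funM => //.
  apply: (measurable_comp mT _ mphi); last exact: measurable_funTS.
  by move=> _ [t _ <-]; exact: TS1.
have cost1_ge0 t : T t -> 0 <= (enorm (t - S1 t) * f t)%:E.
  by move=> Tt; rewrite lee_fin mulr_ge0 ?enorm_ge0 ?f0.
have cost2_ge0 t : T t -> 0 <= (enorm (S1 t - S2 (S1 t)) ^+ 2 * f t)%:E.
  by move=> Tt; rewrite lee_fin mulr_ge0 ?sqr_ge0 ?f0.
have Dm20 : (0 <= 2 * Dm)%R by rewrite mulr_ge0.
apply: (@le_trans _ _ (\int[leb]_(t in T) ((enorm (S1 t - S2 (S1 t)) ^+ 2 * f t)%:E +
    (2 * Dm)%:E * (enorm (t - S1 t) * f t)%:E))).
  apply: ge0_le_integral => //.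
  - by move=> t Tt; rewrite lee_fin mulr_ge0 ?sqr_ge0 ?f0.
  - apply/measurable_EFinP; apply: measurable_funM => //; apply: measurable_funX.
    exact: menorm.
  - by apply: emeasurable_funD => //; exact: measurable_funeM.
  move=> t Tt; rewrite -EFinM -EFinD lee_fin mulrA -mulrDl ler_wpM2r ?f0//=.
  have aD := diamT Tt (TS2 _ (TS1 t)).
  have bD := diamT (TS1 t) (TS2 _ (TS1 t)).
  have := enorm_triangle (t - S1 t) (S1 t - S2 (S1 t)); rewrite subrKA.
  move: aD bD (enorm_ge0 (t - S2 (S1 t))) (enorm_ge0 (S1 t - S2 (S1 t)))
    (enorm_ge0 (t - S1 t)).
  set a := enorm _; set b := enorm _; set c := enorm _ => aD bD a0 b0 c0 abc.
  have [ab|ab] := leP a b; first by nra.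
  have : ((a - b) * (a + b) <= c * (2 * Dm))%R by apply: ler_pM; lra.
  by nra.
rewrite ge0_integralD//; last 2 first.
- by move=> t Tt; rewrite mule_ge0 ?cost1_ge0.
- exact: measurable_funeM.
rewrite leeD2l// ge0_integralZl//.
apply: (@le_trans _ _ ((2 * Dm)%:E * (e1%:E * F + Dm%:E * L))).
  by rewrite lee_wpmul2l.
rewrite -(fineK FF) -(fineK LF) -!EFinM -EFinD lee_fin.
have e1E : (e1 * (2 * Dm * fine F + 1) = e)%R by rewrite /e1 divfK// gt_eqF.
by nra.
Qed.

End wasserstein_stability.

Lemma poweR2 (R : realType) (x : \bar R) : (0 <= x -> x `^ 2 = x ^+ 2)%E.
Proof.
case: x => [r r0|_|//]; first by rewrite poweR_EFin powR_mulrn// EFin_expe.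
by rewrite poweRyr// expe2 mulyy.
Qed.

(** * Bounded functions on T and the negative Sobolev norm *)

Section bounded_functions.
Context {R : realType} {p : nat}.
Local Notation leb := (lebesgue_rV p).
Local Open Scope ereal_scope.

Variable T : set 'rV[R]_p.
Hypotheses (mT : measurable T) (Tfin : leb T < +oo).
Implicit Types f g h : 'rV[R]_p -> R.

(** The bound holds almost everywhere only, since it is extracted from an essential supremum. *)
Definition bounded_on (M : R) f := measurable_fun T f /\
  {ae leb, forall t, T t -> (`|f t| <= M)%R}.

Let measurable_patch f : measurable_fun T f -> measurable_fun setT (f \_ T).
Proof. by move=> mf; apply/(measurable_restrictT _ _).1. Qed.

Lemma sqr_LnormT f : LnormT T 2%:E f ^+ 2 = \int[leb]_(t in T) (f t ^+ 2)%:E.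
Proof.
have := @poweR_Lnorm _ _ R leb (EFin \o (f \_ T)) 2 _.
rewrite poweR2 ?Lnorm_ge0// -/(LnormT T 2%:E f) => ->//.
rewrite [RHS]integral_mkcond; apply: eq_integral => t _ /=.
rewrite !patchE; case: ifPn => _; last by rewrite normr0 powR0// pnatr_eq0.
by rewrite powR_mulrn// real_normK// num_real.
Qed.

Lemma LnormT_ge0 q f : 0 <= LnormT T q f.
Proof. exact: Lnorm_ge0. Qed.

Lemma cauchy_schwarz_LnormT f g : measurable_fun T f -> measurable_fun T g ->
  \int[leb]_(t in T) `|f t * g t|%:E <= LnormT T 2%:E f * LnormT T 2%:E g.
Proof.
move=> mf mg.
have := @hoelder _ _ R leb (f \_ T) (g \_ T) 2 2 (measurable_patch mf) (measurable_patch mg).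
have h2 : (2^-1 + 2^-1 = 1 :> R)%R by lra.
move=> /(_ (ltr0n _ 2) (ltr0n _ 2) h2); apply: le_trans; rewrite Lnorm1 [leLHS]integral_mkcond le_eqVlt.
apply/orP; left; apply/eqP; apply: eq_integral => t _ /=.
by rewrite !patchE; case: ifPn => _; rewrite ?mulr0 ?normr0.
Qed.

Lemma L1_le_LnormT f : measurable_fun T f ->
  \int[leb]_(t in T) `|f t|%:E <= LnormT T 2%:E (cst 1%R) * LnormT T 2%:E f.
Proof.
move=> mf; have := @cauchy_schwarz_LnormT (cst 1%R) f (measurable_cst _) mf.
by under eq_integral do rewrite mul1r.
Qed.

Lemma LnormT1_fin : LnormT T 2%:E (cst 1%R) \is a fin_num.
Proof.
rewrite ge0_fin_numE ?LnormT_ge0//.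
have : LnormT T 2%:E (cst 1%R) ^+ 2 < +oo.
  rewrite sqr_LnormT (_ : \int[leb]_(t in T) _ = leb T)//.
  under eq_integral do rewrite expr1n.
  by rewrite integral_cst// mul1e.
have := LnormT_ge0 2%:E (cst 1%R).
by case: (LnormT T _ _) => [r|_|//]; rewrite ?ltry// expe2 mulyy.
Qed.

Lemma bounded_on_le_integral M f : (0 <= M)%R -> bounded_on M f ->
  \int[leb]_(t in T) `|f t|%:E <= M%:E * leb T.
Proof.
move=> M0 [mf fM]; apply: (integral_le_bound (f := EFin \o f)) => //.
  exact/measurable_EFinP.
Qed.

Lemma bounded_on_integrable M f : bounded_on M f -> leb.-integrable T (EFin \o f).
Proof.
move=> [mf fM]; apply/integrableP; split; first exact/measurable_EFinP.
apply: (@le_lt_trans _ _ (`|M|%:E * leb T)).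
  apply: bounded_on_le_integral => //; split => //.
  by apply: filterS fM => t fM /fM /le_trans; apply; exact: ler_norm.
by rewrite lte_mul_pinfty// lee_fin.
Qed.

Lemma bounded_on_LnormT M f : (0 <= M)%R -> bounded_on M f ->
  LnormT T 2%:E f <= M%:E * LnormT T 2%:E (cst 1%R).
Proof.
move=> M0 [mf fM].
apply: lee_sqrE; first by rewrite mule_ge0 ?LnormT_ge0.
rewrite expe2 [leRHS]expe2 muleACA -!expe2 -EFin_expe !sqr_LnormT -ge0_integralZl ?lee_fin ?sqr_ge0//; last 2 first.
- by apply/measurable_EFinP; exact: measurable_funX.
- by move=> t _; rewrite lee_fin sqr_ge0.
apply: ae_ge0_le_integral => //.
- by move=> t _; rewrite lee_fin sqr_ge0.
- by apply/measurable_EFinP; exact: measurable_funX.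
- by move=> t _; rewrite -EFinM lee_fin mulr_ge0 ?sqr_ge0.
- by apply: measurable_funeM; apply/measurable_EFinP; exact: measurable_funX.
apply: filterS fM => t fM Tt; rewrite -EFinM lee_fin expr1n mulr1.
by rewrite -(real_normK (num_real (f t))) lerXn2r ?nnegrE//; exact: fM.
Qed.

Lemma bounded_onB M N f g : bounded_on M f -> bounded_on N g ->
  bounded_on (M + N) (fun t => f t - g t)%R.
Proof.
move=> [mf fM] [mg gN]; split; first exact: measurable_funB.
by apply: filterS2 fM gN => t + + Tt => /(_ Tt) fM /(_ Tt) gN;
  rewrite (le_trans (ler_normB _ _))// lerD.
Qed.

End bounded_functions.

(** The two difference quotients coincide. It serves to differentiate along one coordinate with the
    others frozen, where L is a slice embedding. *)
Lemma is_derive_affine (R : realType) (U V W : normedModType R) (L : U -> V)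
    (w : U) (v : V) (f : V -> W) (a : U) (df : W) :
  (forall (h : R) b, L (h *: w + b) = h *: v + L b) ->
  is_derive (L a) v f df -> is_derive a w (f \o L) df.
Proof.
move=> Lh [fd fE].
have E : (fun h : R => h^-1 *: (((f \o L) \o shift a) (h *: w) - (f \o L) a)) =
    (fun h : R => h^-1 *: ((f \o shift (L a)) (h *: v) - f (L a))).
  by apply/funext => h /=; rewrite Lh.
by split; rewrite /derivable /derive E.
Qed.

(** * Integrals of partial derivatives on R^p *)

Section continuous_rV.
Context {R : realType}.

Lemma continuous_measurable_rV p (f : 'rV[R]_p -> R) : continuous f ->
  measurable_fun setT f.
Proof.
move=> cf; apply: (measurability _ (RGenOpens.measurableE R)) => _ [_ [a [b ->]] <-].
apply: sub_sigma_algebra; rewrite setTI.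
by apply: open_comp; [move=> v _; exact: cf|exact: interval_open].
Qed.

Lemma continuous_rV_cons_l n (v : 'rV[R]_n) : continuous (fun x : R => rV_cons (x, v)).
Proof.
move=> x; apply/cvg_ballP => e e0.
exists e => //= z xz; split => // i j; rewrite !mxE.
by case: (unlift ord0 j) => [k|] /=; [exact: ballxx|exact: xz].
Qed.

Lemma continuous_rV_cons_r n (x : R) : continuous (fun v : 'rV[R]_n => rV_cons (x, v)).
Proof.
move=> v P /nbhs_ballP[e e0 eP]; apply: filterS (nbhsx_ballx v e e0) => w [_ vw].
apply: eP.
split => // i j; rewrite !mxE.
by case: (unlift ord0 j) => [k|] /=; [exact: vw|exact: ballxx].
Qed.

Lemma rV_consZl n (h x : R) (v : 'rV[R]_n) :
  rV_cons (h *: 1 + x, v) = h *: delta_mx 0 ord0 + rV_cons (x, v).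
Proof.
apply/rowP => j; rewrite !mxE eqxx/=.
case: unliftP => [k ->|->] //=.
by rewrite mulr0 add0r.
Qed.

Lemma rV_consZr n (h x : R) (j : 'I_n) (v : 'rV[R]_n) :
  rV_cons (x, h *: delta_mx 0 j + v) = h *: delta_mx 0 (lift ord0 j) + rV_cons (x, v).
Proof.
apply/rowP => k; rewrite !mxE eqxx/=.
case: unliftP => [l ->|->] /=; last by rewrite mulr0 add0r.
by rewrite !mxE eqxx/= (inj_eq lift_inj) //.
Qed.

Local Open Scope ereal_scope.

Lemma rV_box_compact p (M : R) : (0 < M)%R -> compact [set t : 'rV[R]_p | forall i, t 0%R i \in `[(- M)%R, M]].
Proof.
by move=> M0; apply: (@rV_compact _ _ (fun=> `[(- M)%R, M]%classic)) => i; exact: segment_compact.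
Qed.

Lemma integrable_continuous_bounded_support p (F : 'rV[R]_p -> R) (M : R) : (0 < M)%R ->
  continuous F -> (forall t : 'rV[R]_p, (exists j, (M < `|t 0 j|)%R) -> F t = 0%R) ->
  (lebesgue_rV p).-integrable setT (EFin \o F).
Proof.
move=> M0 cF F0.
pose B := [set t : 'rV[R]_p | forall i, t 0%R i \in `[(- M)%R, M]].
have cB : compact B by exact: rV_box_compact.
have mB : measurable B by apply: closed_measurable_rV; exact: compact_closed.
have [N [_ NF]] : bounded_set (F @` B).
  by apply: compact_bounded; apply: continuous_compact => //; exact: continuous_subspaceT.
have FB t : ~ B t -> F t = 0%R.
  move=> Bt; apply: F0; apply: contrapT => tM; apply: Bt => i.
  rewrite in_itv/= -ler_norml leNgt; apply/negP => Mi; apply: tM; by exists i.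
have mF := continuous_measurable_rV cF.
apply/integrableP; split; first exact/measurable_EFinP.
apply: (@le_lt_trans _ _ (\int[lebesgue_rV p]_t ((`|N| + 1) * \1_B t)%:E)).
  apply: ge0_le_integral => //.
  - by apply: measurableT_comp => //; exact/measurable_EFinP.
  - by apply/measurable_EFinP; apply: measurable_funM.
  move=> t _; rewrite lee_fin indicE; have [Bt|Bt] := pselect (B t).
    rewrite mem_set// mulr1; apply: NF; last by exists t.
    by rewrite (le_lt_trans (ler_norm _))// ltrDl.
  by rewrite FB// normr0 mulr_ge0.
under eq_integral do rewrite EFinM.
rewrite ge0_integralZl ?lee_fin ?addr_ge0//; last first.
  by apply/measurable_EFinP; exact: measurable_indic.
by rewrite integral_indic// setIT lte_mul_pinfty ?lee_fin//; exact: lebesgue_rV_compact_fin.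
Qed.

Lemma integral_derive_eq0 (f F : R -> R) (M : R) : (0 < M)%R ->
  (forall x : R, is_derive x 1%R f (F x)) -> continuous F ->
  (forall x, (M < `|x|)%R -> f x = 0%R /\ F x = 0%R) ->
  \int[lebesgue_measure]_x (F x)%:E = 0.
Proof.
(* The fundamental theorem is applied on an interval widened by 1, so that f vanishes at both
   endpoints. *)
move=> M0 dF cF f0; pose a := (- (M + 1))%R; pose b := (M + 1)%R.
have aM : (M < `|a|)%R by rewrite /a normrN ger0_norm; lra.
have bM : (M < `|b|)%R by rewrite /b ger0_norm; lra.
transitivity (\int[lebesgue_measure]_(x in `[a, b]) (F x)%:E).
  rewrite [RHS]integral_mkcond; apply: eq_integral => x _; rewrite patchE.
  case: ifPn => // /negP xab; suff -> : F x = 0%R by [].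
  apply: (f0 x _).2; rewrite ltNge; apply/negP; rewrite ler_norml => /andP[x1 x2]; apply: xab.
  by rewrite inE/= in_itv/=; apply/andP; rewrite /a /b; split; lra.
have fc : continuous f.
  move=> x; apply: differentiable_continuous; apply/derivable1_diffP.
  by have [] := dF x.
rewrite (@continuous_FTC2 _ F f).
- by rewrite (f0 _ aM).1 (f0 _ bM).1 subee.
- by rewrite /a /b; lra.
- exact: continuous_subspaceT.
- split.
  + by move=> x _; have [] := dF x.
  + by apply: cvg_at_right_filter; exact: fc.
  + by apply: cvg_at_left_filter; exact: fc.
- by move=> x _; rewrite derive1E; have [] := dF x.
Qed.

Lemma ge0_integral_lebesgue_rVS n (f : 'rV[R]_n.+1 -> \bar R) :
  measurable_fun setT f -> (forall t, 0 <= f t) ->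
  \int[lebesgue_rV n.+1]_t f t =
  \int[lebesgue_measure \x lebesgue_rV n]_z f (rV_cons z).
Proof.
move=> mf f0.
have := @ge0_integral_pushforward _ _ (measurableTypeR R * 'rV[R]_n)%type _ R _
  (@measurable_rV_cons R n)
  (@lebesgue_measure R \x lebesgue_rV n) setT f measurableT mf (fun t _ => f0 t).
rewrite preimage_setT => <-.
by apply: eq_measure_integral; first exact: measurable_rV_cons.
Qed.

Lemma integral_lebesgue_rVS n (f : 'rV[R]_n.+1 -> \bar R) :
  measurable_fun setT f ->
  (lebesgue_measure \x lebesgue_rV n).-integrable setT (f \o @rV_cons R n) ->
  \int[lebesgue_rV n.+1]_t f t =
  \int[lebesgue_measure \x lebesgue_rV n]_z f (rV_cons z).
Proof.
move=> mf intf; have := @integral_pushforward _ _ (measurableTypeR R * 'rV[R]_n)%type _ R _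
  (@measurable_rV_cons R n)
  (@lebesgue_measure R \x lebesgue_rV n) setT f mf.
rewrite preimage_setT => /(_ intf measurableT) <-.
by apply: eq_measure_integral; first exact: measurable_rV_cons.
Qed.

(** Fubini and induction on p: a derivative in the head coordinate is integrated first in that
    variable, any other one is a partial derivative on the slices. Vanishing outside a cube is a
    form of bounded support that slices inherit. *)
Lemma integral_partial_eq0 p (f F : 'rV[R]_p -> R) (i : 'I_p) (M : R) : (0 < M)%R ->
  (forall t, is_derive t (delta_mx 0%R i) f (F t)) -> continuous F ->
  (forall t : 'rV[R]_p, (exists j, (M < `|t 0 j|)%R) -> f t = 0%R /\ F t = 0%R) ->
  \int[lebesgue_rV p]_t (F t)%:E = 0.
Proof.
move=> M0; elim: p f F i => [|n IHn] f F i dF cF f0; first by case: i {dF}.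
have iF : (lebesgue_rV n.+1).-integrable setT (EFin \o F).
  apply: (@integrable_continuous_bounded_support n.+1 F M M0 cF) => t tM; exact: (f0 t tM).2.
have mF := continuous_measurable_rV cF.
pose H := fun z : R * 'rV[R]_n => (F (rV_cons z))%:E.
have mH : measurable_fun setT H.
  by apply/measurable_EFinP; exact: (measurableT_comp mF (@measurable_rV_cons R n)).
have iH : (lebesgue_measure \x lebesgue_rV n).-integrable setT H.
  apply/integrableP; split => //; move/integrableP : iF => [_].
  apply: le_lt_trans; rewrite le_eqVlt; apply/orP; left; apply/eqP.
  apply/esym; rewrite ge0_integral_lebesgue_rVS//.
  by apply: measurableT_comp => //; exact/measurable_EFinP.
have -> : \int[lebesgue_rV n.+1]_t (F t)%:E =
    \int[lebesgue_measure \x lebesgue_rV n]_z H z.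
  by rewrite integral_lebesgue_rVS//; exact/measurable_EFinP.
move: dF; case: (unliftP ord0 i) => [j ->|->] dF.
  rewrite -integral12_prod_meas1//; apply: integral0_eq => x _.
  apply: (IHn (fun v => f (rV_cons (x, v))) (fun v => F (rV_cons (x, v))) j).
  - move=> v; apply: (@is_derive_affine _ _ _ _ (fun v => rV_cons (x, v)) _
      (delta_mx 0%R (lift ord0 j)) f v).
    by move=> h w; exact: rV_consZr.
  - by move=> v; apply: continuous_comp; [exact: continuous_rV_cons_r|exact: cF].
  - move=> v [k vk]; apply: f0; exists (lift ord0 k).
    by rewrite mxE liftK.
rewrite -integral21_prod_meas1//; apply: integral0_eq => v _.
apply: (integral_derive_eq0 M0) => [x||x Mx].
- apply: (@is_derive_affine _ _ _ _ (fun x => rV_cons (x, v)) _ (delta_mx 0%R ord0) f x).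
  by move=> h w; exact: rV_consZl.
- by move=> x; apply: continuous_comp; [exact: continuous_rV_cons_l|exact: cF].
- by apply: f0; exists ord0; rewrite mxE unlift_none.
Qed.

End continuous_rV.

(** * Weak gradients and the dual Sobolev norm *)

Section sobolev.
Context {R : realType} {p : nat}.
Local Notation leb := (lebesgue_rV p).
Local Open Scope ereal_scope.

Variable T : set 'rV[R]_p.
Hypothesis cT : compact T.

Let mT : measurable T.
Proof. by apply: closed_measurable_rV; exact: compact_closed. Qed.

Let Tfin : leb T < +oo. Proof. exact: lebesgue_rV_compact_fin. Qed.

Lemma test_function_partial_continuous psi i : test_function T psi ->
  continuous (partial i psi).
Proof. by move=> [Cpsi _ _]; have [_ /(_ i)] := Cpsi 1%N. Qed.

Lemma test_function_partial_out psi i t : test_function T psi -> ~ T t ->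
  psi t = 0%R /\ partial i psi t = 0%R.
Proof.
move=> [Cpsi _ sT] Tt.
have st : ~ closure [set t | psi t != 0%R] t by move=> /sT/interior_subset.
have psi0 : \forall s \near t, psi s = 0%R.
  have : open (~` closure [set t | psi t != 0%R]).
    by apply: closed_openC; exact: closed_closure.
  rewrite openE => /(_ t st); apply: filterS => s /= ss.
  by apply: contrapT => /eqP ps; apply: ss; exact: subset_closure.
split; first by apply: nbhs_singleton psi0.
rewrite /partial (@near_eq_derive _ _ _ psi (cst 0%R)) ?derive_cst//.
Qed.

(** Says that constants have weak gradient zero. *)
Lemma test_function_integral_partial psi i : test_function T psi ->
  (\int[leb]_(t in T) partial i psi t = 0)%R.
Proof.
move=> tpsi; have [Cpsi _ _] := tpsi; have [M M0 TM] := compact_rV_box cT.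
rewrite /Rintegral (_ : integral _ _ _ = 0)//.
rewrite integral_mkcond -[RHS](@integral_partial_eq0 R p psi (partial i psi) i M M0).
- apply: eq_integral => t _; rewrite patchE; case: ifPn => // /negP Tt.
  have nTt : ~ T t by move=> /mem_set.
  by rewrite (test_function_partial_out i tpsi nTt).2.
- by move=> t; split => //; apply: diff_derivable; have [] := Cpsi 1%N.
- exact: test_function_partial_continuous.
- move=> t [j Mt]; apply: (test_function_partial_out i tpsi) => Tt.
  by have := TM t j Tt; rewrite leNgt Mt.
Qed.

Lemma bounded_partial psi i : test_function T psi ->
  exists M, bounded_on T M (partial i psi).
Proof.
move=> tpsi; have cpsi := test_function_partial_continuous (i := i) tpsi.
have [N [_ NF]] : bounded_set (partial i psi @` T).
  by apply: compact_bounded; apply: continuous_compact => //; exact: continuous_subspaceT.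
exists (`|N| + 1)%R; split.
  by apply: measurable_funTS; exact: continuous_measurable_rV.
apply: aeW => t Tt; apply: NF; last by exists t.
by rewrite (le_lt_trans (ler_norm _))// ltrDl.
Qed.

Lemma LnormTD (f g : 'rV[R]_p -> R) : measurable_fun T f -> measurable_fun T g ->
  LnormT T 2%:E (fun t => f t + g t)%R <= LnormT T 2%:E f + LnormT T 2%:E g.
Proof.
move=> mf mg.
have mfT : measurable_fun setT (f \_ T) by apply/(measurable_restrictT _ _).1.
have mgT : measurable_fun setT (g \_ T) by apply/(measurable_restrictT _ _).1.
have := @minkowski_EFin _ _ R leb (f \_ T) (g \_ T) 2 mfT mgT (ler1n _ 2).
apply: le_trans; rewrite le_eqVlt; apply/orP; left; apply/eqP.
apply: eq_Lnorm => t /=; rewrite !patchE.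
by case: ifPn => _ //; rewrite addr0.
Qed.

Lemma L2_mul_integrable (f g : 'rV[R]_p -> R) : L2 T f -> L2 T g ->
  leb.-integrable T (EFin \o (f \* g)%R).
Proof.
move=> [mf f2] [mg g2]; apply/integrableP; split.
  by apply/measurable_EFinP; exact: measurable_funM.
apply: le_lt_trans (cauchy_schwarz_LnormT mT mf mg) _.
rewrite -ge0_fin_numE ?mule_ge0 ?LnormT_ge0// fin_numM//.
  by rewrite ge0_fin_numE ?LnormT_ge0.
by rewrite ge0_fin_numE ?LnormT_ge0.
Qed.

Lemma L2_bounded_on M f : bounded_on T M f -> L2 T f.
Proof.
move=> [mf fM]; split => //.
have : bounded_on T `|M|%R f.
  by split => //; apply: filterS fM => t fM /fM /le_trans; apply; exact: ler_norm.
move=> /(bounded_on_LnormT mT (normr_ge0 M)) /le_lt_trans; apply.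
by rewrite lte_mul_pinfty ?lee_fin// -ge0_fin_numE ?LnormT_ge0// LnormT1_fin.
Qed.

Lemma L2_cst c : L2 T (cst c).
Proof.
apply: (@L2_bounded_on `|c|%R); split; first exact: measurable_cst.
exact: aeW.
Qed.

Lemma L2_integrable f : L2 T f -> leb.-integrable T (EFin \o f).
Proof.
move=> f2; have := L2_mul_integrable f2 (L2_cst 1).
by apply: eq_integrable => // t _ /=; rewrite mulr1.
Qed.

Lemma L2_subcst f c : L2 T f -> L2 T (fun t => f t - c)%R.
Proof.
move=> [mf f2]; have [mc c2] := L2_cst (- c); split; first exact: measurable_funD.
by apply: le_lt_trans (LnormTD mf mc) _; rewrite lte_add_pinfty.
Qed.

(** Allows functions in the supremum that defines [Hm1norm] to be centred, as [poincare] only speaks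
    of mean-zero functions. *)
Lemma H1_subcst phi g c : H1 T phi g -> H1 T (fun t => phi t - c)%R g.
Proof.
move=> [phi2 g2 wg]; split => //; first exact: L2_subcst.
move=> psi tpsi i; rewrite -wg//.
have [M bM] := bounded_partial i tpsi.
have p2 := L2_bounded_on bM.
transitivity (\int[leb]_(t in T) ((phi t * partial i psi t) - c * partial i psi t))%R.
  by apply: eq_Rintegral => t _; rewrite mulrBl.
rewrite RintegralB//; last 2 first.
- exact: L2_mul_integrable.
- by have := L2_mul_integrable (L2_cst c) p2.
rewrite RintegralZl//; last exact: L2_integrable.
by rewrite test_function_integral_partial// mulr0 subr0.
Qed.

Lemma H1_0 : H1 T (cst 0%R) (cst 0%R).
Proof.
split; first exact: L2_cst.
  move=> i; rewrite (_ : (fun t => _) = cst 0%R); first exact: L2_cst.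
  by apply/funext => t; rewrite mxE.
move=> psi _ i.
have E (k : 'rV[R]_p -> R) : (forall t, k t = 0)%R -> (\int[leb]_(t in T) k t = 0)%R.
  by move=> k0; rewrite /Rintegral integral0_eq// => t _; rewrite k0.
by rewrite !E ?oppr0// => t; rewrite ?mxE mul0r.
Qed.

Lemma grad_norm0 : grad_norm T (cst 0%R) = 0.
Proof.
rewrite /grad_norm /LnormT (_ : EFin \o _ = cst 0) ?Lnorm0//.
apply/funext => t /=; rewrite patchE; case: ifPn => // _.
by rewrite /enorm big1 ?sqrtr0// => i _; rewrite mxE expr0n.
Qed.

Lemma Hm1norm_ge0 h : 0 <= Hm1norm T h.
Proof.
apply: ereal_sup_ubound; exists (cst 0%R).
  by exists (cst 0%R); [exact: H1_0|rewrite grad_norm0].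
by apply: integral0_eq => t _; rewrite mulr0.
Qed.

Hypothesis T_pos : 0 < leb T.
Hypothesis T_poincare : poincare T.

(** Since h has mean zero, phi may be replaced by phi minus its mean; Cauchy-Schwarz and the
    Poincare inequality then apply. *)
Lemma Hm1_pairing_le : exists2 C : R, (0 <= C)%R & forall h phi g,
  L2 T h -> \int[leb]_(t in T) (h t)%:E = 0 ->
  H1 T phi g -> grad_norm T g <= 1 ->
  \int[leb]_(t in T) (h t * phi t)%:E <= C%:E * LnormT T 2%:E h.
Proof.
(* [poincare] does not say that its constant is nonnegative. *)
have [C0 CP] := T_poincare; exists (Num.max C0 0)%R; first by rewrite le_max lexx orbT.
move=> h phi g h2 h0 H1phi g1.
have [phi2 _ _] := H1phi.
have iphi := L2_integrable phi2.
pose c : R := (fine (\int[leb]_(t in T) (phi t)%:E) / fine (leb T))%R.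
have TF : leb T \is a fin_num by rewrite ge0_fin_numE.
have ic : leb.-integrable T (EFin \o cst c) by apply: L2_integrable; exact: L2_cst.
have mean0 : \int[leb]_(t in T) (phi t - c)%:E = 0.
  under eq_integral do rewrite EFinB.
  rewrite (integralB mT iphi ic).
  have IF : \int[leb]_(t in T) (phi t)%:E \is a fin_num by exact: integrable_fin_num.
  rewrite (_ : \int[leb]_(t in T) c%:E = \int[leb]_(t in T) (phi t)%:E) ?subee//.
  rewrite (integral_cst _ mT c%:E) -[X in _ * X = _](fineK TF) -EFinM /c divfK ?fineK//.
  by rewrite fine_eq0// gt_eqF.
have H1c := H1_subcst c H1phi.
have phic2 : LnormT T 2%:E (fun t => phi t - c)%R <= (Num.max C0 0)%:E.
  apply: le_trans (CP _ _ H1c mean0) _.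
  apply: (@le_trans _ _ ((Num.max C0 0)%:E * grad_norm T g)).
    by rewrite lee_wpmul2r ?LnormT_ge0// lee_fin le_max lexx.
  by rewrite -[leRHS]mule1 lee_wpmul2l// lee_fin le_max lexx orbT.
have -> : \int[leb]_(t in T) (h t * phi t)%:E =
    \int[leb]_(t in T) (h t * (phi t - c))%:E.
  under [RHS]eq_integral do rewrite mulrBr EFinB.
  rewrite integralB//; last 2 first.
  - exact: (L2_mul_integrable h2 phi2).
  - exact: (L2_mul_integrable h2 (L2_cst c)).
  under [X in _ - X]eq_integral do rewrite mulrC EFinM.
  rewrite integralZl//; last exact: L2_integrable.
  by rewrite h0 mule0 sube0.
apply: (@le_trans _ _ (\int[leb]_(t in T) `|h t * (phi t - c)|%:E)).
  have [[mh _] [mphi _]] := (h2, phi2).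
  apply: (le_trans (lee_abs _)); apply: le_abse_integral => //.
  apply/measurable_EFinP; apply: measurable_funM => //.
  exact: measurable_funB.
apply: le_trans (cauchy_schwarz_LnormT mT _ _) _.
- by have [] := h2.
- by apply: measurable_funB => //; have [] := phi2.
by rewrite muleC lee_wpmul2r// LnormT_ge0.
Qed.

(** The pairing with h1 splits into those with h2 and with h1 - h2; the second is controlled by
    [Hm1_pairing_le]. *)
Lemma Hm1norm_stable : exists2 C : R, (0 <= C)%R & forall h1 h2 : 'rV[R]_p -> R,
  L2 T h1 -> L2 T h2 -> \int[leb]_(t in T) (h1 t)%:E = 0 ->
  \int[leb]_(t in T) (h2 t)%:E = 0 ->
  Hm1norm T h1 <= C%:E * LnormT T 2%:E h1 /\
  Hm1norm T h1 <= Hm1norm T h2 + C%:E * LnormT T 2%:E (fun t => h1 t - h2 t)%R.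
Proof.
have [C C0 CP] := Hm1_pairing_le; exists C => // h1 h2 h1L h2L h10 h20; split.
  by apply: ge_ereal_sup => _ [phi [g gphi g1] <-]; exact: (CP h1 phi g).
apply: ge_ereal_sup => _ [phi [g gphi g1] <-].
have [phi2 _ _] := gphi.
have h12 : L2 T (fun t => h1 t - h2 t)%R.
  have [[m1 n1] [m2 n2]] := (h1L, h2L); split; first exact: measurable_funB.
  apply: le_lt_trans (LnormTD m1 _) _; first exact: measurable_funN.
  rewrite lte_add_pinfty// (_ : LnormT T 2%:E _ = LnormT T 2%:E h2)//.
  rewrite /LnormT -oppe_Lnorm; apply: eq_Lnorm => t /=; rewrite !patchE.
  by case: ifPn => _; rewrite ?oppr0 ?opprK// oppe0.
have -> : \int[leb]_(t in T) (h1 t * phi t)%:E =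
    \int[leb]_(t in T) (h2 t * phi t)%:E +
    \int[leb]_(t in T) ((h1 t - h2 t) * phi t)%:E.
  rewrite -integralD//; last 2 first.
  - exact: (L2_mul_integrable h2L phi2).
  - exact: (L2_mul_integrable h12 phi2).
  by apply: eq_integral => t _; rewrite -EFinD; congr EFin; ring.
apply: leeD.
  by apply: ereal_sup_ubound; exists phi => //; exists g.
apply: (CP (fun t => h1 t - h2 t)%R phi g) => //.
under eq_integral do rewrite EFinB.
by rewrite (integralB mT (L2_integrable h1L) (L2_integrable h2L)) h10 h20 subee.
Qed.

End sobolev.

(** * Stability of the fidelity functionals *)

Section locally_lipschitz.
Context {R : realType}.
Variable sigma : R -> R.
Hypothesis sigma_lip : forall r : R,
  exists2 U : set R, nbhs r U & [lipschitz sigma s | s in U].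

Lemma locally_lipschitz_at (r : R) : exists e L : R, [/\ 0 < e, 0 <= L &
  forall s t, `|r - s| < e -> `|r - t| < e ->
    `|sigma s - sigma t| <= L * `|s - t|].
Proof.
have [U /nbhs_ballP[e /= e0 eU] [L [_ LU]]] := sigma_lip r.
exists e, (`|L| + 1); split => //.
move=> s t rs rt.
by apply: (LU (`|L| + 1) _ (s, t)); [rewrite (le_lt_trans (ler_norm _))// ltrDl|split; exact: eU].
Qed.

Lemma locally_lipschitz_continuous : continuous sigma.
Proof.
move=> r; have [e [L [e0 L0 Lr]]] := locally_lipschitz_at r.
apply/cvgrPdist_lt => d d0.
have de0 : 0 < Num.min e (d / (L + 1)).
  by rewrite lt_min e0 divr_gt0// ltr_wpDl.
near=> s.
have rs : `|r - s| < Num.min e (d / (L + 1)).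
  by near: s; exact: cvgr_dist_lt.
move: rs; rewrite lt_min => /andP[rse rsd].
apply: le_lt_trans (Lr _ _ _ rse) _; first by rewrite subrr normr0.
apply: (@le_lt_trans _ _ ((L + 1) * `|r - s|)); first by rewrite ler_wpM2r// lerDl.
by rewrite mulrC -ltr_pdivlMr// ltr_wpDl.
Unshelve. all: by end_near. Qed.

(** Compactness of the square [-M, M]^2 of pairs. Near a diagonal point the local Lipschitz constant
    serves; near a pair of distinct points the distance is bounded below and sigma is bounded, so a
    large constant suffices. *)
Lemma locally_lipschitz_itv (M : R) : exists2 L : R, 0 <= L &
  forall s t, `|s| <= M -> `|t| <= M -> `|sigma s - sigma t| <= L * `|s - t|.
Proof.
have cK : compact (`[- M, M]%classic `*` `[- M, M]%classic : set (R * R)).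
  by apply: compact_setX; exact: segment_compact.
have cs := locally_lipschitz_continuous.
have /compact_near_coveringP nK := cK.
pose P (L : R) (z : R * R) := `|sigma z.1 - sigma z.2| <= L * `|z.1 - z.2|.
have nP : forall z, (`[- M, M]%classic `*` `[- M, M]%classic) z ->
    \forall z' \near z & L \near +oo, P L z'.
  move=> [a b] _ /=; have [<-{b}|ab] := eqVneq a b.
    have [e [L [e0 L0 Lr]]] := locally_lipschitz_at a.
    exists (ball a e `*` ball a e, [set K | L <= K]).
      split; first by exists (ball a e, ball a e) => //; split; exact: nbhsx_ballx.
      exact/nbhs_pinfty_ge/num_real.
    move=> [[s t] K] /= [[sa ta] LK]; apply: (le_trans (Lr _ _ sa ta)).
    by rewrite ler_wpM2r.
  (* Moving each point by less than |a - b| / 4 keeps the pair at distance at least d, while sigma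
     changes by less than 1 at each; the 2 in [K0] pays for this. *)
  pose d := `|a - b| / 2.
  have d0 : 0 < d by rewrite divr_gt0// normr_gt0 subr_eq0.
  pose d4 := d / 2; have d40 : 0 < d4 by rewrite divr_gt0.
  pose K0 := (`|sigma a| + `|sigma b| + 2) / d.
  exists ((fun z : R * R => `|sigma z.1| < `|sigma a| + 1 /\ `|sigma z.2| < `|sigma b| + 1 /\
     d <= `|z.1 - z.2|), [set K | K0 <= K]).
    split; last exact/nbhs_pinfty_ge/num_real.
    exists ([set s | `|sigma s| < `|sigma a| + 1 /\ `|a - s| < d4],
            [set t | `|sigma t| < `|sigma b| + 1 /\ `|b - t| < d4]).
      have near c : nbhs c [set s | `|sigma s| < `|sigma c| + 1 /\ `|c - s| < d4].
        near=> s; split; last by near: s; exact: cvgr_dist_lt.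
        have : `|sigma c - sigma s| < 1 by near: s; apply: cvgr_dist_lt => //; exact: cs.
        move=> h; rewrite -[X in `|X| < _](subrK (sigma c)) (le_lt_trans (ler_normD _ _))//.
        by rewrite addrC ltrD2l distrC.
      by split; exact: near.
    move=> [s t] /= [[sa ad] [tb bd]]; split => //; split => //.
    have := ler_normD (a - s) ((s - t) + (t - b)).
    have := ler_normD (s - t) (t - b).
    have -> : a - s + (s - t + (t - b)) = a - b by ring.
    rewrite (distrC t b); have : `|a - b| = d * 2 by rewrite /d divfK.
    have : d = d4 * 2 by rewrite /d4 divfK.
    by move: ad bd; lra.
  move=> [[s t] K] /= [[sa [tb st]] KK].
  apply: (@le_trans _ _ (K0 * d)).
    rewrite /K0 divfK ?gt_eqF// (le_trans (ler_normB _ _))//; lra.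
  apply: ler_pM => //; last exact: ltW.
  by rewrite divr_ge0// ?ltW// !addr_ge0.
have [L0 [_ L0P]] := nK R _ P _ nP; exists (`|L0| + 1); first by rewrite addr_ge0.
move=> s t sM tM; apply: (L0P (`|L0| + 1) _ (s, t)).
  by rewrite (le_lt_trans (ler_norm _))// ltrDl.
by split; rewrite /= in_itv/= -ler_norml.
Unshelve. all: by end_near. Qed.

Hypothesis sigma_pos : forall r, 0 < sigma r.

Lemma positive_bounds_itv (M : R) : 0 <= M -> exists c C : R, 0 < c /\
  forall s, `|s| <= M -> c <= sigma s <= C.
Proof.
move=> M0; have MM : - M <= M by lra.
have cs : {within `[- M, M], continuous sigma}.
  by apply: continuous_subspaceT; exact: locally_lipschitz_continuous.
have [a _ aP] := EVT_min MM cs; have [b _ bP] := EVT_max MM cs.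
exists (sigma a), (sigma b); split => // s; rewrite ler_norml => sM.
by apply/andP; split; [apply: aP|apply: bP]; rewrite in_itv.
Qed.

End locally_lipschitz.

Section stability.
Context {R : realType} {p : nat}.
Local Notation leb := (lebesgue_rV p).
Local Open Scope ereal_scope.

Variable T : set 'rV[R]_p.
Hypotheses (cT : compact T) (T_pos : 0 < leb T).

Let mT : measurable T.
Proof. by apply: closed_measurable_rV; exact: compact_closed. Qed.

Let Tfin : leb T < +oo. Proof. exact: lebesgue_rV_compact_fin. Qed.

Let TF : leb T \is a fin_num. Proof. by rewrite ge0_fin_numE. Qed.

Let N1 := fine (LnormT T 2%:E (cst 1%R)).

Let N1E : N1%:E = LnormT T 2%:E (cst 1%R). Proof. by rewrite fineK// LnormT1_fin. Qed.

Let N1_ge0 : (0 <= N1)%R. Proof. by rewrite fine_ge0// LnormT_ge0. Qed.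

Definition bounded_mean0 (M : R) (a : 'rV[R]_p -> R) :=
  bounded_on T M a /\ \int[leb]_(t in T) (a t)%:E = 0.

(** Only the first argument varies, the second standing for the data. The uniform bound by K yields
    finiteness of the potential. *)
Definition stable_on (q : ('rV[R]_p -> R) -> ('rV[R]_p -> R) -> \bar R) :=
  forall M : R, (0 <= M)%R -> exists2 K : R, (0 <= K)%R & forall a b c,
    bounded_mean0 M a -> bounded_mean0 M b -> bounded_mean0 M c ->
    q a c <= K%:E /\
    q a c <= q b c + K%:E * LnormT T 2%:E (fun t => a t - b t)%R.

Let L1_le (a : 'rV[R]_p -> R) : measurable_fun T a ->
  \int[leb]_(t in T) `|a t|%:E <= N1%:E * LnormT T 2%:E a.
Proof. by move=> ma; rewrite N1E; exact: L1_le_LnormT. Qed.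

(** u^2 - v^2 = (u + v)(u - v), where |u + v| <= 2N. *)
Lemma sqr_LnormT_stable N (u v : 'rV[R]_p -> R) : (0 <= N)%R -> bounded_on T N u -> bounded_on T N v ->
  LnormT T 2%:E u ^+ 2 <= LnormT T 2%:E v ^+ 2 +
    (2 * N)%:E * \int[leb]_(t in T) `|u t - v t|%:E.
Proof.
move=> N0 [mu uN] [mv vN]; rewrite !sqr_LnormT.
have muv : measurable_fun T (fun t => `|u t - v t|)%R.
  by apply: measurableT_comp => //; exact: measurable_funB.
rewrite -ge0_integralZl//; last 2 first.
- exact/measurable_EFinP.
- by rewrite lee_fin mulr_ge0.
rewrite -ge0_integralD//; last 4 first.
- by move=> t _; rewrite lee_fin sqr_ge0.
- by apply/measurable_EFinP; exact: measurable_funX.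
- by move=> t _; rewrite mule_ge0// lee_fin// mulr_ge0.
- by apply: measurable_funeM; exact/measurable_EFinP.
apply: ae_ge0_le_integral => //.
- by move=> t _; rewrite lee_fin sqr_ge0.
- by apply/measurable_EFinP; exact: measurable_funX.
- by move=> t _; rewrite adde_ge0 ?mule_ge0 ?lee_fin ?sqr_ge0 ?mulr_ge0.
- apply: emeasurable_funD; first by apply/measurable_EFinP; exact: measurable_funX.
  by apply: measurable_funeM; exact/measurable_EFinP.
apply: filterS2 uN vN => t + + Tt => /(_ Tt) uN /(_ Tt) vN.
rewrite -EFinM -EFinD lee_fin -lerBlDl subr_sqr mulrC.
apply: (@le_trans _ _ (`|u t + v t| * `|u t - v t|)%R).
  by rewrite -normrM ler_norm.
rewrite ler_wpM2r//; apply: (le_trans (ler_normD _ _)); lra.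
Qed.

Lemma sqr_LnormT_bound N (u : 'rV[R]_p -> R) : (0 <= N)%R -> bounded_on T N u ->
  LnormT T 2%:E u ^+ 2 <= ((N * N1) ^+ 2)%:E.
Proof.
move=> N0 uN; rewrite EFin_expe lee_sqr ?LnormT_ge0 ?lee_fin ?mulr_ge0//.
by rewrite EFinM N1E; exact: bounded_on_LnormT.
Qed.

Lemma stable_L2 :
  stable_on (fun a c => LnormT T 2%:E (fun t => a t - c t)%R ^+ 2).
Proof.
move=> M M0; have MM : (0 <= M + M)%R by rewrite addr_ge0.
(* Differences are bounded by 2M. [N1], the L^2 norm of 1, bounds the L^2 norm in terms of the
   supremum and the L^1 norm in terms of the L^2 norm. *)
exists (Num.max (((M + M) * N1) ^+ 2) (2 * (M + M) * N1))%R.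
  by rewrite le_max sqr_ge0.
move=> a b c [aM _] [bM _] [cM _].
have acM := bounded_onB aM cM; have bcM := bounded_onB bM cM; split.
  apply: le_trans (sqr_LnormT_bound MM acM) _.
  by rewrite lee_fin le_max lexx.
apply: le_trans (sqr_LnormT_stable MM acM bcM) _; rewrite leeD2l//.
under eq_integral.
  move=> t _; rewrite (_ : a t - c t - (b t - c t) = a t - b t)%R; last by ring.
  over.
have mab : measurable_fun T (fun t => a t - b t)%R.
  by apply: measurable_funB; [case: aM|case: bM].
apply: (@le_trans _ _ ((2 * (M + M))%:E * (N1%:E * LnormT T 2%:E (fun t => a t - b t)%R))).
  by rewrite lee_wpmul2l ?lee_fin ?mulr_ge0//; exact: L1_le.
rewrite muleA -EFinM lee_wpmul2r ?LnormT_ge0// lee_fin le_max lexx orbT//.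
Qed.

Lemma stable_Hm1 : poincare T ->
  stable_on (fun a c => Hm1norm T (fun t => a t - c t)%R ^+ 2).
Proof.
move=> /(Hm1norm_stable cT T_pos)[C C0 CP] M M0.
have MM : (0 <= M + M)%R by rewrite addr_ge0.
pose B := ((M + M) * N1)%R; have B0 : (0 <= B)%R by rewrite mulr_ge0.
(* If h1 <= h2 + C w with h2 <= C B and w <= B, then h1^2 <= h2^2 + 2 (C B) C w + C^2 B w: one
   factor w of the square is traded for its bound B. *)
exists (Num.max ((C * B) ^+ 2) (2 * (C * B) * C + C ^+ 2 * B))%R.
  by rewrite le_max sqr_ge0.
move=> a b c [aM a0] [bM b0] [cM c0].
have abM := bounded_onB aM bM.
have acM := bounded_onB aM cM; have bcM := bounded_onB bM cM.
have int0 u v : bounded_on T M u -> bounded_on T M v ->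
    \int[leb]_(t in T) (u t)%:E = 0 -> \int[leb]_(t in T) (v t)%:E = 0 ->
    \int[leb]_(t in T) (u t - v t)%:E = 0.
  move=> uM vM u0 v0; under eq_integral do rewrite EFinB.
  by rewrite (integralB mT (bounded_on_integrable mT Tfin uM)
    (bounded_on_integrable mT Tfin vM)) u0 v0 subee.
have B_ge u v : bounded_on T M u -> bounded_on T M v ->
    LnormT T 2%:E (fun t => u t - v t)%R <= B%:E.
  move=> uM vM; rewrite /B EFinM N1E; apply: (bounded_on_LnormT mT MM).
  exact: bounded_onB.
have [ac_le ac_bc] := CP _ _ (L2_bounded_on cT acM) (L2_bounded_on cT bcM)
  (int0 _ _ aM cM a0 c0) (int0 _ _ bM cM b0 c0).
have [bc_le _] := CP _ _ (L2_bounded_on cT bcM) (L2_bounded_on cT acM)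
  (int0 _ _ bM cM b0 c0) (int0 _ _ aM cM a0 c0).
have CB u v : bounded_on T M u -> bounded_on T M v ->
    C%:E * LnormT T 2%:E (fun t => u t - v t)%R <= (C * B)%:E.
  by move=> uM vM; rewrite EFinM lee_wpmul2l ?lee_fin//; exact: B_ge.
have {}ac_le := le_trans ac_le (CB _ _ aM cM).
have {}bc_le := le_trans bc_le (CB _ _ bM cM).
split.
  apply: (@le_trans _ _ ((C * B) ^+ 2)%:E); last by rewrite lee_fin le_max lexx.
  by rewrite EFin_expe lee_sqr ?Hm1norm_ge0 ?lee_fin ?mulr_ge0.
move: ac_bc; rewrite (_ : LnormT T 2%:E (fun t => a t - c t - (b t - c t))%R =
    LnormT T 2%:E (fun t => a t - b t)%R); last first.
  by congr (LnormT _ _ _); apply/funext => t; ring.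
move: (B_ge _ _ aM bM) (Hm1norm_ge0 cT (fun t => a t - c t)%R) ac_le
  (Hm1norm_ge0 cT (fun t => b t - c t)%R) bc_le (LnormT_ge0 T 2%:E (fun t => a t - b t)%R).
case: (LnormT T _ _) => [w| |]//; rewrite !lee_fin => wB.
case: (Hm1norm T _) => [h1| |]//; rewrite !lee_fin => h10 h1B.
case: (Hm1norm T _) => [h2| |]//; rewrite !lee_fin => h20 h2B w0.
move=> h12; rewrite -!expr2.
apply: (@le_trans _ _ (h2 ^+ 2 + (2 * (C * B) * C + C ^+ 2 * B) * w))%R; last first.
  by rewrite lerD2l ler_wpM2r// le_max lexx orbT.
apply: (@le_trans _ _ ((h2 + C * w) ^+ 2))%R.
  by rewrite lerXn2r ?nnegrE// addr_ge0// mulr_ge0.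
rewrite sqrrD -addrA lerD2l mulrDl lerD//.
  rewrite -mulr_natl mulrA [leRHS](_ : _ = 2 * (C * B) * (C * w))%R; last by ring.
  by rewrite ler_wpM2r ?mulr_ge0// ler_wpM2l.
rewrite exprMn expr2 [(w ^+ 2)%R]expr2 -[leRHS]mulrA ler_wpM2l ?mulr_ge0// ler_wpM2r//.
Qed.

End stability.

(** * Densities generated by sigma *)

Section sigma_stability.
Context {R : realType} {p : nat}.
Local Notation leb := (lebesgue_rV p).
Local Open Scope ereal_scope.

Variable T : set 'rV[R]_p.
Hypotheses (cT : compact T) (T_pos : 0 < leb T).
Variable sigma : R -> R.
Hypothesis sigma_pos : forall r, (0 < sigma r)%R.
Hypothesis sigma_lip : forall r : R,
  exists2 U : set R, nbhs r U & [lipschitz sigma s | s in U].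

Let mT : measurable T.
Proof. by apply: closed_measurable_rV; exact: compact_closed. Qed.

Let Tfin : leb T < +oo. Proof. exact: lebesgue_rV_compact_fin. Qed.

Let TF : leb T \is a fin_num. Proof. by rewrite ge0_fin_numE. Qed.

Let tau := fine (leb T).

Let tau_gt0 : (0 < tau)%R. Proof. by rewrite fine_gt0// T_pos. Qed.

Definition sigma_density (a : 'rV[R]_p -> R) (t : 'rV[R]_p) : R :=
  (sigma (a t) / \int[leb]_(s in T) sigma (a s))%R.

Let msigma (a : 'rV[R]_p -> R) : measurable_fun T a ->
  measurable_fun T (sigma \o a).
Proof.
move=> ma; apply: measurableT_comp => //; apply: continuous_measurable_fun.
exact: locally_lipschitz_continuous.
Qed.

(** On [-M, M] sigma lies between two positive constants c and C and is Lipschitz, so the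
    normalizing integral lies between c tau and C tau and is itself Lipschitz for the L^1
    distance. *)
Lemma sigma_density_estimates (M : R) : (0 <= M)%R -> exists N c K : R,
  [/\ (0 <= N)%R, (0 < c)%R, (0 <= K)%R,
    (forall a, bounded_on T M a ->
      [/\ bounded_on T N (sigma_density a),
         {ae leb, forall t, T t -> c <= sigma_density a t}%R,
         (forall t, (0 < sigma_density a t)%R) &
         \int[leb]_(t in T) (sigma_density a t)%:E = 1]) &
    forall a b, bounded_on T M a -> bounded_on T M b ->
      \int[leb]_(t in T) `|sigma_density a t - sigma_density b t|%:E <=
      K%:E * \int[leb]_(t in T) `|a t - b t|%:E].
Proof.
move=> M0; have [c [C [c0 cC]]] := positive_bounds_itv sigma_lip sigma_pos M0.
have [L L0 LP] := locally_lipschitz_itv sigma_lip M.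
have C0 : (0 < C)%R.
  have /cC /andP[h1 h2] : (`|0 : R| <= M)%R by rewrite normr0.
  exact: lt_le_trans c0 (le_trans h1 h2).
have ct0 : (0 < c * tau)%R by rewrite mulr_gt0.
have Ct0 : (0 < C * tau)%R by rewrite mulr_gt0.
pose I (a : 'rV[R]_p -> R) : R := (\int[leb]_(s in T) sigma (a s))%R.
have bs a : bounded_on T M a -> bounded_on T C (sigma \o a).
  move=> [ma aM]; split; first exact: msigma.
  apply: filterS aM => t + Tt => /(_ Tt) /cC /andP[_ h] /=.
  by rewrite ger0_norm// ltW.
have is_ a : bounded_on T M a -> leb.-integrable T (EFin \o (sigma \o a)).
  by move=> /bs; exact: bounded_on_integrable.
have IE a : bounded_on T M a -> (I a)%:E = \int[leb]_(s in T) (sigma (a s))%:E.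
  by move=> aM; rewrite /I /Rintegral fineK//; apply: integrable_fin_num => //; exact: is_.
have tauE : tau%:E = leb T by rewrite fineK.
have I_ge a : bounded_on T M a -> (c * tau <= I a)%R.
  move=> aM; rewrite -lee_fin IE// EFinM tauE -integral_cst//.
  apply: ae_ge0_le_integral => //.
  - by move=> t _; rewrite lee_fin ltW.
  - by move=> t _; rewrite lee_fin ltW.
  - by apply/measurable_EFinP; apply: msigma; case: aM.
  by case: aM => _; apply: filterS => t + Tt => /(_ Tt) /cC /andP[h _]; rewrite lee_fin.
have I_le a : bounded_on T M a -> (I a <= C * tau)%R.
  move=> aM; rewrite -lee_fin IE// EFinM tauE -integral_cst//.
  apply: ae_ge0_le_integral => //.
  - by move=> t _; rewrite lee_fin ltW.
  - by apply/measurable_EFinP; apply: msigma; case: aM.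
  - by move=> t _; rewrite lee_fin ltW.
  by case: aM => _; apply: filterS => t + Tt => /(_ Tt) /cC /andP[_ h]; rewrite lee_fin.
have I_gt0 a : bounded_on T M a -> (0 < I a)%R.
  by move=> aM; apply: lt_le_trans (I_ge _ aM).
have sab a b : bounded_on T M a -> bounded_on T M b ->
    {ae leb, forall t, T t -> (`|sigma (a t) - sigma (b t)| <= L * `|a t - b t|)%R}.
  move=> [_ aM] [_ bM]; apply: filterS2 aM bM => t + + Tt => /(_ Tt) h1 /(_ Tt) h2.
  exact: LP.
have mab a b : bounded_on T M a -> bounded_on T M b ->
    measurable_fun T (fun t => `|a t - b t|)%R.
  move=> [ma _] [mb _]; apply: measurableT_comp => //; exact: measurable_funB.
pose J (a b : 'rV[R]_p -> R) : R := fine (\int[leb]_(t in T) `|a t - b t|%:E).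
have JE a b : bounded_on T M a -> bounded_on T M b ->
    (J a b)%:E = \int[leb]_(t in T) `|a t - b t|%:E.
  move=> aM bM; rewrite /J fineK//; apply: integrable_fin_num => //.
  have := integrable_abse (bounded_on_integrable mT Tfin (bounded_onB aM bM)).
  by [].
have J0 a b : (0 <= J a b)%R.
  by rewrite fine_ge0//; apply: integral_ge0 => t _; rewrite lee_fin.
have Iab a b : bounded_on T M a -> bounded_on T M b -> (`|I a - I b| <= L * J a b)%R.
  move=> aM bM.
  have iab : leb.-integrable T (EFin \o (fun t => sigma (a t) - sigma (b t))%R).
    exact: (bounded_on_integrable mT Tfin (bounded_onB (bs _ aM) (bs _ bM))).
  rewrite /I -RintegralB//; last 2 first.
  - exact: is_.
  - exact: is_.
  rewrite -lee_fin EFin_normr_Rintegral//.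
  apply: le_trans (le_abse_integral _ _ _) _ => //; first exact: measurable_int iab.
  rewrite EFinM JE// -ge0_integralZl ?lee_fin//; last first.
    by apply/measurable_EFinP; exact: mab.
  apply: ae_ge0_le_integral => //.
  - by apply: measurableT_comp => //; exact: measurable_int iab.
  - by move=> t _; rewrite mule_ge0 ?lee_fin.
  - by apply: measurable_funeM; apply/measurable_EFinP; exact: mab.
  by apply: filterS (sab _ _ aM bM) => t + Tt => /(_ Tt); rewrite -EFinM lee_fin.
have sd_gt0 a : bounded_on T M a -> forall t, (0 < sigma_density a t)%R.
  by move=> aM t; rewrite divr_gt0// I_gt0.
have msd a : bounded_on T M a -> measurable_fun T (sigma_density a).
  by move=> [ma _]; apply: measurable_funM => //; exact: msigma.
(* In the third constant, the first term comes from the variation of the numerator and the second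
   from that of the normalizing integral; its factor tau appears on integrating a constant over
   [T]. *)
exists (C / (c * tau))%R, (c / (C * tau))%R,
  (L / (c * tau) + C * L * tau / (c * tau) ^+ 2)%R; split.
- by rewrite divr_ge0// ltW.
- by rewrite divr_gt0.
- by rewrite addr_ge0// divr_ge0// ?sqr_ge0 ?(ltW ct0)// !mulr_ge0// ltW.
- move=> a aM; split.
  + split; first exact: msd.
    case: (aM) => _; apply: filterS => t + Tt => /(_ Tt) /cC /andP[_ h].
    rewrite gtr0_norm ?sd_gt0// ler_pM ?invr_ge0 ?(ltW (sigma_pos _)) ?(ltW (I_gt0 _ aM))//.
    by rewrite lef_pV2 ?posrE ?I_ge// I_gt0.
  + case: (aM) => _; apply: filterS => t + Tt => /(_ Tt) /cC /andP[h _].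
    rewrite ler_pM ?invr_ge0 ?(ltW c0) ?(ltW Ct0)//.
    by rewrite lef_pV2 ?posrE ?I_le// I_gt0.
  + exact: sd_gt0.
  + under eq_integral do rewrite /sigma_density mulrC EFinM.
    rewrite integralZl//; last exact: is_.
    by rewrite -IE// -EFinM mulVf// gt_eqF// I_gt0.
move=> a b aM bM.
have key : {ae leb, forall t, T t -> (`|sigma_density a t - sigma_density b t| <=
    L / (c * tau) * `|a t - b t| + C * L / (c * tau) ^+ 2 * J a b)%R}.
  case: (bM) => _ bM'; apply: filterS2 (sab _ _ aM bM) bM' => t + + Tt.
  move=> /(_ Tt) h /(_ Tt)/cC /andP[_ hC].
  have Ia0 := I_gt0 _ aM; have Ib0 := I_gt0 _ bM.
  have -> : (sigma_density a t - sigma_density b t =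
      (sigma (a t) - sigma (b t)) / I a + sigma (b t) * (I b - I a) / (I a * I b))%R.
    by rewrite /sigma_density -/(I a) -/(I b); field; rewrite !gt_eqF.
  apply: (le_trans (ler_normD _ _)); apply: lerD.
    rewrite normrM (gtr0_norm (_ : 0 < (I a)^-1))%R ?invr_gt0// mulrAC.
    by rewrite ler_pM ?invr_ge0 ?(ltW Ia0)// lef_pV2 ?posrE// I_ge.
  rewrite normrM normrM (gtr0_norm (sigma_pos _)) (gtr0_norm (_ : 0 < (I a * I b)^-1))%R; last first.
    by rewrite invr_gt0 mulr_gt0.
  rewrite distrC.
  apply: (@le_trans _ _ (C * (L * J a b) * ((c * tau) ^+ 2)^-1)%R); last first.
    by rewrite le_eqVlt; apply/orP; left; apply/eqP; ring.
  apply: ler_pM.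
  - by rewrite mulr_ge0// ltW.
  - by rewrite invr_ge0 mulr_ge0// ltW.
  - by apply: ler_pM => //; [exact: ltW|exact: Iab].
  - rewrite lef_pV2 ?posrE ?exprn_gt0 ?mulr_gt0// expr2.
    by apply: ler_pM; rewrite ?(ltW ct0)// I_ge.
apply: (@le_trans _ _ (\int[leb]_(t in T)
   ((L / (c * tau))%:E * `|a t - b t|%:E + (C * L / (c * tau) ^+ 2 * J a b)%:E))).
  apply: ae_ge0_le_integral => //.
  - apply/measurable_EFinP; apply: measurableT_comp => //.
    by apply: measurable_funB; exact: msd.
  - by move=> t _; rewrite -EFinM -EFinD lee_fin addr_ge0// mulr_ge0// divr_ge0// ?sqr_ge0 ?(ltW ct0)// mulr_ge0// ltW.
  - apply: emeasurable_funD => //; apply: measurable_funeM.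
    by apply/measurable_EFinP; exact: mab.
rewrite ge0_integralD//; last 3 first.
- by move=> t _; rewrite -EFinM lee_fin mulr_ge0// divr_ge0// ltW.
- by apply: measurable_funeM; apply/measurable_EFinP; exact: mab.
- move=> t _; rewrite lee_fin mulr_ge0// divr_ge0// ?sqr_ge0// mulr_ge0// ltW//.
rewrite ge0_integralZl ?lee_fin ?divr_ge0 ?(ltW ct0)//; last first.
  by apply/measurable_EFinP; exact: mab.
have cstE (k : R) : \int[leb]_(t in T) k%:E = (k * tau)%:E.
  by rewrite (integral_cst _ mT k%:E) EFinM tauE.
rewrite cstE -JE// -!EFinM -EFinD lee_fin.
rewrite le_eqVlt; apply/orP; left; apply/eqP; ring.
Qed.

End sigma_stability.

Section sigma_potentials.
Context {R : realType} {p : nat}.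
Local Notation leb := (lebesgue_rV p).
Local Open Scope ereal_scope.

Variable T : set 'rV[R]_p.
Hypotheses (cT : compact T) (T_pos : 0 < leb T).
Variable sigma : R -> R.
Hypothesis sigma_pos : forall r, (0 < sigma r)%R.
Hypothesis sigma_lip : forall r : R,
  exists2 U : set R, nbhs r U & [lipschitz sigma s | s in U].

Let mT : measurable T.
Proof. by apply: closed_measurable_rV; exact: compact_closed. Qed.

Let Tfin : leb T < +oo. Proof. exact: lebesgue_rV_compact_fin. Qed.

Local Notation sd := (sigma_density T sigma).

Let L1_stable M K : (0 <= K)%R -> exists2 K' : R, (0 <= K')%R &
  forall a b : 'rV[R]_p -> R, bounded_on T M a -> bounded_on T M b ->
  K%:E * \int[leb]_(t in T) `|a t - b t|%:E <=
  K'%:E * LnormT T 2%:E (fun t => a t - b t)%R.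
Proof.
move=> K0; exists (K * fine (LnormT T 2%:E (cst 1%R)))%R.
  by rewrite mulr_ge0// fine_ge0// LnormT_ge0.
move=> a b [ma _] [mb _]; rewrite EFinM fineK ?LnormT1_fin// -muleA.
rewrite lee_wpmul2l ?lee_fin//; apply: L1_le_LnormT => //.
exact: measurable_funB.
Qed.

Lemma stable_M : stable_on T (fun a c =>
  LnormT T 2%:E (fun t => (sd a t - sd c t) / sd c t)%R ^+ 2).
Proof.
move=> M M0; have [N [c [K [N0 c0 K0 sdP sdK]]]] :=
  sigma_density_estimates cT T_pos sigma_pos sigma_lip M0.
(* Two densities differ by at most 2N, and the dividing density is at least c. *)
pose N2 := ((N + N) / c)%R; have N20 : (0 <= N2)%R by rewrite divr_ge0 ?addr_ge0// ltW.
have [|K1 K10 K1P] := @L1_stable M (2 * N2 * (c^-1 * K))%R.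
  have ci0 : (0 <= c^-1)%R by rewrite invr_ge0 ltW.
  exact: mulr_ge0 (mulr_ge0 _ N20) (mulr_ge0 ci0 K0).
pose N1 := fine (LnormT T 2%:E (cst 1%R)).
exists (Num.max ((N2 * N1) ^+ 2) K1)%R; first by rewrite le_max sqr_ge0.
move=> a b d [aM _] [bM _] [dM _].
have [aN _ _ _] := sdP a aM; have [bN _ _ _] := sdP b bM.
have [dN dc d0 _] := sdP d dM.
(* The inverse is written as the power -1, which agrees with it because the density is positive. *)
have md : measurable_fun T (fun t => (sd d t)^-1)%R.
  have [md _] := dN.
  apply: (eq_measurable_fun ((@powR R ^~ (-1)%R) \o sd d)).
    by move=> t _ /=; rewrite powR_inv1// ltW.
  exact: (measurableT_comp (measurable_powR _) md).
have uN2 u : bounded_on T N u -> bounded_on T N2 (fun t => (u t - sd d t) / sd d t)%R.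
  move=> uN; have [mu udN] := bounded_onB uN dN; split.
    exact: measurable_funM.
  apply: filterS2 udN dc => t + + Tt => /(_ Tt) h /(_ Tt) dct.
  rewrite normrM normfV (gtr0_norm (d0 t)); apply: ler_pM => //.
    by rewrite invr_ge0 ltW.
  by rewrite lef_pV2 ?posrE.
have aN2 := uN2 _ aN; have bN2 := uN2 _ bN; split.
  apply: le_trans (sqr_LnormT_bound cT N20 aN2) _.
  by rewrite lee_fin le_max lexx.
apply: le_trans (sqr_LnormT_stable cT N20 aN2 bN2) _; rewrite leeD2l//.
apply: (@le_trans _ _ (K1%:E * LnormT T 2%:E (fun t => a t - b t)%R)); last first.
  by rewrite lee_wpmul2r ?LnormT_ge0// lee_fin le_max lexx orbT.
apply: le_trans (K1P _ _ aM bM).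
rewrite [in leRHS]EFinM -muleA lee_wpmul2l ?lee_fin ?(mulr_ge0 _ N20)//.
rewrite [in leRHS]EFinM -muleA; apply: (@le_trans _ _ ((c^-1)%:E * \int[leb]_(t in T) `|sd a t - sd b t|%:E)); last first.
  by rewrite lee_wpmul2l ?lee_fin ?invr_ge0 ?(ltW c0)//; exact: sdK.
have [ma _] := aN; have [mb _] := bN.
have mab : measurable_fun T (fun t => `|sd a t - sd b t|)%R.
  by apply: measurableT_comp => //; exact: measurable_funB.
rewrite -ge0_integralZl ?lee_fin ?invr_ge0 ?(ltW c0)//; last exact/measurable_EFinP.
have muv : measurable_fun T (fun t => `|(sd a t - sd d t) / sd d t - (sd b t - sd d t) / sd d t|)%R.
  by apply: measurableT_comp => //; apply: measurable_funB; [case: aN2|case: bN2].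
apply: ae_ge0_le_integral => //.
- exact/measurable_EFinP.
- by move=> t _; rewrite mule_ge0// lee_fin// invr_ge0 ltW.
- by apply: measurable_funeM; exact/measurable_EFinP.
apply: filterS dc => t + Tt => /(_ Tt) dct.
have -> : ((sd a t - sd d t) / sd d t - (sd b t - sd d t) / sd d t = (sd d t)^-1 * (sd a t - sd b t))%R.
  by field; rewrite gt_eqF.
rewrite -EFinM lee_fin normrM normfV (gtr0_norm (d0 t)) ler_wpM2r// lef_pV2 ?posrE//.
Qed.

Hypothesis p_gt0 : (0 < p)%N.

Let diamT : exists2 Dm : R, (0 <= Dm)%R &
  forall s t, T s -> T t -> (enorm (s - t) <= Dm)%R.
Proof.
have [M M0 TM] := compact_rV_box cT; exists (p%:R * (M + M))%R.
  by rewrite mulr_ge0// addr_ge0// ltW.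
move=> s t Ts Tt; apply: le_trans (enorm_le_sum _) _.
apply: (@le_trans _ _ (\sum_(i < p) (M + M)))%R.
  apply: ler_sum => i _; rewrite !mxE; apply: le_trans (ler_normB _ _) _.
  by apply: lerD; exact: TM.
by rewrite sumr_const card_ord mulr_natl.
Qed.

Lemma stable_W2 : stable_on T (fun a c => W2 T (sd a) (sd c) ^+ 2).
Proof.
move=> M M0; have [N [c [K [N0 c0 K0 sdP sdK]]]] :=
  sigma_density_estimates cT T_pos sigma_pos sigma_lip M0.
have [Dm Dm0 TD] := diamT.
have T0 : T !=set0.
  apply/set0P/negP => /eqP T0; by move: T_pos; rewrite T0 measure0 ltxx.
(* The factor 2 Dm^2 comes from [transport_cost_lip], and K from the passage from densities back to
   a and b. *)
have [|K1 K10 K1P] := @L1_stable M (2 * Dm ^+ 2 * K)%R.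
  by rewrite !mulr_ge0// sqr_ge0.
exists (Num.max (Dm ^+ 2) K1)%R; first by rewrite le_max sqr_ge0.
move=> a b d [aM _] [bM _] [dM _].
have [[ma _] _ a0 a1] := sdP a aM; have [[mb _] _ b0 b1] := sdP b bM.
have [[md _] _ d0 d1] := sdP d dM.
have sd0 u : (forall t, (0 < sd u t)%R) -> forall t, T t -> (0 <= sd u t)%R.
  by move=> u0 t _; exact: ltW.
have Wad : W2 T (sd a) (sd d) ^+ 2 <= transport_cost T (sd a) (sd d).
  by rewrite (sqr_W2 (sd d) (sd0 _ a0)).
have Wbd : transport_cost T (sd b) (sd d) <= W2 T (sd b) (sd d) ^+ 2.
  by rewrite -(sqr_W2 (sd d) (sd0 _ b0)).
split.
  apply: le_trans Wad (le_trans (transport_cost_le p_gt0 mT T0 Dm0 TD ma md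
    (sd0 _ a0) (sd0 _ d0) _ _) _).
  - by rewrite a1 ltry.
  - by rewrite a1 d1.
  - by rewrite a1 mule1 lee_fin le_max lexx.
apply: le_trans Wad (le_trans (transport_cost_lip p_gt0 mT T0 Dm0 TD ma mb
  (sd0 _ a0) (sd0 _ b0) _ _ (sd d)) _).
- by rewrite a1 ltry.
- by rewrite a1 b1.
apply: leeD => //.
apply: (@le_trans _ _ (K1%:E * LnormT T 2%:E (fun t => a t - b t)%R)); last first.
  by rewrite lee_wpmul2r ?LnormT_ge0// lee_fin le_max lexx orbT.
apply: le_trans (K1P _ _ aM bM).
rewrite [in leRHS]EFinM -muleA lee_wpmul2l ?lee_fin ?mulr_ge0 ?sqr_ge0//.
exact: sdK.
Qed.

End sigma_potentials.

(** * Radon measures and posteriors *)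

Section exhaustion.
Local Open Scope ereal_scope.

Lemma nondecreasing_exhaustion d (T : measurableType d) (R : realType)
  (mu : {finite_measure set T -> \bar R}) (F : (set T)^nat) (A : set T) (e : R) :
  (forall n, measurable (F n)) -> measurable A -> nondecreasing_seq F ->
  A = \bigcup_n F n -> (0 < e)%R -> exists n, mu (A `\` F n) <= e%:E.
Proof.
move=> mF mA ndF AE e0.
have ni : nonincreasing_seq (fun n => A `\` F n).
  by move=> m n mn; apply/subsetPset; apply: setDS; exact/subsetPset/ndF.
have : mu \o (fun n => A `\` F n) @ \oo --> mu (\bigcap_n (A `\` F n)).
  apply: nonincreasing_cvg_mu => //.
  - by rewrite -ge0_fin_numE// fin_num_measure//; exact: measurableD.
  - by move=> i; exact: measurableD.
  - by apply: bigcap_measurable => // i _; exact: measurableD.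
rewrite (_ : \bigcap_n _ = set0); last first.
  rewrite AE -subset0 => x Fx; have [[n _ Fnx] _] := Fx 0%N I.
  by have [_] := Fx n I.
rewrite measure0 => /fine_cvgP[fn /cvgrPdist_le /(_ _ e0)].
move=> he; near \oo => n; exists n.
rewrite -[leLHS]fineK; last by near: n.
rewrite lee_fin -[leLHS]ger0_norm ?fine_ge0//.
by rewrite -[X in normr X]opprK normrN -[X in normr X]add0r; near: n.
Unshelve. all: by end_near. Qed.

End exhaustion.

Section radon_of_polish.
Context {R : realType} (X : completeNormedModType R).
Local Open Scope ereal_scope.

Lemma open_borel (U : set X) : open U -> measurable (U : set (borelType X)).
Proof. exact: sub_sigma_algebra. Qed.

Lemma closed_borel (F : set X) : closed F -> measurable (F : set (borelType X)).
Proof.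
by move=> cF; rewrite -[F]setCK; apply: measurableC; apply: open_borel;
  exact: closed_openC.
Qed.

Variable mu : {finite_measure set (borelType X) -> \bar R}.

Let mu_fin (A : set (borelType X)) : measurable A -> mu A \is a fin_num.
Proof. by move=> mA; exact: fin_num_measure. Qed.

(** [F n] collects the points at distance at least 1/(n+1) from the complement of U. *)
Lemma open_bigcup_closed (U : set X) : open U ->
  exists F : (set X)^nat, [/\ forall n, closed (F n), nondecreasing_seq F &
    U = \bigcup_n F n].
Proof.
move=> oU; exists (fun n => \bigcap_(y in ~` U) [set x | n.+1%:R^-1 <= `|x - y|]%R).
split.
- move=> n; apply: closed_bigI => y _.
  rewrite (_ : [set x | _] = (fun x => `|x - y|%R) @^-1` [set r | n.+1%:R^-1 <= r]%R)//.
  apply: preimage_closed; last exact: closed_ge.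
  move=> x _; apply: cvg_norm; apply: cvgB; [exact: cvg_id|exact: cvg_cst].
- move=> m n mn; apply/subsetPset => x Fx y Uy; apply: le_trans (Fx y Uy) => /=.
  by rewrite lef_pV2 ?posrE// ler_nat.
apply/seteqP; split => [x Ux|x [n _ Fx]]; last first.
  by apply: contrapT => Uy; have /= := Fx x Uy; rewrite subrr normr0 leNgt invr_gt0 ltr0n.
have /nbhs_ballP[e /= e0 eU] : nbhs x U by exact: open_nbhs_nbhs.
have [k _ /(_ k (leqnn k))/= ke] := near_infty_natSinv_lt (PosNum e0).
exists k => // y Uy /=; rewrite leNgt; apply/negP => xy; apply: Uy; apply: eU.
by rewrite -ball_normE /ball_/=; exact: lt_trans ke.
Qed.

(** Inner and outer approximation are stated through a single gap, a condition symmetric under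
    complement. *)
Let regular (A : set (borelType X)) := measurable A /\
  forall e : R, (0 < e)%R -> exists F U : set X,
    [/\ closed F, open U, F `<=` A, A `<=` U &
        mu ((U : set (borelType X)) `\` F) <= e%:E].

(** A countable union of closed sets need not be closed: half of e is shared out among the gaps of
    the A n, the other half pays for keeping only finitely many of the closed sets. *)
Let regular_bigcup (A : (set (borelType X))^nat) :
  (forall n, regular (A n)) -> regular (\bigcup_n A n).
Proof.
move=> rA; split; first by apply: bigcupT_measurable => n; have [] := rA n.
move=> e e0; have e20 : (0 < e / 2)%R by rewrite divr_gt0.
have /choice[FU FUP] : forall n, exists FU : set X * set X,
    [/\ closed FU.1, open FU.2, FU.1 `<=` A n, A n `<=` FU.2 &
        mu ((FU.2 : set (borelType X)) `\` FU.1) <= (e / 2 / (2 ^ n.+1)%:R)%:E].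
  move=> n; have [_ /(_ (e / 2 / (2 ^ n.+1)%:R)%R)] := rA n.
  case; first by rewrite divr_gt0// ltr0n expn_gt0.
  by move=> F [U ?]; exists (F, U).
have cF n : closed (FU n).1 by have [] := FUP n.
have oU n : open (FU n).2 by have [] := FUP n.
have mF n := closed_borel (cF n).
have mU n := open_borel (oU n).
pose G n : set X := \big[setU/set0]_(k < n.+1) (FU k).1.
have cG n : closed (G n) by rewrite /G; apply: closed_bigsetU.
have [N NP] : exists N, mu ((\bigcup_n (FU n).1 : set (borelType X)) `\` G N) <= (e / 2)%:E.
  apply: nondecreasing_exhaustion => //.
  - by move=> n; exact: closed_borel.
  - exact: bigcupT_measurable.
  - move=> m n mn; apply/subsetPset.
    exact: (@subset_bigsetU _ (fun k => (FU k).1)) m.+1 n.+1 mn.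
  - exact/esym/(@bigcup_bigsetU_bigcup _ (fun k => (FU k).1)).
exists (G N), (\bigcup_n (FU n).2); split => //.
- exact: bigcup_open.
- have -> : G N = \bigcup_(k in `I_N.+1) (FU k).1 by rewrite bigcup_mkord.
  move=> x [n _ Fx]; exists n => //.
  by have [_ _ FA _ _] := FUP n; exact: FA.
- by apply: subset_bigcup => n _; have [] := FUP n.
apply: (@le_trans _ _ (mu ((\bigcup_n ((FU n).2 `\` (FU n).1) : set (borelType X)) `|`
   ((\bigcup_n (FU n).1 : set (borelType X)) `\` G N)))).
  apply: le_measure; rewrite ?inE.
  - apply: measurableD; first exact: bigcupT_measurable.
    exact: closed_borel.
  - apply: measurableU.
      by apply: bigcupT_measurable => n; exact: measurableD.
    by apply: measurableD; [exact: bigcupT_measurable|exact: closed_borel].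
  move=> x [[n _ Ux] Gx]; have [Fx|Fx] := pselect ((FU n).1 x).
    by right; split => //; exists n.
  by left; exists n.
apply: (le_trans (measureU2 _ _ _)).
- by apply: bigcupT_measurable => n; exact: measurableD.
- by apply: measurableD; [exact: bigcupT_measurable|exact: closed_borel].
rewrite [e]splitr EFinD; apply: leeD => //.
apply: (le_trans (generalized_Boole_inequality _ _ _)).
- by move=> n; exact: measurableD.
- by apply: bigcupT_measurable => n; exact: measurableD.
apply: (le_trans _ (epsilon_trick0 xpredT (ltW e20))).
by apply: lee_nneseries => // n _; have [] := FUP n.
Qed.

Lemma borel_regular (A : set (borelType X)) : measurable A ->
  forall e : R, (0 < e)%R -> exists F U : set X,
    [/\ closed F, open U, F `<=` A, A `<=` U &
        mu ((U : set (borelType X)) `\` F) <= e%:E].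
Proof.
move=> mA; suff [] : regular A by [].
move: A mA; apply: smallest_sub => [|U oU].
  split.
  - split => // e e0; exists set0, set0; split => //.
    + exact: closed0.
    + exact: open0.
    + by rewrite setD0 measure0 lee_fin ltW.
  - move=> A [mA rA]; rewrite setTD; split; first exact: measurableC.
    move=> e /rA[F [U [cF oU FA AU FUe]]]; exists (~` U), (~` F); split.
    + exact: open_closedC.
    + exact: closed_openC.
    + exact: subsetC.
    + exact: subsetC.
    + by rewrite setDE setCK setIC -setDE.
  - by move=> A; exact: regular_bigcup.
split; first exact: open_borel.
move=> e e0; have [F [cF ndF UF]] := open_bigcup_closed oU.
have [n nP] : exists n, mu ((U : set (borelType X)) `\` F n) <= e%:E.
  apply: nondecreasing_exhaustion => //; last exact: open_borel.
  by move=> n; exact: closed_borel.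
exists (F n), U; split => // x Fx; rewrite UF; by exists n.
Qed.

(** An ultrafilter containing K contains one of the finitely many balls for every radius. It is thus
    Cauchy, converges by completeness, and its limit is in the closed set K. *)
Lemma closed_totally_bounded_compact (K : set X) : closed K ->
  (forall e : R, (0 < e)%R -> exists (s : nat -> X) N,
     K `<=` \bigcup_(k in `I_N) closed_ball (s k) e) -> compact K.
Proof.
move=> cK tK; rewrite compact_ultra => F UF FK.
have PF : ProperFilter F by exact: ultra_proper.
have FB (e : R) (s : nat -> X) N :
    F (\bigcup_(k in `I_N) closed_ball (s k) e) ->
    exists k, F (closed_ball (s k) e).
  elim: N => [|N IH].
    by rewrite II0 bigcup_set0 => F0; exfalso; exact: filter_not_empty F0.
  have -> : \bigcup_(k in `I_N.+1) closed_ball (s k) e =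
      \bigcup_(k in `I_N) closed_ball (s k) e `|` closed_ball (s N) e.
    by rewrite !bigcup_mkord big_ord_recr.
  move=> FU.
  have [FN|FN] := in_ultra_setVsetC (closed_ball (s N) e) UF; first by exists N.
  apply: IH; apply: filterS (filterI FU FN) => x [[//|]].
  by move=> ? /=.
have cF : cauchy F.
  apply: cauchy_exP => e e0; have e20 : (0 < e / 2)%R by rewrite divr_gt0.
  have [s [N KN]] := tK _ e20.
  have [k Fk] := FB _ _ _ (filterS KN FK).
  exists (s k); apply: filterS Fk; apply: closed_ball_subset => //.
  by rewrite ltr_pdivrMr// mulr_natr mulr2n ltrDl.
have Fl : F --> lim F by exact: cauchy_cvg.
exists (lim F); split => //.
exact: (@closed_cvg _ X F _ id K cK FK _ Fl).
Qed.

(* Ulam's theorem. *)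
Lemma finite_measure_tight : (exists2 S : set X, countable S & dense S) ->
  forall e : R, (0 < e)%R ->
    exists2 K : set X, compact K & mu (~` K : set (borelType X)) <= e%:E.
Proof.
move=> [S + dS] e e0.
have S0 : S !=set0.
  have [|x [_ Sx]] := dS setT _ openT; [by exists point|by exists x].
move=> /pfcard_geP[S0'|[s]]; first by move: S0; rewrite S0' => -[].
have sS n : \bigcup_k closed_ball (s k) n.+1%:R^-1 = [set: X].
  apply/seteqP; split => // x _.
  have n0 : (0 < n.+1%:R^-1 :> R)%R by rewrite invr_gt0.
  have [||y [xy Sy]] := dS (ball x n.+1%:R^-1).
  - by exists x; exact: ballxx.
  - exact: ball_open.
  have [k _ ky] := @surj _ _ _ _ s y Sy; exists k => //.
  by apply: subset_closed_ball; rewrite ky; exact: ball_sym.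
(* Finite unions of balls of radius 1/(n+1) around a dense sequence. For each n one of them misses
   mass at most e / 2^(n+1); the intersection of these over n is closed and totally bounded. *)
pose G n N : set X := \big[setU/set0]_(k < N.+1) closed_ball (s k) n.+1%:R^-1.
have GE n N : G n N = \bigcup_(k in `I_N.+1) closed_ball (s k) n.+1%:R^-1.
  by rewrite bigcup_mkord.
have cG n N : closed (G n N).
  rewrite /G; elim: N.+1 => [|k IH]; first by rewrite big_ord0; exact: closed0.
  by rewrite big_ord_recr/=; apply: closedU => //; exact: closed_ball_closed.
have /choice[N NP] : forall n, exists N,
    mu (setT `\` (G n N : set (borelType X))) <= (e / (2 ^ n.+1)%:R)%:E.
  move=> n; apply: nondecreasing_exhaustion => //.
  - by move=> k; exact: closed_borel.
  - move=> k l kl; apply/subsetPset.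
    exact: (@subset_bigsetU _ (fun i => closed_ball (s i) _)) k.+1 l.+1 kl.
  - by rewrite -(sS n) -(@bigcup_bigsetU_bigcup _ (fun i => closed_ball (s i) _)).
  - by rewrite divr_gt0// ltr0n expn_gt0.
exists (\bigcap_n G n (N n)).
  apply: closed_totally_bounded_compact.
    by apply: closed_bigI => n _; exact: cG.
  move=> r r0.
  have [n _ /(_ n (leqnn n))/= ne] := near_infty_natSinv_lt (PosNum r0).
  exists s, (N n).+1 => x /(_ n I); rewrite GE => -[k kN xk]; exists k => //.
  by move: x xk; apply: le_closed_ball; rewrite ltW.
apply: (@le_trans _ _ (mu (\bigcup_n (setT `\` (G n (N n) : set (borelType X)))))).
  apply: le_measure; rewrite ?inE.
  - apply: measurableC; apply: closed_borel.
    by apply: closed_bigI => n _; exact: cG.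
  - apply: bigcupT_measurable => n; apply: measurableD => //.
    exact: closed_borel.
  - by rewrite setC_bigcap => x [n _ nx]; exists n.
have mG n : measurable (setT `\` (G n (N n) : set (borelType X))).
  by apply: measurableD => //; exact: closed_borel.
apply: (le_trans (generalized_Boole_inequality _ _ _)) => //.
  exact: bigcupT_measurable.
apply: (le_trans _ (epsilon_trick0 xpredT (ltW e0))).
by apply: lee_nneseries => // n _; exact: NP.
Qed.

(** The compact set is the intersection of a closed inner approximation with a compact set of nearly
    full mass; each costs e / 2. *)
Lemma polish_radon : (exists2 S : set X, countable S & dense S) -> radon mu.
Proof.
move=> hX; split.
  move=> u; exists setT; first by split; [exact: openT|].
  by rewrite -ge0_fin_numE// mu_fin.
move=> A mA; apply/eqP; rewrite eq_le; apply/andP; split; last first.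
  apply: ge_ereal_sup => _ [K [cK KA] <-]; apply: le_measure; rewrite ?inE//.
  by apply: closed_borel; apply: compact_closed => //; exact: norm_hausdorff.
apply/lee_addgt0Pr => e e0; have e20 : (0 < e / 2)%R by rewrite divr_gt0.
have [F [U [cF oU FA AU FUe]]] := borel_regular mA e20.
have [K cK Ke] := finite_measure_tight hX e20.
have KK : closed K by apply: compact_closed => //; exact: norm_hausdorff.
have cKF : compact (K `&` F) by exact: compact_closedI.
have mF := closed_borel cF; have mK := closed_borel KK.
have mU := open_borel oU.
have mKF : measurable (K `&` F : set (borelType X)) by exact: measurableI.
apply: (@le_trans _ _ (mu ((K `&` F : set (borelType X)) `|`
    ((U : set (borelType X)) `\` F `|` ~` K)))).
  apply: le_measure; rewrite ?inE//.
    apply: measurableU => //; apply: measurableU; first exact: measurableD.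
    exact: measurableC.
  move=> x Ax; have [Kx|Kx] := pselect (K x); last by right; right.
  have [Fx|Fx] := pselect (F x); first by left.
  by right; left; split => //; exact: AU.
apply: (le_trans (measureU2 _ _ _)) => //.
  by apply: measurableU; [exact: measurableD|exact: measurableC].
apply: leeD.
  by apply: ereal_sup_ubound; exists (K `&` F) => //; split => // x [_ /FA].
rewrite [e]splitr EFinD; apply: (le_trans (measureU2 _ _ _)).
- exact: measurableD.
- exact: measurableC.
- exact: leeD.
Qed.

End radon_of_polish.

(** * From functionals on T to potentials on D *)

Section potentials_lipschitz.
Context {R : realType} {d : measure_display} {D : measurableType d} {p : nat}.
Variable lam : {finite_measure set D -> \bar R}.
Local Notation leb := (lebesgue_rV p).
Local Open Scope ereal_scope.

Variable T : set 'rV[R]_p.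
Hypotheses (cT : compact T) (T_pos : 0 < leb T).

Let mT : measurable T.
Proof. by apply: closed_measurable_rV; exact: compact_closed. Qed.

Let mDT : measurable ([set: D] `*` T). Proof. exact: measurableX. Qed.

Lemma Y0_section (a : D -> 'rV[R]_p -> R) x : Y0 lam T a -> measurable_fun T (a x).
Proof.
move=> [ma _ _ _].
apply: (@measurable_comp _ _ _ _ _ _ ([set: D] `*` T) (fun z => a z.1 z.2) T (pair x)) => //.
  by move=> _ [t Tt <-].
by apply: measurable_funTS; exact: pair1_measurable.
Qed.

(** The norm with exponent +oo unfolds to an essential supremum only when the ambient measure is
    nonzero. *)
Let leb_setT_gt0 : 0 < leb [set: 'rV[R]_p].
Proof.
by apply: (@lt_le_trans _ _ (leb T)) => //; apply: le_measure; rewrite ?inE.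
Qed.

Lemma LnormTy_bounded_on M (f : 'rV[R]_p -> R) : measurable_fun T f ->
  LnormT T +oo f <= M%:E -> bounded_on T M f.
Proof.
move=> mf; rewrite /LnormT unlock /Lnorm leb_setT_gt0 => /ess_supP fM; split => //.
by apply: filterS fM => t + Tt; rewrite /= patchE mem_set// lee_fin.
Qed.

Lemma Y0_bounded_mean0 (a : D -> 'rV[R]_p -> R) (M : R) : Y0 lam T a ->
  LnormDT lam T +oo a <= M%:E -> {ae lam, forall x, bounded_mean0 T M (a x)}.
Proof.
move=> Ya aM; have [_ _ _ a0] := Ya.
have leb0 := leb_setT_gt0.
(* If [lam] is zero the norm carries no information, but then every property holds almost
   everywhere. *)
have [lam0|lam0] := eqVneq (lam setT) 0.
  by exists setT; split.
have : \forall x \ae lam, `|LnormT T +oo (a x)| <= M%:E.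
  apply/ess_supP; move: aM; rewrite /LnormDT unlock /Lnorm lt0e lam0/= measure_ge0.
  by [].
apply: filterS => x axM; split; last exact: a0.
apply: LnormTy_bounded_on; first exact: Y0_section.
by apply: le_trans axM; exact: lee_abs.
Qed.

Let w (a b : D -> 'rV[R]_p -> R) x := LnormT T 2%:E (fun t => a x t - b x t)%R.

Lemma LnormTE (f : 'rV[R]_p -> R) :
  LnormT T 2%:E f = (\int[leb]_(t in T) (f t ^+ 2)%:E) `^ 2^-1.
Proof.
rewrite -sqr_LnormT -poweR2 ?LnormT_ge0// -poweRrM divff ?pnatr_eq0//.
by rewrite poweRe1 ?LnormT_ge0.
Qed.

(** Tonelli, from joint measurability on D x T. This is the measurable error term that
    [le_lower_integralD] needs. *)
Lemma measurable_LnormT_diff a b : Y0 lam T a -> Y0 lam T b ->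
  measurable_fun setT (w a b).
Proof.
move=> [ma _ _ _] [mb _ _ _].
pose F (z : D * 'rV[R]_p) := (((fun z => (a z.1 z.2 - b z.1 z.2) ^+ 2)%R \_ ([set: D] `*` T)) z)%:E.
have mF : measurable_fun setT F.
  apply/measurable_EFinP; apply/(measurable_restrictT _ _).1 => //.
  by apply: measurable_funX; exact: measurable_funB.
have F0 z : 0 <= F z.
  by rewrite /F patchE lee_fin; case: ifPn => // _; exact: sqr_ge0.
have := @measurable_fun_fubini_tonelli_F _ _ _ _ R leb F mF F0.
move=> mI; have -> : w a b = (fun x => (\int[leb]_t F (x, t)) `^ 2^-1).
  apply/funext => x; rewrite /w LnormTE; congr (_ `^ _).
  rewrite [LHS]integral_mkcond; apply: eq_integral => t _.
  rewrite /F !patchE; have [Tt|Tt] := pselect (T t).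
    by rewrite !mem_set.
  by rewrite !memNset// => -[].
exact: (measurableT_comp (measurable_poweR _) mI).
Qed.

Lemma integral_LnormT_diff_le a b : Y0 lam T a -> Y0 lam T b ->
  \int[lam]_x w a b x <=
    lam setT `^ 2^-1 * LnormDT lam T 2%:E (fun x t => a x t - b x t)%R.
Proof.
move=> Ya Yb; have mw := measurable_LnormT_diff Ya Yb.
(* Finite for every x, not just almost every x, since [Y0] bounds each section; [w] may thus be
   replaced by a real function. *)
have wF x : w a b x \is a fin_num.
  have bnd (c : D -> 'rV[R]_p -> R) : Y0 lam T c -> exists M, bounded_on T M (c x).
    move=> Yc; have [_ cfin _ _] := Yc; exists (fine (LnormT T +oo (c x))).
    apply: LnormTy_bounded_on; first exact: Y0_section.
    by rewrite fineK// ge0_fin_numE// LnormT_ge0.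
  have [[M aM] [N bN]] := (bnd _ Ya, bnd _ Yb).
  by have [_] := L2_bounded_on cT (bounded_onB aM bN); rewrite ge0_fin_numE// LnormT_ge0.
pose g x := fine (w a b x).
have gE x : (g x)%:E = w a b x by rewrite fineK.
have mg : measurable_fun setT g by exact: (measurableT_comp (fine_measurable measurableT) mw).
have h2 : (2^-1 + 2^-1 = 1 :> R)%R by lra.
have := @hoelder _ _ R lam (cst 1%R) g 2 2 (measurable_cst _) mg (ltr0n _ 2) (ltr0n _ 2) h2.
rewrite Lnorm1 (_ : 'N[lam]_2%:E[EFin \o cst 1%R] = lam setT `^ 2^-1); last first.
  by rewrite -Lnorm_cst1; apply: eq_Lnorm.
rewrite (_ : 'N[lam]_2%:E[EFin \o g] = LnormDT lam T 2%:E (fun x t => a x t - b x t)%R); last first.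
  by apply: eq_Lnorm => x; exact: gE.
apply: le_trans; apply: le_lower_integral => x; first exact: LnormT_ge0.
by rewrite /= mul1r -gE lee_fin ler_norm.
Qed.

Variable q : ('rV[R]_p -> R) -> ('rV[R]_p -> R) -> \bar R.
Hypotheses (q_ge0 : forall a c, 0 <= q a c) (q_stable : stable_on T q).

Definition potential (a y : D -> 'rV[R]_p -> R) : \bar R :=
  2^-1%:E * \int[lam]_x q (a x) (y x).

Lemma potential_ge0 a y : 0 <= potential a y.
Proof. by rewrite mule_ge0 ?lee_fin//; exact: integral_ge0. Qed.

(** Stability of [q] is integrated over the almost all x whose sections are bounded by M, by lower
    integrals as [q (a x) (y x)] may fail to be measurable. Hölder on D then turns the L^1(D) error
    into an L^2(D) one. *)
Lemma potential_stable M : (0 <= M)%R -> exists2 K : R, (0 <= K)%R &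
  forall a b y, Y0 lam T a -> Y0 lam T b -> Y0 lam T y ->
    LnormDT lam T +oo a <= M%:E -> LnormDT lam T +oo b <= M%:E ->
    LnormDT lam T +oo y <= M%:E ->
    potential a y <= K%:E /\
    potential a y <= potential b y +
      K%:E * LnormDT lam T 2%:E (fun x t => a x t - b x t)%R.
Proof.
move=> /q_stable[K0 K00 KP].
have lamF : lam setT \is a fin_num by exact: fin_num_measure.
have lam2F : lam setT `^ 2^-1 \is a fin_num by exact: fin_num_poweR.
(* The total mass of [lam] enters the uniform bound, its square root the Hölder step. *)
pose K := (2^-1 * K0 * Num.max (fine (lam setT)) (fine (lam setT `^ 2^-1)))%R.
exists K; first by rewrite !mulr_ge0// le_max fine_ge0.
move=> a b y Ya Yb Yy aM bM yM.
have aB := Y0_bounded_mean0 Ya aM; have bB := Y0_bounded_mean0 Yb bM.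
have yB := Y0_bounded_mean0 Yy yM; split.
  apply: (@le_trans _ _ (2^-1%:E * (K0%:E * lam setT))).
    rewrite lee_wpmul2l ?lee_fin// -integral_cst//.
    apply: ae_le_lower_integral => //.
    apply: filterS2 aB yB => x ax yx; exact: (KP _ (a x) _ ax ax yx).1.
  rewrite muleA -EFinM -(fineK lamF) -EFinM lee_fin ler_wpM2l ?mulr_ge0//.
  by rewrite le_max lexx.
have mw := measurable_LnormT_diff Ya Yb.
rewrite /potential; apply: (@le_trans _ _ (2^-1%:E * (\int[lam]_x q (b x) (y x) +
    \int[lam]_x (K0%:E * w a b x)))).
  rewrite lee_wpmul2l ?lee_fin//; apply: le_lower_integralD => //.
  - by move=> x; rewrite mule_ge0 ?lee_fin ?LnormT_ge0.
  - exact: measurable_funeM.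
  have abB : {ae lam, forall x, bounded_mean0 T M (a x) /\ bounded_mean0 T M (b x)}.
    by apply: filterS2 aB bB.
  by apply: filterS2 abB yB => x [ax bx] yx; exact: (KP _ _ _ ax bx yx).2.
rewrite ge0_muleDr ?integral_ge0//; last first.
  by move=> x _; rewrite mule_ge0 ?lee_fin ?LnormT_ge0.
rewrite leeD2l// ge0_integralZl ?lee_fin//; last by move=> x _; exact: LnormT_ge0.
apply: (@le_trans _ _ (2^-1%:E * (K0%:E * (lam setT `^ 2^-1 *
    LnormDT lam T 2%:E (fun x t => a x t - b x t)%R)))).
  by rewrite !lee_wpmul2l ?lee_fin//; exact: integral_LnormT_diff_le.
rewrite !muleA lee_wpmul2r ?Lnorm_ge0// -(fineK lam2F) -!EFinM lee_fin.
by rewrite ler_wpM2l ?mulr_ge0// le_max lexx orbT.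
Qed.

End potentials_lipschitz.

(** * Posteriors as Radon probability measures *)

Section density_probability.
Local Open Scope ereal_scope.
Context d (T : measurableType d) (R : realType).
Variable mu : {measure set T -> \bar R}.
Variables (f : T -> R) (mf : measurable_fun setT f).
Hypothesis f0 : forall x, (0 <= f x)%R.
Hypothesis f1 : \int[mu]_x (f x)%:E = 1.

HB.instance Definition _ := @Measure_isProbability.Build _ _ _ (density mu mf f0) f1.

Lemma density_probability : exists Q : probability T R,
  forall A, Q A = \int[mu]_(x in A) (f x)%:E.
Proof. by exists (density mu mf f0). Qed.

End density_probability.

(** Continuity is meant in the whole space at each point of A. The preimage of an open ray then
    agrees on A with its interior, which is open however f behaves off A. *)
Lemma measurable_fun_continuous_on (R : realType) (X : ptopologicalType)
    (A : set (borelType X)) (f : X -> R) : measurable A ->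
  (forall u, A u -> {for u, continuous f}) ->
  measurable_fun A (f : borelType X -> R).
Proof.
move=> mA cf _; apply: (measurability _ (RGenOInfty.measurableE R)) => //.
move=> _ [_ [c ->] <-].
rewrite (_ : A `&` f @^-1` `]c, +oo[%classic = A `&` interior (f @^-1` `]c, +oo[%classic)).
  apply: measurableI => //; apply: sub_sigma_algebra; exact: open_interior.
apply/seteqP; split => u [Au fu]; split => //; last exact: interior_subset.
by apply: (cf u Au); apply: open_nbhs_nbhs; split.
Qed.

Section posterior_measure.
Context {R : realType} (X : completeNormedModType R).
Local Open Scope ereal_scope.
Variable pi0 : probability (borelType X) R.

Lemma posterior_radon (hX : exists2 S : set X, countable S & dense S)
    (Phi : X -> \bar R) (N : set (borelType X)) :
  (forall u, 0 <= Phi u < +oo) -> measurable N -> pi0 N = 0 ->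
  (forall u, ~ N u -> {for u, continuous (fine \o Phi)}) ->
  [/\ ae_measurable pi0 (fun u => expeR (- Phi u)),
      0 < normalizer pi0 Phi, normalizer pi0 Phi < +oo &
      exists2 Q : probability (borelType X) R, radon Q &
        forall A : set (borelType X), measurable A -> Q A = posterior pi0 Phi A].
Proof.
move=> Phi0 mN N0 cPhi.
pose f (u : borelType X) : R := expR (- fine (Phi u)).
have fE u : expeR (- Phi u) = (f u)%:E.
  have /andP[P0 Py] := Phi0 u; rewrite /f.
  by case: (Phi u) P0 Py => //= r _ _; rewrite -EFinN.
have mNC : measurable (~` N) by exact: measurableC.
(* Borel version of the likelihood. [f] itself may fail to be Borel on [N], and [intE] exchanges the
   two inside lower integrals. *)
pose g : borelType X -> R := f \_ (~` N).
have mg : measurable_fun setT g.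
  apply/(measurable_restrictT _ _).1 => //.
  apply: measurable_fun_continuous_on => // u Nu.
  apply: (@continuous_comp _ _ _ (fun u => - fine (Phi u))%R expR).
    by apply: cvgN; exact: cPhi.
  exact: continuous_expR.
have g0 u : (0 <= g u)%R by rewrite /g patchE; case: ifPn => // _; exact: expR_ge0.
have fg : {ae pi0, forall u, (f u)%:E = (g u)%:E}.
  exists N; split => // u /= h; apply: contrapT => Nu; apply: h.
  by rewrite /g patchE mem_set.
have intE A : measurable A ->
    \int[pi0]_(u in A) expeR (- Phi u) = \int[pi0]_(u in A) (g u)%:E.
  move=> mA; rewrite [LHS]integral_mkcond [RHS]integral_mkcond.
  apply: ae_eq_lower_integral.
  - by move=> u; apply: erestrict_ge0 => v _; rewrite fE lee_fin expR_ge0.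
  - by move=> u; apply: erestrict_ge0 => v _; rewrite lee_fin.
  by apply: filterS fg => u fgu; rewrite !patchE fE fgu.
have g_le1 u : (g u <= 1)%R.
  rewrite /g patchE; case: ifPn => // _; rewrite /f -expR0 ler_expR oppr_le0.
  by rewrite fine_ge0//; have /andP[] := Phi0 u.
have mge : measurable_fun setT (EFin \o g) by exact/measurable_EFinP.
have Zg : normalizer pi0 Phi = \int[pi0]_u (g u)%:E by exact: intE.
have Z1 : normalizer pi0 Phi <= 1.
  rewrite Zg; apply: (@le_trans _ _ (\int[pi0]_u (cst 1 u))).
    by apply: le_lower_integral => u; rewrite lee_fin.
  rewrite (integral_cst pi0 measurableT 1) mul1e.
  exact: (probability_le1 pi0 measurableT).
have Zy : normalizer pi0 Phi < +oo by apply: le_lt_trans Z1 _; rewrite ltry.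
have Z0 : 0 < normalizer pi0 Phi.
  rewrite lt0e; apply/andP; split; last first.
    by rewrite Zg; apply: integral_ge0 => u _; rewrite lee_fin.
  (* A zero integral would make [g] vanish almost everywhere, whereas it is positive off the null
     set [N]: the whole space would be null. *)
  apply/eqP => Z0.
  have : \int[pi0]_u `|(EFin \o g) u| = 0.
    by rewrite -[RHS]Z0 Zg; apply: eq_integral => u _ /=; rewrite ger0_norm.
  move/(ae_eq_integral_abs pi0 measurableT mge).1 => [N' [mN' N'0 gN']].
  have TN : [set: borelType X] `<=` N `|` N'.
    move=> u _; have [Nu|Nu] := pselect (N u); first by left.
    right; apply: gN' => /= /(_ I) /eqP; rewrite /g patchE mem_set//.
    by rewrite eqe gt_eqF// expR_gt0.
  have NN0 : pi0 (N `|` N') = 0 by exact: null_set_setU.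
  suff : pi0 [set: borelType X] <= 0 by rewrite leNgt (probability_setT pi0) lte01.
  rewrite -NN0; apply: le_measure TN; rewrite inE//; exact: measurableU.
pose z := fine (normalizer pi0 Phi).
have ZF : normalizer pi0 Phi \is a fin_num by rewrite ge0_fin_numE// ltW.
have z0 : (0 < z)%R by rewrite fine_gt0// Z0.
split => //.
  by exists (EFin \o g) => //; apply: filterS fg => u; rewrite fE.
have mgz : measurable_fun setT (fun u => z^-1 * g u)%R by exact: measurable_funM.
have gz0 u : (0 <= z^-1 * g u)%R by rewrite mulr_ge0// invr_ge0 ltW.
have gzE A : measurable A ->
    \int[pi0]_(u in A) (z^-1 * g u)%:E = (z^-1)%:E * \int[pi0]_(u in A) (g u)%:E.
  move=> mA; under eq_integral do rewrite EFinM.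
  rewrite ge0_integralZl//.
  - exact: measurable_funTS.
  - by move=> u _; rewrite lee_fin.
  - by rewrite lee_fin invr_ge0 ltW.
have gz1 : \int[pi0]_u (z^-1 * g u)%:E = 1.
  by rewrite gzE// -Zg -(fineK ZF) -EFinM mulVf// gt_eqF.
have [Q QE] := density_probability mgz gz0 gz1.
exists Q; first exact: polish_radon.
by move=> A mA; rewrite QE gzE// /posterior intE.
Qed.

End posterior_measure.

Section potential_continuity.
Context {R : realType} {X : completeNormedModType R}.
Context {d : measure_display} {D : measurableType d} {p : nat}.
Variable lam : {finite_measure set D -> \bar R}.
Local Open Scope ereal_scope.

Variable T : set 'rV[R]_p.
Hypotheses (cT : compact T) (T_pos : 0 < lebesgue_rV p T).
Variable q : ('rV[R]_p -> R) -> ('rV[R]_p -> R) -> \bar R.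
Hypotheses (q_ge0 : forall a c, 0 <= q a c) (q_stable : stable_on T q).
Variable y : D -> 'rV[R]_p -> R.
Hypothesis hy : Y0 lam T y.
Variable G : X -> D -> 'rV[R]_p -> R.
Hypothesis hG : forall u, Y0 lam T (G u).
Variable RG : R -> R.
Hypothesis RG_incr : forall r s : R, (0 <= r)%R -> (r <= s)%R -> (RG r <= RG s)%R.
Hypothesis G_bound : forall u, LnormDT lam T +oo (G u) <= (RG `|u|)%:E.

(** The constant depends on r because [RG] bounds G on balls of X only; the bound M also covers the
    data y. *)
Lemma potential_locally_lipschitz r : exists2 K : R, (0 <= K)%R &
  forall u v, (`|u| <= r)%R -> (`|v| <= r)%R ->
    potential lam q (G u) y <= K%:E /\
    potential lam q (G u) y <= potential lam q (G v) y +
      K%:E * LnormDT lam T 2%:E (fun x t => G u x t - G v x t)%R.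
Proof.
pose My := fine (LnormDT lam T +oo y).
have yM : LnormDT lam T +oo y <= My%:E.
  by have [_ _ yfin _] := hy; rewrite fineK// ge0_fin_numE ?Lnorm_ge0.
pose M := Num.max (RG r) My.
have M0 : (0 <= M)%R by rewrite le_max fine_ge0 ?orbT// Lnorm_ge0.
have [K K0 KP] := potential_stable lam cT T_pos q_ge0 q_stable M0.
exists K => // u v ur vr; apply: KP => //.
- by apply: le_trans (G_bound u) _; rewrite lee_fin le_max RG_incr.
- by apply: le_trans (G_bound v) _; rewrite lee_fin le_max RG_incr.
- by apply: le_trans yM _; rewrite lee_fin le_max lexx orbT.
Qed.

Lemma potential_fin u : 0 <= potential lam q (G u) y < +oo.
Proof.
rewrite potential_ge0//=; have [K _ KP] := potential_locally_lipschitz `|u|%R.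
by apply: le_lt_trans (KP u u _ _).1 _ => //; rewrite ltry.
Qed.

(** Points near u stay in the ball of radius |u| + 1, where one K serves; the stability estimate is
    used in both orders of u and v. *)
Lemma potential_continuous u : L2_continuous_at lam T G u ->
  {for u, continuous (fine \o (fun v => potential lam q (G v) y))}.
Proof.
move=> Gu; have [K K0 KP] := potential_locally_lipschitz (`|u| + 1)%R.
pose w v := LnormDT lam T 2%:E (fun x t => G v x t - G u x t)%R.
have wC v : w v = LnormDT lam T 2%:E (fun x t => G u x t - G v x t)%R.
  apply: eq_Lnorm => x; rewrite /LnormT -oppe_Lnorm; apply: eq_Lnorm => t /=.
  by rewrite !patchE; case: ifPn => _; rewrite ?oppr0 ?opprB.
have fw : (fine \o w) v @[v --> u] --> 0%R by exact: (fine_cvg Gu).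
have wfin : \forall v \near u, w v \is a fin_num.
  by have /fine_cvgP[] := Gu.
apply/cvgrPdist_le => e e0 /=.
have K1 : (0 < K + 1)%R by rewrite ltr_wpDl.
near=> v.
have vr : (`|v| <= `|u| + 1)%R.
  rewrite -[v](subrK u) (le_trans (ler_normD _ _))// addrC lerD2l distrC.
  by near: v; apply: cvgr_dist_le => //; exact: cvg_id.
have ur : (`|u| <= `|u| + 1)%R by rewrite lerDl.
have wF : w v \is a fin_num by near: v.
have we : (`|fine (w v)| <= e / (K + 1))%R.
  near: v; move/cvgrPdist_le : fw => /(_ (e / (K + 1)))%R.
  rewrite divr_gt0// => /(_ isT); apply: filterS => v.
  by rewrite sub0r normrN.
have w0 : (0 <= fine (w v))%R by rewrite fine_ge0// Lnorm_ge0.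
have := (KP _ _ ur vr).2; have := (KP _ _ vr ur).2; rewrite -wC -/(w v).
have PF v' : potential lam q (G v') y \is a fin_num.
  by have /andP[P0 Py] := potential_fin v'; rewrite ge0_fin_numE.
rewrite -(fineK wF) -(fineK (PF v)) -(fineK (PF u)) -EFinM -!EFinD !lee_fin /=.
have Ke : (K * fine (w v) <= e)%R.
  apply: (@le_trans _ _ ((K + 1) * (e / (K + 1)))%R); last first.
    by rewrite mulrCA divff ?mulr1// gt_eqF.
  by apply: ler_pM => //; rewrite ?lerDl// -[fine (w v)]ger0_norm.
by move=> h1 h2; rewrite ler_norml; apply/andP; split; lra.
Unshelve. all: by end_near. Qed.

End potential_continuity.

Theorem theorem4p4 (R : realType) (X : completeNormedModType R)
    (hX : exists2 S : set X, countable S & dense S)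
    (d : measure_display) (D : measurableType d)
    (lam : {finite_measure set D -> \bar R})
    (p : nat) (hp : (0 < p)%N) (T : set 'rV[R]_p)
    (T_compact : compact T) (T_connected : connected T)
    (T_pos : (0 < lebesgue_rV p T)%E) (T_poincare : poincare T)
    (sigma : R -> R) (sigma_pos : forall r, 0 < sigma r)
    (sigma_lip : forall r : R, exists2 U : set R, nbhs r U & [lipschitz sigma s | s in U])
    (pi0 : probability (borelType X) R)
    (y : D -> 'rV[R]_p -> R) (hy : Y0 lam T y)
    (G : X -> D -> 'rV[R]_p -> R) (hG : forall u, Y0 lam T (G u))
    (G_cont : {ae pi0, forall u, L2_continuous_at lam T G u})
    (RG : R -> R) (RG_ge0 : forall r : R, 0 <= r -> 0 <= RG r)
    (RG_incr : forall r s : R, 0 <= r -> r <= s -> RG r <= RG s)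
    (G_bound : forall u, (LnormDT lam T +oo (G u) <= (RG `|u|)%:E)%E)
    (Phi : (D -> 'rV[R]_p -> R) -> (D -> 'rV[R]_p -> R) -> \bar R)
    (hPhi : [\/ Phi = Phi_L2 lam T, Phi = Phi_Hm1 lam T,
                Phi = Phi_M lam T sigma | Phi = Phi_W2 lam T sigma]) :
  let PhiG := fun u => Phi (G u) y in
  [/\ ae_measurable pi0 (fun u => expeR (- PhiG u)),
      (0 < normalizer pi0 PhiG)%E,
      (normalizer pi0 PhiG < +oo)%E &
      exists2 Q : probability (borelType X) R, radon Q &
        forall A : set (borelType X), measurable A ->
          Q A = posterior pi0 PhiG A].
Proof.
move=> PhiG.
have [N [mN N0 NG]] := G_cont.
have concl q : (forall a c, (0 <= q a c)%E) -> stable_on T q ->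
    Phi = potential lam q ->
    [/\ ae_measurable pi0 (fun u => expeR (- PhiG u)),
      (0 < normalizer pi0 PhiG)%E, (normalizer pi0 PhiG < +oo)%E &
      exists2 Q : probability (borelType X) R, radon Q &
        forall A : set (borelType X), measurable A -> Q A = posterior pi0 PhiG A].
  move=> q0 qs PhiE; rewrite /PhiG PhiE.
  apply: (posterior_radon hX _ mN N0).
    move=> u; exact: (potential_fin T_compact T_pos q0 qs hy hG RG_incr G_bound).
  move=> u Nu; apply: (potential_continuous T_compact T_pos q0 qs hy hG RG_incr G_bound).
  by apply: contrapT => /NG.
have sq0 (x : \bar R) : (0 <= x ^+ 2)%E by exact: sqre_ge0.
(* Each potential unfolds to [potential lam q], with [q] dictated by the stability lemma in use. *)
case: hPhi => PhiE.
- apply: (concl _ _ (stable_L2 T_compact)); last by rewrite PhiE.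
  by move=> a c; exact: sq0.
- apply: (concl _ _ (stable_Hm1 T_compact T_pos T_poincare)); last by rewrite PhiE.
  by move=> a c; exact: sq0.
- apply: (concl _ _ (stable_M T_compact T_pos sigma_pos sigma_lip)); last by rewrite PhiE.
  by move=> a c; exact: sq0.
- apply: (concl _ _ (stable_W2 T_compact T_pos sigma_pos sigma_lip hp)); last by rewrite PhiE.
  by move=> a c; exact: sq0.
Qed.
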